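(* Let $P$ be an ideal right-angled polyhedron in three-dimensional hyperbolic space $\mathbb{H}^3$ with $N \geq 17$ faces, all of whose faces are triangles or quadrilaterals. Then $$ \operatorname{vol}(P) < (N-5)\,\frac{v_8}{2}. $$
   Context: An ideal right-angled polyhedron in $\mathbb{H}^3$ is a convex finite-volume polyhedron in $\mathbb{H}^3$ all of whose vertices lie on the absolute (sphere at infinity $\partial\mathbb{H}^3$) and all of whose dihedral angles equal $\pi/2$. Here $N$ denotes the number of faces of $P$. The number $v_8$ denotes the volume of the ideal right-angled (regular ideal) octahedron in $\mathbb{H}^3$; $v_8 = 8\Lambda(\pi/4) = 3.66386\ldots$, where $\Lambda(\theta) = -\int_0^\theta \log|2\sin t|\,dt$ is the Lobachevsky function. *)

(* Defs.v *)
From HB Require Import structures.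
From mathcomp Require Import all_boot all_order all_algebra.
From mathcomp Require Import all_classical all_reals all_analysis.

Set Implicit Arguments.
Unset Strict Implicit.
Unset Printing Implicit Defensive.

Import Order.TTheory GRing.Theory Num.Theory.
Import numFieldNormedType.Exports.

Local Open Scope classical_set_scope.
Local Open Scope ring_scope.

(* Hyperbolic 3-space is taken in the projective (Klein) model: the open unit
   ball of R^3, with the unit sphere as absolute.  A point x of the ball stands
   for the line through (x, 1) in Minkowski space R^{3,1}, so hyperbolic lines,
   planes and convex sets are the traces on the ball of the affine ones. *)

Section Hyperbolic3.
Variable R : realType.
Implicit Types (x y v : 'rV[R]_3) (h k : 'rV[R]_3 * R) (A P F E : set 'rV[R]_3).

Definition dot x y : R := \sum_(i < 3) x 0 i * y 0 i.

Definition H3 : set 'rV[R]_3 := [set x | dot x x < 1].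

Definition absolute : set 'rV[R]_3 := [set x | dot x x = 1].

(* A vector h = (a, b) of R^{3,1} determines the plane a.x = b; this plane
   meets the ball exactly when h is spacelike. *)
Definition lorentz h k : R := dot h.1 k.1 - h.2 * k.2.

Definition spacelike h := 0 < lorentz h h.

Definition plane h : set 'rV[R]_3 := [set x | H3 x /\ dot h.1 x = h.2].

Definition halfspace h : set 'rV[R]_3 := [set x | H3 x /\ dot h.1 x <= h.2].

(* The set {h, k} of outward normals bounds a wedge whose interior dihedral
   angle is pi minus the Lorentzian angle between the normals. *)
Definition dihedral_angle h k : R :=
  pi - acos (lorentz h k / (Num.sqrt (lorentz h h) * Num.sqrt (lorentz k k))).

Definition vec3 (p : R * (R * R)) : 'rV[R]_3 :=
  \row_(i < 3) [:: p.1; p.2.1; p.2.2]`_i.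

(* The Riemannian volume element of the Klein model in dimension n is
   (1 - |x|^2)^(-(n+1)/2) dx. *)
Definition hvolume A : \bar R :=
  (\int[lebesgue_measure \x (lebesgue_measure \x lebesgue_measure)]_(p in
      [set p | (A `&` H3) (vec3 p)])
    ((1 - dot (vec3 p) (vec3 p)) ^- 2)%:E)%E.

Definition affinely_independent d (x : 'I_d.+1 -> 'rV[R]_3) : bool :=
  row_free (\matrix_(i < d) (x (lift ord0 i) - x ord0)).

Definition has_dimension d A :=
  (exists x : 'I_d.+1 -> 'rV[R]_3, (forall i, A (x i)) /\ affinely_independent x)
  /\ forall x : 'I_d.+2 -> 'rV[R]_3,
       (forall i, A (x i)) -> ~~ affinely_independent x.

Definition polyhedron P :=
  (exists (n : nat) (h : 'I_n -> 'rV[R]_3 * R),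
     (forall i, spacelike (h i)) /\
     P = H3 `&` \bigcap_(i in [set: 'I_n]) halfspace (h i))
  /\ interior P !=set0.

Definition supports d P h :=
  [/\ spacelike h, P `<=` halfspace h & has_dimension d (P `&` plane h)].

Definition face P F := exists2 h, supports 2 P h & F = P `&` plane h.

Definition edge P E := exists2 h, supports 1 P h & E = P `&` plane h.

Definition sides P F : set (set 'rV[R]_3) := [set E | edge P E /\ E `<=` F].

Definition extreme_point A v :=
  A v /\ forall x y (t : R), A x -> A y -> 0 < t < 1 ->
    v = t *: x + (1 - t) *: y -> x = y.

(* Closing up in R^3 adds the ideal points; every ideal point of P is extreme
   in the closure, by strict convexity of the sphere. *)
Definition vertex P v := extreme_point (closure P) v.

Definition right_angled P :=
  forall h k, supports 2 P h -> supports 2 P k ->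
    has_dimension 1 (P `&` plane h `&` plane k) ->
    dihedral_angle h k = pi / 2.

Definition ideal_right_angled_polyhedron P :=
  [/\ polyhedron P, (hvolume P < +oo)%E, vertex P `<=` absolute
    & right_angled P].

Definition triangular P F := (sides P F #= `I_3)%card.

Definition quadrilateral P F := (sides P F #= `I_4)%card.

(* The regular ideal octahedron: the convex hull of the points +e_i and -e_i,
   which lie on the absolute. *)
Definition ideal_octahedron : set 'rV[R]_3 :=
  [set x | H3 x /\ \sum_(i < 3) `|x 0 i| <= 1].

Definition v8 : \bar R := hvolume ideal_octahedron.

End Hyperbolic3.

Arguments v8 : clear implicits.

(* Main.v *)
(* Take an ideal vertex v of P lying on a quadrilateral face, if there is one,
   and cut P into cones with apex v over the faces f not containing v.  In the
   half-space model with v at infinity these faces are hemispheres over discs of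
   radius r_f, which overlap orthogonally along the edges; hence the region over
   f is covered, up to a null set, by pairs of right triangles, one pair for each
   neighbour g of f not containing v, and the part of the cone over each of these
   triangles has a volume half (r_f / r_g) that depends only on the ratio of the
   radii.  Since half k + half (1 / k) <= 2 half 1, and since the octahedron is
   made of 16 pieces of volume half 1,
     vol P <= 2 F half 1 <= F v8 / 8,
   where F is the number of ordered pairs (f, g) of adjacent faces avoiding v.
   The faces through v number m >= 4, each with at most two neighbours through v,
   so counting sides gives F <= 4 N - 5 m <= 4 (N - 5), and the inequality is
   strict because v lies on a quadrilateral, or because all the N >= 17 faces are
   triangles. *)

From HB Require Import structures.
Require Import Defs.
From mathcomp Require Import all_boot all_order all_algebra.
From mathcomp Require Import zify ring lra.
From mathcomp Require Import all_classical all_reals all_analysis.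
From mathcomp Require Import measurable_realfun.

Import Order.TTheory GRing.Theory Num.Theory.
Import numFieldNormedType.Exports.

Local Open Scope classical_set_scope.
Local Open Scope ring_scope.

Set Implicit Arguments.
Unset Strict Implicit.
Unset Printing Implicit Defensive.

(** All estimates are one-sided: [P] is only covered by flags and the octahedron only packed with
    them, so no exact tiling is ever established. Exceptional positions lie on finitely many conics,
    which are discarded line by line: a nonzero conic meets all but finitely many vertical lines in
    a finite set. Stereographic projection from [v] makes the volume over a boundary point rational,
    namely 1 / (2 p) with p the power of the point for the disc of the face below it. Cutting a disc
    along its radical axes with the orthogonal neighbours gives right triangles with angle arctan
    (r_f / r_g) at a point of the circle; integrating along rays from that point removes the
    singularity there. The outcome for k = r_f / r_g is Lambda(pi/2 - arctan k) / 2, with Lambda the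
    Lobachevsky function, so that [half 1] is Lambda(pi/4) / 2. Finite volume enters through one
    fact: the discs cover the shadow of [P] on the boundary plane. Hence every walk in this plane is
    stopped by a face, which yields both the four faces through [v] and the neighbour responsible
    for a given point. *)

(** * Affine changes of variables in one and two real variables *)

Section ChangeOfVariables.
Context {R : realType}.
Local Notation mu := (@lebesgue_measure R).
Local Notation TR := (measurableTypeR R).
Local Open Scope ereal_scope.

Let affine (a b : R) : TR -> TR := fun x => (a * x + b)%R.

Let measurable_affine (a b : R) : measurable_fun [set: TR] (affine a b).
Proof. by apply: measurable_funD => //; apply: measurable_funM. Qed.

Let push (a b : R) : {measure set TR -> \bar R} :=
  measure_function_pushforward__canonical__measure_function_Measure mu (measurable_affine a b).

(** Lebesgue measure is determined by its values on the intervals []c, d]]. For [a < 0] the preimage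
    is half-open on the other side, which does not change its length. *)
Let lebesgue_affine (a b : R) (A : set TR) : a != 0%R -> measurable A ->
  mu A = mscale (NngNum (normr_ge0 a)) (push a b) A.
Proof.
move=> a0 mA; apply: (@lebesgue_measure_unique _
  (mscale (NngNum (normr_ge0 a)) (push a b))) => //=.
move=> _ [[c d]] _ <-; rewrite /mscale /pushforward/= /pushforward /affine /preimage.
have [apos|aneg] := ltP 0%R a.
  have -> : [set t | `]c, d]%classic (a * t + b)%R] = `]((c - b) / a)%R, ((d - b) / a)%R]%classic.
    apply/seteqP; split => x /=; rewrite !in_itv/= ltr_pdivrMr // ler_pdivlMr //; lra.
  rewrite !lebesgue_measure_itv/= !lte_fin ltr_pM2r ?invr_gt0//.
  rewrite ltrD2r; case: ifP => _; last by rewrite mule0.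
  rewrite -!EFinB -EFinM gtr0_norm //; congr EFin; field; lra.
have {}aneg : (a < 0)%R by rewrite lt_neqAle a0.
have -> : [set t | `]c, d]%classic (a * t + b)%R] = `[((d - b) / a)%R, ((c - b) / a)%R[%classic.
  apply/seteqP; split => x /=; rewrite !in_itv/= ltr_ndivlMr // ler_ndivrMr //; lra.
rewrite !lebesgue_measure_itv/= !lte_fin ltr_nM2r ?invr_lt0//.
rewrite ltrD2r; case: ifP => _; last by rewrite mule0.
rewrite -!EFinB -EFinM ltr0_norm //; congr EFin; field; lra.
Qed.

Lemma integral_affine (a b : R) (f : TR -> \bar R) : a != 0%R ->
  measurable_fun setT f -> (forall x, 0 <= f x) ->
  `|a|%:E * \int[mu]_x f (a * x + b)%R = \int[mu]_x f x.
Proof.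
move=> a0 mf f0.
have <- : \int[pushforward mu (affine a b)]_x f x = \int[mu]_x f (affine a b x).
  by rewrite ge0_integral_pushforward //; exact: measurable_affine.
rewrite -[pushforward _ _]/(push a b : set TR -> \bar R).
have := @ge0_integral_mscale _ _ R (push a b) _ measurableT (NngNum (normr_ge0 a)) _ mf (fun x _ => f0 x).
move=> /= <-; apply/esym/eq_measure_integral => A mA _; exact: lebesgue_affine.
Qed.

Lemma integral2_swap (f : R -> R -> \bar R) :
  measurable_fun setT (fun p : TR * TR => f p.1 p.2) -> (forall x y, 0 <= f x y) ->
  \int[mu]_x \int[mu]_y f x y = \int[mu]_y \int[mu]_x f x y.
Proof.
move=> mf f0; exact: (@fubini_tonelli _ _ TR TR R mu mu (fun p => f p.1 p.2)).
Qed.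

Lemma measurable_inner (d : measure_display) (T : measurableType d) (f : T -> R -> \bar R) :
  measurable_fun setT (fun p : T * TR => f p.1 p.2) -> (forall x y, 0 <= f x y) ->
  measurable_fun setT (fun x => \int[mu]_y f x y).
Proof.
move=> mf f0; exact: (@measurable_fun_fubini_tonelli_F _ _ T TR R mu (fun p => f p.1 p.2)).
Qed.

(** Gaussian elimination with pivot [a]: substituting [a * x + b * y] for [x] at fixed [y] turns the
    second argument into [c / a * x + e * y], where [e] is the second pivot, and an affine
    substitution in [y] finishes. *)
Let linear2_neq0 (a b c d : R) (f : R -> R -> \bar R) : a != 0%R ->
  (a * d - b * c != 0)%R ->
  measurable_fun setT (fun p : TR * TR => f p.1 p.2) -> (forall x y, 0 <= f x y) ->
  `|(a * d - b * c)%R|%:E * \int[mu]_x \int[mu]_y f (a * x + b * y)%R (c * x + d * y)%R =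
  \int[mu]_x \int[mu]_y f x y.
Proof.
move=> a0 D0 mf f0.
have mcomp (g h : TR * TR -> TR) : measurable_fun setT g -> measurable_fun setT h ->
    measurable_fun setT (fun p => f (g p) (h p)).
  move=> mg mh; apply: (measurableT_comp mf (g := fun p => (g p, h p))).
  exact: measurable_fun_pair.
have mlin (r s : R) : measurable_fun setT (fun p : TR * TR => (r * p.1 + s * p.2)%R : TR).
  by apply: measurable_funD; apply: measurable_funM.
rewrite integral2_swap //; last exact: mcomp.
pose e := ((a * d - b * c) / a)%R.
have eE : (a * d - b * c = a * e)%R by rewrite /e; field.
have e0 : e != 0%R by rewrite /e mulf_neq0 // invr_neq0.
rewrite eE normrM EFinM muleAC.
transitivity (`|e|%:E * \int[mu]_y \int[mu]_x f x (c / a * x + e * y)%R).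
  rewrite muleC; congr (_ * _).
  rewrite -ge0_integralZl//; last 2 first.
  - apply: measurable_inner => //; apply: mcomp.
    + by apply: measurable_funD; apply: measurable_funM.
    + by apply: measurable_funD; apply: measurable_funM.
  - by move=> y _; apply: integral_ge0.
  apply: eq_integral => y _.
  rewrite -(@integral_affine a (b * y)%R (fun x => f x (c / a * x + e * y)%R)) //.
  - congr (_ * _); apply: eq_integral => x _; congr (f _ _) => //; rewrite /e; field => //.
  - apply: (measurableT_comp (f := fun p : TR * TR => f p.1 (c / a * p.1 + e * p.2)%R) (g := fun x => (x, y))) => //.
    exact: (mcomp fst (fun p => (c / a * p.1 + e * p.2)%R)).
rewrite integral2_swap //; last first.
  apply: (mcomp snd (fun p => (c / a * p.2 + e * p.1)%R)) => //.
  by apply: measurable_funD; apply: measurable_funM.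
rewrite -ge0_integralZl//; last 2 first.
- apply: (measurable_inner (f := fun x y => f x (c / a * x + e * y)%R)) => //.
  exact: (mcomp fst (fun p => (c / a * p.1 + e * p.2)%R)).
- by move=> x _; apply: integral_ge0.
apply: eq_integral => x _.
rewrite -(@integral_affine e (c / a * x)%R (fun y => f x y)) //.
- by congr (_ * _); apply: eq_integral => y _; rewrite addrC.
- exact: (measurableT_comp mf (pair1_measurable x)).
Qed.

Lemma integral2_linear (a b c d : R) (f : R -> R -> \bar R) :
  (a * d - b * c != 0)%R ->
  measurable_fun setT (fun p : TR * TR => f p.1 p.2) -> (forall x y, 0 <= f x y) ->
  `|(a * d - b * c)%R|%:E * \int[mu]_x \int[mu]_y f (a * x + b * y)%R (c * x + d * y)%R =
  \int[mu]_x \int[mu]_y f x y.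
Proof.
have [->|a0] := eqVneq a 0%R; last exact: linear2_neq0.
move=> D0 mf f0.
have c0 : c != 0%R by apply: contraNneq D0 => ->; rewrite mulr0 mul0r subrr.
have mf' : measurable_fun setT (fun p : TR * TR => f p.2 p.1).
  apply: (measurableT_comp mf (g := fun p => (p.2, p.1))); exact: measurable_fun_pair.
rewrite [RHS]integral2_swap //.
(* For [a = 0] the two arguments of [f] are exchanged: the pivot becomes [c], and the determinant
   only changes sign. *)
rewrite -(@linear2_neq0 c d 0%R b (fun x y => f y x)) //; last first.
  by move: D0; rewrite !mul0r mulr0 subr0 sub0r oppr_eq0 mulrC.
by rewrite !mul0r mulr0 sub0r subr0 normrN mulrC.
Qed.

End ChangeOfVariables.

(** * Hyperbolic volume as an iterated integral in Klein coordinates *)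

Section HyperbolicVolume.
Context {R : realType}.
Local Notation mu := (@lebesgue_measure R).
Local Notation TR := (measurableTypeR R).

Definition pt (x y z : R) : 'rV[R]_3 := vec3 (x, (y, z)).

Lemma ptE (x y z : R) : (pt x y z 0 0 = x) * (pt x y z 0 1 = y) * (pt x y z 0 (1 + 1) = z).
Proof. by rewrite /pt /vec3 !mxE. Qed.

Lemma dotE (x y : 'rV[R]_3) :
  dot x y = x 0 0 * y 0 0 + x 0 1 * y 0 1 + x 0 (1 + 1) * y 0 (1 + 1).
Proof.
rewrite /dot !big_ord_recl big_ord0 addr0 addrA.
by congr (_ * _ + _ * _ + _ * _); congr (fun_of_matrix _ _ _); apply/val_inj.
Qed.

Lemma rV3P (x y : 'rV[R]_3) :
  x 0 0 = y 0 0 -> x 0 1 = y 0 1 -> x 0 (1 + 1) = y 0 (1 + 1) -> x = y.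
Proof.
move=> h0 h1 h2; apply/rowP => -[[|[|[|//]]] i].
- by rewrite (_ : Ordinal i = 0) //; apply/val_inj.
- by rewrite (_ : Ordinal i = 1) //; apply/val_inj.
- by rewrite (_ : Ordinal i = 1 + 1) //; apply/val_inj.
Qed.

(** The indicator includes the ball because the integrals run over all of space, and the even power
    is positive outside the closed ball too. *)
Definition hdensity (A : set 'rV[R]_3) (x : 'rV[R]_3) : R :=
  \1_(A `&` @H3 R) x * (1 - dot x x) ^- 2.

Definition borel3 (A : set 'rV[R]_3) :=
  measurable ((fun p : TR * (TR * TR) => vec3 p) @^-1` A).

Definition measurable3 (f : R -> R -> R -> \bar R) :=
  measurable_fun setT (fun p : TR * (TR * TR) => f p.1 p.2.1 p.2.2).

Lemma measurable3_comp d (T : measurableType d) (f : R -> R -> R -> \bar R)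
    (g h k : T -> TR) : measurable3 f ->
  measurable_fun setT g -> measurable_fun setT h -> measurable_fun setT k ->
  measurable_fun setT (fun t => f (g t) (h t) (k t)).
Proof.
move=> mf mg mh mk.
apply: (measurableT_comp mf (g := fun t => (g t, (h t, k t)))).
by apply: measurable_fun_pair => //; exact: measurable_fun_pair.
Qed.

Lemma measurable_H3 : borel3 (@H3 R).
Proof.
rewrite /borel3 -[X in measurable X]setTI.
rewrite (_ : (_ @^-1` _) = (fun p : TR * (TR * TR) => p.1 * p.1 + p.2.1 * p.2.1 + p.2.2 * p.2.2 : TR) @^-1` `]-oo, 1[); last first.
  by apply/seteqP; split=> p; rewrite /H3/= in_itv/= dotE !ptE.
have m21 : measurable_fun setT (fun p : TR * (TR * TR) => p.2.1) by apply: measurableT_comp.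
have m22 : measurable_fun setT (fun p : TR * (TR * TR) => p.2.2) by apply: measurableT_comp.
have : measurable_fun setT (fun p : TR * (TR * TR) => p.1 * p.1 + p.2.1 * p.2.1 + p.2.2 * p.2.2 : TR).
  by do 2?apply: measurable_funD; apply: measurable_funM.
by apply => //; exact: measurable_itv.
Qed.

Lemma measurable_hdensity A : borel3 A ->
  measurable3 (fun x y z => (hdensity A (pt x y z))%:E).
Proof.
move=> mA; apply/measurable_EFinP; rewrite /hdensity.
have m21 : measurable_fun setT (fun p : TR * (TR * TR) => p.2.1) by apply: measurableT_comp.
have m22 : measurable_fun setT (fun p : TR * (TR * TR) => p.2.2) by apply: measurableT_comp.
apply: measurable_funM.
  rewrite (_ : (fun x => _) = \1_((fun p : TR * (TR * TR) => vec3 p) @^-1` (A `&` @H3 R))).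
    by apply: measurable_indic; rewrite preimage_setI; apply: measurableI => //; exact: measurable_H3.
  by apply/funext => -[x [y z]]; rewrite !indicE.
apply: (measurableT_comp (f := fun t : TR => t ^- 2 : TR)).
  rewrite (_ : (fun t => _) = (fun t => (t ^+ 2) `^ (-1))).
    by apply: (measurableT_comp (measurable_powR _)); exact: measurable_funX.
  by apply/funext => t; rewrite powR_inv1 ?sqr_ge0.
under eq_fun do rewrite dotE !ptE.
by apply: measurable_funB => //; do 2?apply: measurable_funD; apply: measurable_funM.
Qed.

Lemma hdensity_ge0 A x : 0 <= hdensity A x.
Proof. by rewrite /hdensity mulr_ge0 // invr_ge0 exprn_even_ge0. Qed.

Local Open Scope ereal_scope.

Lemma integral_mkindic d (T : measurableType d) (m : {measure set T -> \bar R})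
    (D : set T) (g : T -> R) :
  \int[m]_(x in D) (g x)%:E = \int[m]_x (\1_D x * g x)%:E.
Proof.
rewrite integral_mkcond; apply: eq_integral => x _; rewrite patchE indicE.
by case: (x \in D); rewrite ?mul1r ?mul0r.
Qed.

(** The products of the two increasing exhaustions exhaust the product; a pair is caught at the
    larger of its two indices. *)
Lemma sigma_finite_prod d1 d2 (T1 : measurableType d1) (T2 : measurableType d2)
  (m1 : {sigma_finite_measure set T1 -> \bar R})
  (m2 : {sigma_finite_measure set T2 -> \bar R}) : sigma_finite setT (m1 \x m2).
Proof.
have /sigma_finiteP[F [TF ndF Foo]] := sigma_finiteT m1.
have /sigma_finiteP[G [TG ndG Goo]] := sigma_finiteT m2.
exists (fun n => F n `*` G n).
  rewrite -setXTT TF TG; apply/seteqP; split=> -[x y] /=.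
    move=> [[n _ Fnx] [k _ Gky]]; exists (maxn n k) => //; split.
      by move: x Fnx; exact/subsetPset/ndF/leq_maxl.
    by move: y Gky; exact/subsetPset/ndG/leq_maxr.
  by move=> [n _ []/= ? ?]; split; exists n.
move=> k; have [mF Fk] := Foo k; have [mG Gk] := Goo k.
split; first exact: measurableX.
by rewrite product_measure1E// lte_mul_pinfty// ge0_fin_numE.
Qed.

(** Tonelli's theorem in dimension 3 is applied to a first factor and a second factor that is itself
    a product, which must carry a sigma-finite structure. *)
Definition product_sigma_finite d1 d2 (T1 : measurableType d1) (T2 : measurableType d2)
  (m1 : {sigma_finite_measure set T1 -> \bar R})
  (m2 : {sigma_finite_measure set T2 -> \bar R}) :
  {sigma_finite_measure set (T1 * T2)%type -> \bar R} :=
  HB.pack (m1 \x m2)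
    (@Measure_isSigmaFinite.Build _ _ _ (m1 \x m2) (sigma_finite_prod m1 m2)).

Lemma fubini3 d1 d2 d3 (T1 : measurableType d1) (T2 : measurableType d2) (T3 : measurableType d3)
  (m1 : {sigma_finite_measure set T1 -> \bar R})
  (m2 : {sigma_finite_measure set T2 -> \bar R})
  (m3 : {sigma_finite_measure set T3 -> \bar R}) (D : set (T1 * (T2 * T3))%type)
  (g : (T1 * (T2 * T3))%type -> R) :
  measurable_fun setT (fun p => \1_D p * g p)%R -> (forall p, (0 <= g p)%R) ->
  \int[m1 \x (m2 \x m3)]_(p in D) (g p)%:E =
  \int[m1]_x \int[m2]_y \int[m3]_z (\1_D (x, (y, z)) * g (x, (y, z)))%:E.
Proof.
move=> mg g0; pose m23 := product_sigma_finite m2 m3.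
pose m123 : {measure set _ -> \bar R} := m1 \x m23.
have -> : \int[m1 \x (m2 \x m3)]_(p in D) (g p)%:E = \int[m123]_(p in D) (g p)%:E by [].
have g0' p : (0 <= \1_D p * g p)%R by rewrite mulr_ge0.
rewrite integral_mkindic.
rewrite (@fubini_tonelli1 _ _ _ _ _ m1 m23 (fun p => (\1_D p * g p)%:E)); last 2 first.
- exact/measurable_EFinP.
- by move=> p; rewrite lee_fin.
apply: eq_integral => x _; rewrite /fubini_F/=.
rewrite (fubini_tonelli1 (fun q => (\1_D (x, q) * g (x, q))%:E)) //=; last first.
  by move=> p; rewrite lee_fin.
apply/measurable_EFinP; exact: (measurableT_comp mg (pair1_measurable x)).
Qed.

Lemma hvolumeE A : borel3 A ->
  hvolume A = \int[mu]_x \int[mu]_y \int[mu]_z (hdensity A (pt x y z))%:E.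
Proof.
move=> mA; rewrite /hvolume.
rewrite fubini3.
- by [].
- move/measurable_EFinP: (measurable_hdensity mA).
  apply: eq_measurable_fun => -[x [y z]] _ //.
- by move=> p; rewrite invr_ge0 exprn_even_ge0.
Qed.

Lemma I3_rotation (c s : R) (f : R -> R -> R -> \bar R) : (c ^+ 2 + s ^+ 2 = 1)%R ->
  measurable3 f -> (forall x y z, 0 <= f x y z) ->
  \int[mu]_x \int[mu]_y \int[mu]_z f x y z =
  \int[mu]_x \int[mu]_y \int[mu]_z f (c * x - s * y)%R (s * x + c * y)%R z.
Proof.
move=> cs mf f0.
rewrite -(@integral2_linear _ c (- s) s c (fun x y => \int[mu]_z f x y z)).
- rewrite (_ : (c * c - - s * s = 1)%R); last by rewrite -cs; ring.
  by rewrite normr1 mul1e; apply: eq_integral => x _; apply: eq_integral => y _;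
     rewrite mulNr.
- by rewrite (_ : (c * c - - s * s = 1)%R) ?oner_neq0 // -cs; ring.
- apply: (measurable_inner (f := fun q z => f q.1 q.2 z)) => //.
  by apply: measurable3_comp => //; apply: measurableT_comp.
- by move=> x y; apply: integral_ge0.
Qed.

Lemma I3_swap12 (f : R -> R -> R -> \bar R) :
  measurable3 f -> (forall x y z, 0 <= f x y z) ->
  \int[mu]_x \int[mu]_y \int[mu]_z f x y z =
  \int[mu]_y \int[mu]_x \int[mu]_z f x y z.
Proof.
move=> mf f0; apply: integral2_swap.
- apply: (measurable_inner (f := fun q z => f q.1 q.2 z)) => //.
  by apply: measurable3_comp => //; apply: measurableT_comp.
- by move=> x y; apply: integral_ge0.
Qed.

Lemma I3_swap23 (f : R -> R -> R -> \bar R) :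
  measurable3 f -> (forall x y z, 0 <= f x y z) ->
  \int[mu]_x \int[mu]_y \int[mu]_z f x y z =
  \int[mu]_x \int[mu]_z \int[mu]_y f x y z.
Proof.
move=> mf f0; apply: eq_integral => x _; apply: integral2_swap => //.
exact: measurable3_comp.
Qed.

End HyperbolicVolume.

(** * Volume in stereographic coordinates from an ideal point *)

Section ConeFormula.
Context {R : realType}.
Local Notation mu := (@lebesgue_measure R).
Local Notation TR := (measurableTypeR R).
Implicit Types (v e : 'rV[R]_3) (A : set 'rV[R]_3).

(* In the half-space model with [v] at infinity, [w] is the coordinate on the
   boundary plane and [l] runs along the geodesic from [v] to [w]. *)
Definition cone_pt v (e1 e2 : 'rV[R]_3) (w1 w2 l : R) : 'rV[R]_3 :=
  v + l *: (w1 *: e1 + w2 *: e2 - v).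

(** On the ray, 1 - |x|^2 = l (2 - l (1 + |w|^2)), so the Jacobian [l ^+ 2] of [cone_pt] cancels the
    factor [l ^- 2] of the Klein density. What remains is regular at [v], and the absolute is
    reached at l = 2 / (1 + |w|^2). *)
Definition cone_density A v (e1 e2 : 'rV[R]_3) (w1 w2 l : R) : R :=
  \1_(A `&` @H3 R) (cone_pt v e1 e2 w1 w2 l) * (2 - l * (1 + w1 ^+ 2 + w2 ^+ 2)) ^- 2.

Definition frame v (e1 e2 : 'rV[R]_3) :=
  [/\ dot v v = 1, dot e1 e1 = 1 & dot e2 e2 = 1] /\
  [/\ dot e1 e2 = 0, dot e1 v = 0 & dot e2 v = 0].

Lemma dotC (x y : 'rV[R]_3) : dot x y = dot y x.
Proof. by rewrite !dotE; ring. Qed.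

Lemma dotDl (x y z : 'rV[R]_3) : dot (x + y) z = dot x z + dot y z.
Proof. by rewrite !dotE !mxE; ring. Qed.

Lemma dotZl (k : R) (x z : 'rV[R]_3) : dot (k *: x) z = k * dot x z.
Proof. by rewrite !dotE !mxE; ring. Qed.

Lemma dotNl (x z : 'rV[R]_3) : dot (- x) z = - dot x z.
Proof. by rewrite !dotE !mxE; ring. Qed.

Lemma dotDr (x y z : 'rV[R]_3) : dot z (x + y) = dot z x + dot z y.
Proof. by rewrite !dotE !mxE; ring. Qed.

Lemma dotZr (k : R) (x z : 'rV[R]_3) : dot z (k *: x) = k * dot z x.
Proof. by rewrite !dotE !mxE; ring. Qed.

Lemma dotNr (x z : 'rV[R]_3) : dot z (- x) = - dot z x.
Proof. by rewrite !dotE !mxE; ring. Qed.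

Definition dotL := (dotDl, dotDr, dotZl, dotZr, dotNl, dotNr).

Lemma dot_frame v e1 e2 (Y X Z : R) : frame v e1 e2 ->
  dot (Y *: e1 + X *: e2 + Z *: v) (Y *: e1 + X *: e2 + Z *: v) =
  Y ^+ 2 + X ^+ 2 + Z ^+ 2.
Proof.
move=> [[vv e11 e22] [e12 e1v e2v]]; rewrite !dotL.
by rewrite (dotC v e1) (dotC v e2) (dotC e2 e1) vv e11 e22 e12 e1v e2v; ring.
Qed.

(** These points form the plane tangent to the absolute at [v]. *)
Lemma frame_notin_H3 v e1 e2 (Y X : R) : frame v e1 e2 ->
  ~ H3 (Y *: e1 + X *: e2 + 1 *: v).
Proof. by move=> fr; rewrite /H3/= dot_frame //; have := sqr_ge0 Y; have := sqr_ge0 X; lra. Qed.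

Lemma dot_cone_pt v e1 e2 w1 w2 l : frame v e1 e2 ->
  1 - dot (cone_pt v e1 e2 w1 w2 l) (cone_pt v e1 e2 w1 w2 l) =
  l * (2 - l * (1 + w1 ^+ 2 + w2 ^+ 2)).
Proof.
move=> [[vv e11 e22] [e12 e1v e2v]]; rewrite /cone_pt !dotL.
by rewrite (dotC v e1) (dotC v e2) (dotC e2 e1) vv e11 e22 e12 e1v e2v; ring.
Qed.

Lemma hdensity_out A x : ~ H3 x -> hdensity A x = 0.
Proof. by move=> nx; rewrite /hdensity indicE memNset ?mul0r // => -[]. Qed.

Lemma hdensity_cone A v e1 e2 w1 w2 l : frame v e1 e2 ->
  l ^+ 2 * hdensity A ((l * w1) *: e1 + (l * w2) *: e2 + (1 - l) *: v) =
  cone_density A v e1 e2 w1 w2 l.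
Proof.
move=> fr; rewrite /hdensity.
rewrite (_ : _ + _ + _ = cone_pt v e1 e2 w1 w2 l); last first.
  by rewrite /cone_pt; apply/rowP => k; rewrite !mxE; ring.
rewrite dot_cone_pt // /cone_density mulrCA.
have [->|l0] := eqVneq l 0; last first.
  congr (_ * _); by rewrite exprMn invfM mulrA mulfV ?mul1r // expf_neq0.
(* At [l = 0] the point is [v] itself, which is ideal, so both sides vanish. *)
rewrite indicE memNset ?mul0r // => -[_]; rewrite /H3/= /cone_pt scale0r addr0.
by move: fr => [[-> _ _] _]; rewrite ltxx.
Qed.

Lemma measurable_lin3 (a b c d : R) :
  measurable_fun setT (fun p : TR * (TR * TR) => a * p.1 + b * p.2.1 + c * p.2.2 + d : TR).
Proof.
have m21 : measurable_fun setT (fun p : TR * (TR * TR) => p.2.1) by apply: measurableT_comp.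
have m22 : measurable_fun setT (fun p : TR * (TR * TR) => p.2.2) by apply: measurableT_comp.
by do 3?apply: measurable_funD => //; apply: measurable_funM.
Qed.

Lemma measurable_proj1 : measurable_fun setT (fun p : TR * (TR * TR) => p.1 : TR).
Proof. exact: measurable_fst. Qed.

Lemma measurable_proj2 : measurable_fun setT (fun p : TR * (TR * TR) => p.2.1 : TR).
Proof. by apply: measurableT_comp. Qed.

Lemma measurable_proj3 : measurable_fun setT (fun p : TR * (TR * TR) => p.2.2 : TR).
Proof. by apply: measurableT_comp. Qed.

Lemma measurable_lin2 (a b c : R) :
  measurable_fun setT (fun p : TR * TR => a * p.1 + b * p.2 + c : TR).
Proof. by do 2?apply: measurable_funD => //; apply: measurable_funM. Qed.

Lemma measurable_cone_pt A v e1 e2 : borel3 A ->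
  measurable ((fun p : TR * (TR * TR) => cone_pt v e1 e2 p.1 p.2.1 p.2.2) @^-1` A).
Proof.
move=> mA.
pose g (k : 'I_3) (p : TR * (TR * TR)) : TR := cone_pt v e1 e2 p.1 p.2.1 p.2.2 0 k.
have m21 : measurable_fun setT (fun p : TR * (TR * TR) => p.2.1) by apply: measurableT_comp.
have m22 : measurable_fun setT (fun p : TR * (TR * TR) => p.2.2) by apply: measurableT_comp.
have mg k : measurable_fun setT (g k).
  rewrite /g /cone_pt.
  rewrite (_ : (fun p => _) = (fun p : TR * (TR * TR) =>
     v 0 k + p.2.2 * (p.1 * e1 0 k + p.2.1 * e2 0 k - v 0 k))); last first.
    by apply/funext => p; rewrite !mxE.
  apply: measurable_funD => //; apply: measurable_funM => //.
  by apply: measurable_funB => //; apply: measurable_funD; apply: measurable_funM.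
have mG : measurable_fun setT (fun p => (g 0 p, (g 1 p, g (1 + 1) p))).
  by apply: measurable_fun_pair => //; apply: measurable_fun_pair.
have := mG measurableT _ mA; rewrite setTI; congr measurable.
apply/seteqP; split => p /=; rewrite (_ : vec3 _ = cone_pt v e1 e2 p.1 p.2.1 p.2.2) //;
  by apply: rV3P; rewrite -[vec3 _]/(pt (g 0 p) (g 1 p) (g (1 + 1) p)) ptE.
Qed.

Lemma cone_density_ge0 A v e1 e2 w1 w2 l : 0 <= cone_density A v e1 e2 w1 w2 l.
Proof. by rewrite /cone_density mulr_ge0 // invr_ge0 exprn_even_ge0. Qed.

Lemma measurable_expNn2 : measurable_fun setT (fun t : TR => t ^- 2 : TR).
Proof.
rewrite (_ : (fun t => _) = (fun t => (t ^+ 2) `^ (-1))).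
  by apply: (measurableT_comp (measurable_powR _)); exact: measurable_funX.
by apply/funext => t; rewrite powR_inv1 ?sqr_ge0.
Qed.

Lemma measurable_cone_density A v e1 e2 : borel3 A ->
  measurable3 (fun w1 w2 l => (cone_density A v e1 e2 w1 w2 l)%:E).
Proof.
move=> mA; apply/measurable_EFinP; rewrite /cone_density.
have m21 : measurable_fun setT (fun p : TR * (TR * TR) => p.2.1) by apply: measurableT_comp.
have m22 : measurable_fun setT (fun p : TR * (TR * TR) => p.2.2) by apply: measurableT_comp.
apply: measurable_funM.
  rewrite (_ : (fun x => _) =
      \1_((fun p : TR * (TR * TR) => cone_pt v e1 e2 p.1 p.2.1 p.2.2) @^-1` (A `&` @H3 R))).
    apply: measurable_indic; apply: measurable_cone_pt; rewrite /borel3 preimage_setI.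
    by apply: measurableI => //; exact: measurable_H3.
  by apply/funext => -[x [y z]]; rewrite !indicE.
apply: (measurableT_comp measurable_expNn2).
apply: measurable_funB => //; apply: measurable_funM => //.
by do 2?apply: measurable_funD => //; exact: measurable_funX.
Qed.

Let polar (x y : R) : exists r c s : R, [/\ c ^+ 2 + s ^+ 2 = 1, x = r * c & y = r * s].
Proof.
pose r := Num.sqrt (x ^+ 2 + y ^+ 2).
have rr : r ^+ 2 = x ^+ 2 + y ^+ 2 by rewrite sqr_sqrtr // addr_ge0 // sqr_ge0.
have [r0|r0] := eqVneq r 0.
  exists 0, 1, 0; rewrite !mul0r expr1n expr0n addr0.
  have : x ^+ 2 + y ^+ 2 = 0 by rewrite -rr r0 expr0n.
  by move/eqP; rewrite paddr_eq0 ?sqr_ge0 // !sqrf_eq0 => /andP[/eqP -> /eqP ->].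
exists r, (x / r), (y / r); split; try field => //.
by rewrite !expr_div_n -mulrDl -rr mulfV // expf_neq0.
Qed.

Local Open Scope ereal_scope.

(** Two plane rotations, one about the third axis and one in a plane containing it, carry the third
    axis to (r c, r s, z); thus the planar change of variables suffices in space. *)
Lemma I3_euler_angles (c s r z : R) (F : R -> R -> R -> \bar R) :
  (c ^+ 2 + s ^+ 2 = 1)%R -> (r ^+ 2 + z ^+ 2 = 1)%R ->
  measurable3 F -> (forall x y t, 0 <= F x y t) ->
  \int[mu]_x \int[mu]_y \int[mu]_t F x y t =
  \int[mu]_Z \int[mu]_Y \int[mu]_X
    F (c * (z * X + r * Z) - s * Y)%R (s * (z * X + r * Z) + c * Y)%R (- r * X + z * Z)%R.
Proof.
move=> cs rz mF F0.
have mlin1 (a b e : R) : measurable_fun setT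
    (fun p : TR * (TR * TR) => a * p.1 + b * p.2.1 + e * p.2.2 : TR)%R.
  by apply: eq_measurable_fun (measurable_lin3 a b e 0) => p _; rewrite addr0.
have mG : measurable3 (fun Y X Z =>
    F (c * (z * X + r * Z) - s * Y)%R (s * (z * X + r * Z) + c * Y)%R (- r * X + z * Z)%R).
  apply: (measurable3_comp mF).
  - apply: eq_measurable_fun (mlin1 (- s) (c * z) (c * r))%R => p _; ring.
  - apply: eq_measurable_fun (mlin1 c (s * z) (s * r))%R => p _; ring.
  - apply: eq_measurable_fun (mlin1 0 (- r) z)%R => p _; ring.
transitivity (\int[mu]_Y \int[mu]_X \int[mu]_Z
    F (c * (z * X + r * Z) - s * Y)%R (s * (z * X + r * Z) + c * Y)%R (- r * X + z * Z)%R).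
  have E1 := @I3_rotation _ c s F cs mF F0.
  etransitivity; first exact: E1.
  have E2 := @I3_swap12 _ (fun x y t => F (c * x - s * y) (s * x + c * y) t)%R.
  etransitivity; first apply: E2.
  - apply: (measurable3_comp mF).
    + apply: eq_measurable_fun (mlin1 c (- s) 0)%R => p _; ring.
    + apply: eq_measurable_fun (mlin1 s c 0)%R => p _; ring.
    + by apply: measurableT_comp.
  - by move=> *; apply: F0.
  apply: eq_integral => Y _ /=.
  have D : (z * z - r * - r = 1)%R by rewrite -rz; ring.
  have E3 := @integral2_linear _ z r (- r) z (fun x t => F (c * x - s * Y) (s * x + c * Y) t)%R.
  rewrite -E3; last 3 first.
  - by rewrite D oner_neq0.
  - apply: (measurable3_comp mF).
    + apply: eq_measurable_fun (measurable_lin2 c 0 (- (s * Y)))%R => p _; ring.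
    + apply: eq_measurable_fun (measurable_lin2 s 0 (c * Y))%R => p _; ring.
    + exact: measurable_snd.
  - by move=> *; apply: F0.
  by rewrite D normr1 mul1e.
have E4 := @I3_swap23 _ _ mG.
etransitivity; first by apply: E4 => *; apply: F0.
apply: (@I3_swap12 _ (fun Y Z X =>
    F (c * (z * X + r * Z) - s * Y)%R (s * (z * X + r * Z) + c * Y)%R (- r * X + z * Z)%R)).
- exact: (measurable3_comp mG measurable_proj1 measurable_proj3 measurable_proj2).
- by move=> *; apply: F0.
Qed.

Let sqnorm (x : R) : (x ^+ 2 = `|x * x|)%R.
Proof. by rewrite -expr2 ger0_norm // sqr_ge0. Qed.

Lemma ge0_integral_scale (k : R) (f : TR -> \bar R) : (0 <= k)%R ->
  measurable_fun setT f -> (forall x, 0 <= f x) ->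
  k%:E * \int[mu]_x f x = \int[mu]_x (k%:E * f x).
Proof. by move=> k0 mf f0; rewrite ge0_integralZl. Qed.

(** Each slice [Z = 1 - l] is rescaled by [l] in both directions, whence the Jacobian [l ^+ 2]. The
    scaling degenerates on the slice [l = 0], where [G] is assumed to vanish. *)
Lemma I3_homothety (G : R -> R -> R -> \bar R) :
  measurable3 G -> (forall Y X Z, 0 <= G Y X Z) -> (forall Y X, G Y X 1%R = 0) ->
  \int[mu]_Z \int[mu]_Y \int[mu]_X G Y X Z =
  \int[mu]_Y \int[mu]_X \int[mu]_l ((l ^+ 2)%:E * G (l * Y)%R (l * X)%R (1 - l)%R).
Proof.
move=> mG G0 G1.
have mG1 : measurable_fun setT (fun Z => \int[mu]_Y \int[mu]_X G Y X Z).
  apply: (measurable_inner (f := fun Z Y => \int[mu]_X G Y X Z)); last first.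
    by move=> *; apply: integral_ge0.
  apply: (measurable_inner (f := fun q X => G q.2 X q.1)); last by move=> *; apply: G0.
  apply: (measurable3_comp mG); last by apply: measurableT_comp.
  - by apply: measurableT_comp.
  - exact: measurable_snd.
have mc : measurable3 (fun Y X l => (l ^+ 2)%:E * G (l * Y)%R (l * X)%R (1 - l)%R).
  apply: emeasurable_funM.
    apply/measurable_EFinP.
    have := measurable_funX 2 measurable_proj3.
    exact.
  apply: (measurable3_comp mG).
  - exact: (measurable_funM measurable_proj3 measurable_proj1).
  - exact: (measurable_funM measurable_proj3 measurable_proj2).
  - apply: eq_measurable_fun (measurable_lin3 0 0 (- 1) 1)%R => p _; ring.
have c0 Y X l : 0 <= (l ^+ 2)%:E * G (l * Y)%R (l * X)%R (1 - l)%R.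
  by rewrite mule_ge0 // lee_fin sqr_ge0.
have E1 := @I3_swap23 _ _ mc c0.
apply: esym; etransitivity; first exact: E1.
have E2 := @I3_swap12 _ (fun Y l X => (l ^+ 2)%:E * G (l * Y)%R (l * X)%R (1 - l)%R).
etransitivity; first apply: E2.
- exact: (measurable3_comp mc measurable_proj1 measurable_proj3 measurable_proj2).
- by move=> *; apply: c0.
rewrite -(@integral_affine _ (- 1) 1 _ _ mG1); last 2 first.
- by rewrite oppr_eq0 oner_neq0.
- by move=> Z; apply: integral_ge0 => Y _; apply: integral_ge0.
rewrite normrN normr1 mul1e; apply: eq_integral => l _.
rewrite (_ : (-1 * l + 1 = 1 - l)%R); last ring.
have [->|l0] := eqVneq l 0%R.
  transitivity (0%E : \bar R).
    by apply: integral0_eq => Y _; apply: integral0_eq => X _; rewrite expr0n mul0e.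
  apply: esym; apply: integral0_eq => Y _; apply: integral0_eq => X _.
  by rewrite subr0 G1.
have E3 := @integral2_linear _ l 0 0 l (fun Y X => G Y X (1 - l)%R).
rewrite -E3; last 3 first.
- by rewrite mul0r subr0 mulf_neq0.
- exact: (measurable3_comp mG measurable_fst measurable_snd (measurable_cst _)).
- by move=> *; apply: G0.
rewrite mul0r subr0.
have mg' : measurable_fun setT (fun p : TR * TR => G (l * p.1) (l * p.2) (1 - l))%R.
  apply: (measurable3_comp mG); last exact: measurable_cst.
  - by apply: eq_measurable_fun (measurable_lin2 l 0 0) => p _; rewrite mul0r !addr0.
  - by apply: eq_measurable_fun (measurable_lin2 0 l 0) => p _; rewrite mul0r add0r !addr0.
under [in RHS]eq_integral do under eq_integral do rewrite !mul0r addr0 add0r.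
have E5 := @ge0_integral_scale `|(l * l)%R| (fun Y => \int[mu]_X G (l * Y)%R (l * X)%R (1 - l)%R).
rewrite E5; last 3 first.
- exact: normr_ge0.
- apply: (measurable_inner (f := fun Y X => G (l * Y) (l * X) (1 - l))%R mg').
  by move=> *; apply: G0.
- by move=> Y; apply: integral_ge0 => X _; apply: G0.
apply: eq_integral => Y _.
have E6 := @ge0_integral_scale `|(l * l)%R| (fun X => G (l * Y)%R (l * X)%R (1 - l)%R).
rewrite E6; last 3 first.
- exact: normr_ge0.
- exact: (measurableT_comp mg' (pair1_measurable Y)).
- by move=> X; apply: G0.
apply: eq_integral => X _; congr (_%:E * _).
exact: (sqnorm l).
Qed.

Lemma hvolume_euler_frame (c s r z : R) A :
  (c ^+ 2 + s ^+ 2 = 1)%R -> (r ^+ 2 + z ^+ 2 = 1)%R -> borel3 A ->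
  let v := pt (r * c) (r * s) z in
  let e1 := pt (- s) c 0 in let e2 := pt (c * z) (s * z) (- r) in
  frame v e1 e2 /\
  hvolume A = \int[mu]_w1 \int[mu]_w2 \int[mu]_l (cone_density A v e1 e2 w1 w2 l)%:E.
Proof.
move=> cs rz mA v e1 e2.
have v0 : v 0%R 0%R = (r * c)%R by rewrite ptE.
have v1 : v 0%R 1%R = (r * s)%R by rewrite ptE.
have vz : v 0%R (1 + 1)%R = z by rewrite ptE.
have vv : dot v v = 1%R.
  rewrite dotE v0 v1 vz; transitivity (r ^+ 2 * (c ^+ 2 + s ^+ 2) + z ^+ 2)%R; first ring.
  by rewrite cs mulr1.
have fr : frame v e1 e2.
  split; split => //; rewrite dotE !ptE.
  - by rewrite -cs; ring.
  - transitivity ((c ^+ 2 + s ^+ 2) * z ^+ 2 + r ^+ 2)%R; first ring.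
    by rewrite cs mul1r addrC.
  - ring.
  - ring.
  - transitivity ((c ^+ 2 + s ^+ 2 - 1) * z * r)%R; first ring.
    by rewrite cs subrr !mul0r.
split=> //; rewrite (hvolumeE mA).
have mh := measurable_hdensity mA.
have E1 := @I3_euler_angles c s r z _ cs rz mh.
etransitivity; first by apply: E1 => *; rewrite lee_fin hdensity_ge0.
pose g (Y X Z : R) : 'rV[R]_3 := (Y *: e1 + X *: e2 + Z *: v)%R.
have gE Y X Z : g Y X Z = pt (c * (z * X + r * Z) - s * Y) (s * (z * X + r * Z) + c * Y) (- r * X + z * Z).
  have gk k : g Y X Z 0%R k = (Y * e1 0 k + X * e2 0 k + Z * v 0 k)%R by rewrite !mxE.
  by apply: rV3P; rewrite gk ?v0 ?v1 ?vz !ptE; ring.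
pose G Y X Z := (hdensity A (g Y X Z))%:E.
have mlin1 (a b d : R) : measurable_fun setT
    (fun p : TR * (TR * TR) => a * p.1 + b * p.2.1 + d * p.2.2 : TR)%R.
  by apply: eq_measurable_fun (measurable_lin3 a b d 0) => p _; rewrite addr0.
have mG : measurable3 G.
  rewrite /measurable3 /G; under eq_fun do rewrite gE.
  apply: (measurable3_comp mh).
  - apply: eq_measurable_fun (mlin1 (- s) (c * z) (c * r))%R => p _; ring.
  - apply: eq_measurable_fun (mlin1 c (s * z) (s * r))%R => p _; ring.
  - apply: eq_measurable_fun (mlin1 0 (- r) z)%R => p _; ring.
transitivity (\int[mu]_Z \int[mu]_Y \int[mu]_X G Y X Z).
  by do 3![apply: eq_integral => ? _]; rewrite /G gE.
etransitivity; first apply: (@I3_homothety _ mG).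
- by move=> *; rewrite lee_fin hdensity_ge0.
- by move=> Y X; rewrite /G (hdensity_out A (@frame_notin_H3 v e1 e2 Y X fr)).
apply: eq_integral => Y _; apply: eq_integral => X _; apply: eq_integral => l _.
by rewrite /G /g -EFinM (hdensity_cone A Y X l fr).
Qed.

Lemma hvolume_cone v : dot v v = 1%R -> exists e1 e2, frame v e1 e2 /\
  forall A, borel3 A -> hvolume A =
    \int[mu]_w1 \int[mu]_w2 \int[mu]_l (cone_density A v e1 e2 w1 w2 l)%:E.
Proof.
move=> vv; have [r [c [s [cs v0 v1]]]] := polar (v 0%R 0%R) (v 0%R 1%R).
set z := v 0%R (1 + 1)%R.
have rz : (r ^+ 2 + z ^+ 2 = 1)%R.
  transitivity (r ^+ 2 * (c ^+ 2 + s ^+ 2) + z ^+ 2)%R; first by rewrite cs mulr1.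
  by rewrite -vv dotE v0 v1 -/z; ring.
have vE : v = pt (r * c) (r * s) z by apply: rV3P; rewrite ptE.
exists (pt (- s) c 0), (pt (c * z) (s * z) (- r)); rewrite vE; split.
  by have [] := @hvolume_euler_frame c s r z _ cs rz (@measurable_H3 R).
by move=> A mA; have [] := hvolume_euler_frame cs rz mA.
Qed.

End ConeFormula.

(** * Derivatives, monotonicity and primitives of real functions *)

Section RealCalculus.
Context {R : realType}.
Local Notation mu := (@lebesgue_measure R).
Local Notation der x f d := (is_derive (x : R) (1 : R) (f : R -> R) (d : R)).
Implicit Types (f g F : R -> R).

Lemma der_eq f (x a b : R) : der x f a -> a = b -> der x f b.
Proof. by move=> fa <-. Qed.

Lemma der_cst (c x : R) : der x (fun=> c) 0.
Proof. exact: is_derive_cst. Qed.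

Lemma der_id (x : R) : der x (fun y => y) 1.
Proof. exact: is_derive_id. Qed.

Lemma der_add f g (x a b : R) : der x f a -> der x g b -> der x (fun y => f y + g y) (a + b).
Proof. by move=> fa gb; exact: is_deriveD. Qed.

Lemma der_opp f (x a : R) : der x f a -> der x (fun y => - f y) (- a).
Proof. by move=> fa; exact: is_deriveN. Qed.

Lemma der_mul f g (x a b : R) : der x f a -> der x g b ->
  der x (fun y => f y * g y) (f x * b + g x * a).
Proof. by move=> fa gb; exact: is_deriveM. Qed.

Lemma der_inv f (x a : R) : der x f a -> f x != 0 -> der x (fun y => (f y)^-1) (- (f x) ^- 2 * a).
Proof. by move=> fa fx; exact: is_deriveV. Qed.

Lemma der_comp f g (x a b : R) : der (g x) f a -> der x g b -> der x (fun y => f (g y)) (a * b).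
Proof. by move=> fa gb; exact: is_derive1_comp. Qed.

Lemma der_ln g (x b : R) : der x g b -> 0 < g x -> der x (fun y => ln (g y)) ((g x)^-1 * b).
Proof. by move=> gb g0; apply: der_comp => //; exact: is_derive1_ln. Qed.

Lemma der_continuous f (x a : R) : der x f a -> {for x, continuous f}.
Proof. by case=> fa _; apply/differentiable_continuous/derivable1_diffP. Qed.

Lemma der_within f (df : R -> R) (a b : R) :
  (forall x, a <= x <= b -> der x f (df x)) -> {within `[a, b], continuous f}.
Proof.
move=> fd; apply: derivable_within_continuous => x; rewrite in_itv/= => xab.
by case: (fd _ xab).
Qed.

Lemma der_ndecr f (df : R -> R) (a b : R) : a <= b ->
  (forall x, a <= x <= b -> der x f (df x)) -> (forall x, a <= x <= b -> 0 <= df x) ->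
  f a <= f b.
Proof.
move=> ab fd d0.
have h1 x : x \in `]a, b[%R -> der x f (df x).
  by rewrite in_itv/= => /andP[ax xb]; apply: fd; rewrite !ltW.
have [c] := MVT_segment ab h1 (der_within fd).
rewrite in_itv/= => cab e; rewrite -subr_ge0 e mulr_ge0 ?subr_ge0 //.
exact: d0.
Qed.

Lemma der_constant f (a b : R) : a <= b -> (forall x, a <= x <= b -> der x f 0) -> f a = f b.
Proof.
move=> ab fd; apply/eqP; rewrite eq_le; apply/andP; split.
  exact: (der_ndecr ab fd).
rewrite -lerN2; apply: (@der_ndecr (fun x => - f x) (fun=> 0) a b) => // x xab.
by rewrite -oppr0; apply: der_opp; exact: fd.
Qed.

Lemma integral_der f F (a b : R) : a <= b ->
  (forall x, a <= x <= b -> der x F (f x)) ->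
  (forall x, a <= x <= b -> {for x, continuous f}) ->
  (\int[mu]_(x in `[a, b]) (f x)%:E = (F b - F a)%:E)%E.
Proof.
move=> ab Fd fc; have [abE|ltab] := eqVneq a b.
  by rewrite abE subrr set_itv1 integral_set1.
rewrite (@continuous_FTC2 _ f F) //.
- by rewrite lt_neqAle ltab.
- apply: continuous_in_subspaceT => x; rewrite inE/= in_itv/=; exact: fc.
- split.
  + by move=> x; rewrite in_itv/= => /andP[ax xb]; have := Fd x; rewrite !ltW // => /(_ isT) [].
  + by apply: cvg_at_right_filter; apply: der_continuous; apply: Fd; rewrite lexx ab.
  + by apply: cvg_at_left_filter; apply: der_continuous; apply: Fd; rewrite lexx ab.
- move=> x; rewrite in_itv/= => /andP[ax xb]; have := Fd x; rewrite !ltW // => /(_ isT) ?.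
  by rewrite derive1E derive_val.
Qed.

Lemma integral_indic_der f F (a b : R) : a <= b ->
  (forall x, a <= x <= b -> der x F (f x)) ->
  (forall x, a <= x <= b -> {for x, continuous f}) ->
  (\int[mu]_x (\1_(`[a, b]%classic) x * f x)%:E = (F b - F a)%:E)%E.
Proof. by move=> ab Fd fc; rewrite -(integral_der ab Fd fc) -integral_mkindic. Qed.

Definition primitive f (a x : R) : R := \int[mu]_(t in `[a, x]) f t.

Lemma der_primitive f (a x : R) : continuous f -> a < x -> der x (primitive f a) (f x).
Proof.
move=> cf ax; have xu : x < x + 1 by rewrite ltrDl.
have [||dF F'] := @continuous_FTC1_closed R f a x (x + 1) xu _ ax.
- apply: continuous_compact_integrable; first exact: segment_compact.
  exact: continuous_subspaceT.
- exact: cf.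
by apply: DeriveDef; [exact: dF|rewrite -F' derive1E].
Qed.

(** The sum has derivative f y - f (- y) = 0, so it keeps its value at 0: up to a constant, a
    primitive of an even function is odd. *)
Lemma primitive_odd f (a x : R) : continuous f -> (forall y, f (- y) = f y) ->
  0 <= x -> a < - x -> primitive f a x + primitive f a (- x) = 2 * primitive f a 0.
Proof.
move=> cf fe x0 ax.
have E : primitive f a 0 + primitive f a (- 0) = primitive f a x + primitive f a (- x).
  apply: (@der_constant (fun y => primitive f a y + primitive f a (- y)) 0 x x0) => y /andP[y0 yx].
  have h1 : der y (primitive f a) (f y) by apply: der_primitive => //; lra.
  have h2 : der (- y) (primitive f a) (f y) by rewrite -fe; apply: der_primitive => //; lra.
  have h3 := der_add h1 (der_comp h2 (der_opp (der_id y))).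
  by rewrite (_ : 0 = f y + f y * - 1) //; ring.
by rewrite -E oppr0; ring.
Qed.

End RealCalculus.

(** * The flag volume as a Lobachevsky integral *)

Section TriangleVolume.
Context {R : realType}.
Local Notation mu := (@lebesgue_measure R).
Local Notation der x f d := (is_derive (x : R) (1 : R) (f : R -> R) (d : R)).

(** With s = tan x, [gL s] ds is ln (2 cos x) dx and [hL s] ds is - ln (cos x) dx: the Lobachevsky
    integrand, written without trigonometric functions. *)
Definition gL (s : R) : R := (ln 2 - 2^-1 * ln (1 + s * s)) * (1 + s * s)^-1.
Definition hL (s : R) : R := (2^-1 * ln (1 + s * s)) * (1 + s * s)^-1.

Let sq1_gt0 (s : R) : 0 < 1 + s * s.
Proof. nra. Qed.

Let der_ln1 (s : R) : der s (fun s => ln (1 + s * s)) ((1 + s * s)^-1 * (0 + (s * 1 + s * 1))).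
Proof.
exact: (der_ln (der_add (der_cst 1 s) (der_mul (der_id s) (der_id s))) (sq1_gt0 s)).
Qed.

Let der_inv1 (s : R) : der s (fun s => (1 + s * s)^-1) (- (1 + s * s) ^- 2 * (0 + (s * 1 + s * 1))).
Proof.
exact: (der_inv (der_add (der_cst 1 s) (der_mul (der_id s) (der_id s))) (lt0r_neq0 (sq1_gt0 s))).
Qed.

Lemma continuous_gL : continuous gL.
Proof.
move=> s; have d := (der_mul (der_add (der_cst (ln 2) s) (der_opp (der_mul (der_cst 2^-1 s) (der_ln1 s)))) (der_inv1 s)).
exact: (der_continuous d).
Qed.

Lemma continuous_hL : continuous hL.
Proof.
move=> s; have d := (der_mul (der_mul (der_cst 2^-1 s) (der_ln1 s)) (der_inv1 s)).
exact: (der_continuous d).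
Qed.

(** This is Lambda(pi/2 - arctan k) / 2 for the Lobachevsky function Lambda. The base point [- 1]
    only has to lie strictly to the left of 0, so that the primitive is differentiable there. *)
Definition half (k : R) : R := 2^-1 * (primitive gL (- 1) k - primitive gL (- 1) 0).

(** The density of [tri k] in the slope [t], once integrated along the ray of that slope from the
    origin up to abscissa 1 / (1 + k t). *)
Definition outer (k t : R) : R :=
  (2 * (1 + t * t))^-1 * (ln 2 - ln (2 - (1 + t * t) / (1 + k * t))).

Section Outer.
Variable k : R.
Hypothesis k0 : 0 < k.
(* Antiderivative of [outer k]: with [t = tan x] and [k = tan a], the
   substitutions [m1 = tan (a - x)] and [m2 = tan (a - 2 x)] turn the logarithms
   into [hL]. *)
Let m1 (t : R) := (k - t) * (1 + k * t)^-1.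
Let m2 (t : R) := (k * (1 - t * t) - 2 * t) * (1 - t * t + 2 * (k * t))^-1.
Let K (t : R) := 2^-1 * (primitive gL (- 1) t + primitive hL (- (k + 1)) (m1 t)
  - 2^-1 * primitive hL (- (k + 1)) (m2 t)).

Let p1 (t : R) : 0 <= t <= k -> 0 < 1 + k * t.
Proof.
by move=> /andP[? ?]; rewrite ltr_pwDl // mulr_ge0 // ltW.
Qed.

Let p2 (t : R) : 0 <= t <= k -> 0 < 1 - t * t + 2 * (k * t).
Proof.
move=> /andP[t0 tk]; have : 0 <= t * (k - t) by rewrite mulr_ge0 // subr_ge0.
have : 0 <= k * t by rewrite mulr_ge0 // ltW.
nra.
Qed.

Let der_m1 (t : R) : 0 <= t <= k -> der t m1 (- ((1 + k * k) / (1 + k * t) ^+ 2)).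
Proof.
move=> tk; have := p1 tk => pt.
have h1 := der_add (der_cst k t) (der_opp (der_id t)).
have h2 := der_add (der_cst 1 t) (der_mul (der_cst k t) (der_id t)).
have h3 := der_mul h1 (der_inv h2 (lt0r_neq0 pt)).
apply: (der_eq h3) => /=.
by field; rewrite gt_eqF.
Qed.

Let der_m2 (t : R) : 0 <= t <= k ->
  der t m2 (- (2 * (1 + k * k) * (1 + t * t) / (1 - t * t + 2 * (k * t)) ^+ 2)).
Proof.
move=> tk; have := p2 tk => pt.
have htt := der_add (der_cst 1 t) (der_opp (der_mul (der_id t) (der_id t))).
have h1 := der_add (der_mul (der_cst k t) htt) (der_opp (der_mul (der_cst 2 t) (der_id t))).
have h2 := der_add htt (der_mul (der_cst 2 t) (der_mul (der_cst k t) (der_id t))).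
have h3 := der_mul h1 (der_inv h2 (lt0r_neq0 pt)).
apply: (der_eq h3) => /=.
by field; rewrite gt_eqF.
Qed.

Let ln_sq (x : R) : 0 < x -> ln (x ^+ 2) = 2 * ln x.
Proof. by move=> x0; rewrite lnXn // mulr_natl. Qed.

Let der_K (t : R) : 0 <= t <= k -> der t K (outer k t).
Proof.
move=> tk; have := p1 tk; have := p2 tk => q2 q1; have /andP[t0 tk'] := tk.
(* Both [m1] and [m2] stay at or above [- k], so the base point [- (k + 1)] of the primitives of
   [hL] is strictly to their left. *)
have m1g : - (k + 1) < m1 t.
  rewrite (lt_le_trans (y := 0)) //; first lra.
  by rewrite /m1 mulr_ge0 ?invr_ge0 ?subr_ge0 // ltW.
have m2g : - (k + 1) < m2 t.
  rewrite (lt_le_trans (y := - k)) //; first lra.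
  rewrite -subr_ge0 opprK (_ : m2 t + k = 2 * ((k - t) * (1 + k * t)) / (1 - t * t + 2 * (k * t))).
    by rewrite divr_ge0 ?mulr_ge0 ?subr_ge0 // ltW.
  by rewrite /m2; field; rewrite gt_eqF.
have t1 : - 1 < t by lra.
have hG := der_primitive continuous_gL t1.
have hH1 := der_comp (der_primitive continuous_hL m1g) (der_m1 tk).
have hH2 := der_comp (der_primitive continuous_hL m2g) (der_m2 tk).
have hK := der_mul (der_cst 2^-1 t) (der_add (der_add hG hH1) (der_opp (der_mul (der_cst 2^-1 t) hH2))).
apply: (der_eq hK).
have E1 : ln (1 + m1 t * m1 t) = ln (1 + k * k) + ln (1 + t * t) - 2 * ln (1 + k * t).
  rewrite -ln_sq // -lnM ?posrE // -ln_div ?posrE ?mulr_gt0 ?exprn_gt0 //.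
  by congr ln; rewrite /m1; field; rewrite gt_eqF.
have E2 : ln (1 + m2 t * m2 t) =
    ln (1 + k * k) + 2 * ln (1 + t * t) - 2 * ln (1 - t * t + 2 * (k * t)).
  rewrite -!ln_sq // -lnM ?posrE ?exprn_gt0 // -ln_div ?posrE ?mulr_gt0 ?exprn_gt0 //.
  by congr ln; rewrite /m2; field; rewrite gt_eqF.
have E3 : ln (2 - (1 + t * t) / (1 + k * t)) = ln (1 - t * t + 2 * (k * t)) - ln (1 + k * t).
  rewrite -ln_div ?posrE //; congr ln; field; by rewrite gt_eqF.
have F1 : 1 + m1 t * m1 t = (1 + k * k) * (1 + t * t) / (1 + k * t) ^+ 2.
  by rewrite /m1; field; rewrite gt_eqF.
have F2 : 1 + m2 t * m2 t = (1 + k * k) * (1 + t * t) ^+ 2 / (1 - t * t + 2 * (k * t)) ^+ 2.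
  by rewrite /m2; field; rewrite gt_eqF.
rewrite /hL /gL /outer E1 E2 E3 F1 F2.
field; rewrite !gt_eqF //.
Qed.

(** At [t = 0] both [m1] and [m2] equal [k]; at [t = k] they are 0 and [- k]. Since [hL] is even,
    its contributions cancel and only the one of [gL] survives. *)
Let K_diff : K k - K 0 = half k.
Proof.
have m1k : m1 k = 0 by rewrite /m1 subrr mul0r.
have m10 : m1 0 = k by rewrite /m1 mulr0 addr0 invr1 subr0 mulr1.
have m2k : m2 k = - k.
  by rewrite /m2; field; rewrite gt_eqF //; nra.
have m20 : m2 0 = k by rewrite /m2 !mulr0 !subr0 addr0 invr1 !mulr1.
have odd := @primitive_odd R hL (- (k + 1)) k continuous_hL.
have {}odd : primitive hL (- (k + 1)) k + primitive hL (- (k + 1)) (- k) = 2 * primitive hL (- (k + 1)) 0.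
  by apply: odd; [move=> y; rewrite /hL mulrNN|exact: ltW|lra].
rewrite /K /half m1k m10 m2k m20.
have -> : primitive hL (- (k + 1)) 0 = 2^-1 * (primitive hL (- (k + 1)) k + primitive hL (- (k + 1)) (- k)).
  by rewrite odd; field.
by field.
Qed.

Lemma integral_outer :
  (\int[mu]_t (\1_(`[0, k]%classic) t * outer k t)%:E = (half k)%:E)%E.
Proof.
rewrite -K_diff; apply: (integral_indic_der (ltW k0) (fun t tk => der_K tk)).
move=> t tk; have /andP[t0 tk'] := tk.
have htt := der_add (der_cst 1 t) (der_mul (der_id t) (der_id t)).
have hkt := der_add (der_cst 1 t) (der_mul (der_cst k t) (der_id t)).
have q1 := p1 tk; have q2 := p2 tk.
have pos : 0 < 2 - (1 + t * t) / (1 + k * t).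
  rewrite (_ : _ - _ = (1 - t * t + 2 * (k * t)) / (1 + k * t)) ?divr_gt0 //.
  by field; rewrite gt_eqF.
have n2 : 2 * (1 + t * t) != 0 by rewrite gt_eqF // mulr_gt0.
have h1 := der_inv (der_mul (der_cst 2 t) htt) n2.
have h2 := der_add (der_cst 2 t) (der_opp (der_mul htt (der_inv hkt (lt0r_neq0 q1)))).
have d := der_mul h1 (der_add (der_cst (ln 2) t) (der_opp (der_ln h2 pos))).
exact: (der_continuous d).
Qed.

End Outer.
End TriangleVolume.

(** * Volume over a normalised right triangle *)

Section TriangleIntegral.
Context {R : realType}.
Local Notation mu := (@lebesgue_measure R).
Local Notation TR := (measurableTypeR R).

Lemma measurable_inv : measurable_fun setT (fun t : TR => t^-1 : TR).
Proof.
rewrite (_ : (fun t => _) = (fun t : TR => t * t ^- 2)).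
  by apply: measurable_funM => //; exact: measurable_expNn2.
apply/funext => t; have [->|t0] := eqVneq t 0; first by rewrite invr0 mul0r.
by rewrite expr2 invfM mulrA mulfV // mul1r.
Qed.

Lemma measurable_halfplane (a b c : R) :
  measurable [set p : TR * TR | 0 <= a * p.1 + b * p.2 + c].
Proof.
have := @measurable_lin2 R a b c measurableT `[0, +oo[%classic (measurable_itv _).
rewrite setTI; congr measurable.
by apply/seteqP; split => p /=; rewrite in_itv/= andbT.
Qed.

(** The right triangle with hypotenuse from (0, 0) to (1, 0) and angle arctan k at the origin. The
    disc is the unit disc around (1, 0): the origin is a point of its circle, and [y = k x] is the
    radical axis with the neighbouring disc. *)
Definition tri (k : R) : set (TR * TR) :=
  [set p | [/\ 0 <= p.2, p.2 <= k * p.1 & p.1 + k * p.2 <= 1]].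

Lemma measurable_tri (k : R) : measurable (tri k).
Proof.
rewrite (_ : tri k = [set p | 0 <= 0 * p.1 + 1 * p.2 + 0] `&`
  ([set p | 0 <= k * p.1 + (- 1) * p.2 + 0] `&` [set p | 0 <= (- 1) * p.1 + (- k) * p.2 + 1])).
  by apply: measurableI; [|apply: measurableI]; exact: measurable_halfplane.
apply/seteqP; split => p /=.
  by case=> h1 h2 h3; split; [lra|split; [lra|nra]].
by case=> h1 [h2 h3]; split; [lra|lra|nra].
Qed.

(** Here 2 x - x^2 - y^2 is the power of the point for the unit circle around (1, 0), and 1 / (2
    power) is the volume above the hemisphere over that point. *)
Definition tri_density (k x y : R) : R :=
  \1_(tri k) (x, y) * (2 * (2 * x - x ^+ 2 - y ^+ 2))^-1.

Lemma measurable_quadratic (a b c d e f : R) :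
  measurable_fun setT (fun p : TR * TR =>
    a * p.1 ^+ 2 + b * (p.1 * p.2) + c * p.2 ^+ 2 + d * p.1 + e * p.2 + f : TR).
Proof.
by do 5?apply: measurable_funD => //; apply: measurable_funM => //;
   do ?[exact: measurable_funX|exact: measurable_funM].
Qed.

Lemma measurable_tri_density (k : R) :
  measurable_fun setT (fun p : TR * TR => (tri_density k p.1 p.2)%:E).
Proof.
apply/measurable_EFinP; apply: measurable_funM.
  rewrite (_ : (fun p => _) = \1_(tri k)); last by apply/funext => -[].
  by apply: measurable_indic; exact: measurable_tri.
apply: (measurableT_comp measurable_inv).
apply: eq_measurable_fun (measurable_quadratic (- 2) 0 (- 2) 4 0 0) => p _; ring.
Qed.

Lemma tri_density_ge0 (k x y : R) : 0 < k -> 0 <= tri_density k x y.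
Proof.
move=> k0; rewrite /tri_density indicE; case: (boolP (_ \in _)) => h; last by rewrite mul0r.
rewrite mul1r invr_ge0; move: h; rewrite in_setE /tri /= => -[y0 yx xy].
have x0 : 0 <= x by rewrite -(pmulr_rge0 _ k0); exact: le_trans yx.
have : y * y <= k * x * y by rewrite ler_wpM2r.
nra.
Qed.

Definition inner (t x : R) : R := (2 * (2 - x * (1 + t * t)))^-1.

Lemma measurable_inner_density (t : R) : measurable_fun setT (fun x : TR => inner t x : TR).
Proof.
apply: (measurableT_comp measurable_inv).
by apply: measurable_funM => //; apply: measurable_funB => //; exact: measurable_funM.
Qed.

Lemma integral_inner (t X : R) : 0 <= X -> X * (1 + t * t) < 2 ->
  (\int[mu]_x (\1_(`]0, X]%classic) x * inner t x)%:E =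
   ((2 * (1 + t * t))^-1 * (ln 2 - ln (2 - X * (1 + t * t))))%:E)%E.
Proof.
move=> X0 Xt; have tt : 0 < 1 + t * t by nra.
rewrite -(@integral_mkindic _ _ TR mu `]0, X]%classic (inner t)).
rewrite integral_itv_obnd_cbnd; last first.
  apply: measurable_funS (measurableT) (@subsetT _ _) _; apply/measurable_EFinP.
  exact: measurable_inner_density.
pose F x := - (2 * (1 + t * t))^-1 * ln (2 - x * (1 + t * t)).
have pos x : 0 <= x <= X -> 0 < 2 - x * (1 + t * t).
  move=> /andP[x0 xX]; rewrite subr_gt0; apply: le_lt_trans Xt.
  by rewrite ler_wpM2r // ltW.
have d1 (x : R) := der_add (der_cst 2 x) (der_opp (der_mul (der_id x) (der_cst (1 + t * t) x))).
rewrite (_ : _ * _ = F X - F 0); last by rewrite /F mul0r subr0; ring.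
apply: (@integral_der _ (inner t) F 0 X X0).
- move=> x xX; apply: (der_eq (der_mul (der_cst _ x) (der_ln (d1 x) (pos _ xX)))) => /=.
  by rewrite /inner; field; rewrite !gt_eqF // ?pos.
- move=> x xX; apply: der_continuous.
  have n0 : 2 * (2 - x * (1 + t * t)) != 0 by rewrite gt_eqF // mulr_gt0 // pos.
  exact: (der_inv (der_mul (der_cst 2 x) (d1 x)) n0).
Qed.

(** In the slope t = y / x the factor of dy = |x| dt cancels the pole of the density at the
    origin. *)
Lemma tri_density_slope (k t x : R) : 0 < k ->
  `|x| * tri_density k x (t * x) =
  \1_(`[0, k]%classic) t * (\1_(`]0, (1 + k * t)^-1]%classic) x * inner t x).
Proof.
move=> k0; rewrite /tri_density !indicE.
have [xp|xn|->] := ltrgt0P x; last 2 first.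
- rewrite memNset; last by move=> [/= h1 h2 h3]; nra.
  rewrite mul0r mulr0 [X in _ * (X * _)](_ : _ = 0) ?mul0r ?mulr0 // memNset // /= in_itv/= => /andP[]; lra.
- by rewrite mul0r [X in _ * (X * _)](_ : _ = 0) ?mul0r ?mulr0 // memNset // /= in_itv/= ltxx.
have [tk|tk] := boolP (0 <= t <= k); last first.
  rewrite [t \in _]memNset ?mul0r; last by rewrite /= in_itv/=; apply/negP.
  rewrite memNset ?mul0r ?mulr0 // => -[/= h1 h2 h3]; move/negP: tk; apply.
  by rewrite -(pmulr_lge0 _ xp) h1 -(ler_pM2r xp).
rewrite [t \in _]mem_set ?mul1r; last by rewrite /= in_itv.
have /andP[t0 tk'] := tk.
have kt : 0 < 1 + k * t by rewrite ltr_pwDl // mulr_ge0 // ltW.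
have -> : ((x, t * x) \in tri k) = (x \in `]0, (1 + k * t)^-1]%classic).
  apply/idP/idP; rewrite !in_setE /tri /= in_itv/= -[(1 + _)^-1]mul1r ler_pdivlMr //.
    by case=> h1 h2 h3; apply/andP; split => //; nra.
  by move=> /andP[_ h]; split; [rewrite mulr_ge0 // ltW|rewrite ler_pM2r|nra].
rewrite mulrCA; congr (_ * _); rewrite /inner.
have -> : 2 * x - x ^+ 2 - (t * x) ^+ 2 = x * (2 - x * (1 + t * t)) by ring.
by rewrite mulrCA invfM mulrA mulfV ?mul1r // gt_eqF.
Qed.

Local Open Scope ereal_scope.

Lemma integral_tri (k : R) : (0 < k)%R ->
  \int[mu]_x \int[mu]_y (tri_density k x y)%:E = (half k)%:E.
Proof.
move=> k0; have d0 x y : 0 <= (tri_density k x y)%:E by rewrite lee_fin tri_density_ge0.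
have md := measurable_tri_density k.
have mdx x : measurable_fun setT (fun y : TR => (tri_density k x y)%:E).
  exact: (measurableT_comp md (pair1_measurable x)).
pose e t x := (\1_(`[0%R, k]%classic) t * (\1_(`]0%R, (1 + k * t)^-1]%classic) x * inner t x))%R.
have eE t x : (e t x = `|x| * tri_density k x (t * x))%R by rewrite tri_density_slope.
transitivity (\int[mu]_x \int[mu]_t (e t x)%:E).
  (* At [x = 0] the substitution y = t x is not allowed, but there the triangle reduces to the
     origin, where the density is [0^-1 = 0]. *)
  apply: eq_integral => x _; have [->|x0] := eqVneq x 0%R.
    transitivity (0 : \bar R)%E; last apply: esym; apply: integral0_eq => y _.
      rewrite /tri_density indicE; case: (boolP (_ \in _)); last by rewrite mul0r.
      rewrite in_setE /tri /= mulr0 => -[y0 y1 _].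
      have -> : y = 0%R by apply/eqP; rewrite eq_le y0 y1.
      by rewrite mulr0 expr0n !subr0 mulr0 invr0 mulr0.
    by rewrite eE normr0 mul0r.
  rewrite -(integral_affine 0 x0 (mdx x) (d0 x)).
  rewrite ge0_integral_scale //; last first.
    by apply: (measurableT_comp (mdx x)); apply: measurable_funD => //; apply: measurable_funM.
  by apply: eq_integral => t _; rewrite eE EFinM addr0 (mulrC x).
have me : measurable_fun setT (fun p : TR * TR => (e p.2 p.1)%:E).
  under eq_fun do rewrite eE; apply/measurable_EFinP; apply: measurable_funM.
    exact: measurableT_comp.
  apply/measurable_EFinP.
  have mg : measurable_fun setT (fun p : TR * TR => (p.1, p.2 * p.1)%R : TR * TR).
    by apply: measurable_fun_pair => //; exact: measurable_funM.
  exact: (measurableT_comp md mg).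
rewrite (integral2_swap (f := fun x t => (e t x)%:E) me); last first.
  by move=> x t; rewrite eE EFinM mule_ge0.
rewrite -integral_outer //; apply: eq_integral => t _; rewrite /e.
have [tk|tk] := boolP (0 <= t <= k)%R; last first.
  rewrite indicE memNset; last by rewrite /= in_itv/=; apply/negP.
  by rewrite mul0r; apply: integral0_eq => x _; rewrite mul0r.
rewrite indicE mem_set ?mul1r; last by rewrite /= in_itv.
under eq_integral do rewrite mul1r.
have /andP[t0 tk'] := tk.
have kt : (0 < 1 + k * t)%R by rewrite ltr_pwDl // mulr_ge0 // ltW.
rewrite integral_inner /outer.
- by congr EFin; congr (_ * (_ - ln (_ - _)))%R; rewrite mulrC.
- by rewrite invr_ge0 ltW.
- by rewrite mulrC ltr_pdivrMr //; nra.
Qed.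

End TriangleIntegral.

(** * Comparison of the flags of ratio k and 1 / k with the regular one *)

Section HalfInequality.
Context {R : realType}.

(** The derivative of [G x + G x^-1] simplifies to - ln x / (1 + x^2), which is nonnegative on ]0,
    1]; the case [k > 1] follows by exchanging [k] and its inverse. *)
Lemma half_inv_le (k : R) : 0 < k -> half k + half k^-1 <= 2 * half 1.
Proof.
have key x : 0 < x -> x <= 1 -> half x + half x^-1 <= 2 * half 1.
  move=> x0 x1; rewrite /half.
  set G := primitive gL (- 1).
  suff : G x + G x^-1 <= G 1 + G 1^-1 by rewrite invr1 -!/G; lra.
  apply: (@der_ndecr _ (fun y => G y + G y^-1) (fun y => gL y + gL y^-1 * (- y ^- 2 * 1)) x 1) => //.
    move=> y /andP[xy y1]; have y0 : 0 < y by exact: lt_le_trans xy.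
    have yi : - 1 < y^-1 by rewrite (lt_trans (y := 0)) ?invr_gt0 // ltrN10.
    have y2 : - 1 < y by lra.
    apply: der_add; first exact: (der_primitive continuous_gL y2).
    exact: (der_comp (der_primitive continuous_gL yi) (der_inv (der_id y) (lt0r_neq0 y0))).
  move=> y /andP[xy y1]; have y0 : 0 < y by exact: lt_le_trans xy.
  have pos : 0 < 1 + y * y by nra.
  have E : ln (1 + y^-1 * y^-1) = ln (1 + y * y) - 2 * ln y.
    rewrite mulr_natl -lnXn // -ln_div ?posrE ?exprn_gt0 //; congr ln.
    by field; rewrite gt_eqF.
  rewrite /gL E.
  have -> : (ln 2 - 2^-1 * ln (1 + y * y)) / (1 + y * y) +
      (ln 2 - 2^-1 * (ln (1 + y * y) - 2 * ln y)) / (1 + y^-1 * y^-1) * (- y ^- 2 * 1) =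
      - ln y / (1 + y * y).
    have : 1 + y^-1 * y^-1 != 0 by rewrite gt_eqF // ltr_pwDl // mulr_ge0 // invr_ge0 ltW.
    by move=> n0; field; rewrite !gt_eqF //= -expr2 ?exprn_gt0 //; nra.
  by rewrite divr_ge0 ?oppr_ge0 ?ln_le0 // ltW.
move=> k0; have [k1|k1] := leP k 1; first exact: key.
rewrite addrC -[X in _ + half X]invrK; apply: key; first by rewrite invr_gt0.
by rewrite invf_le1 // ltW.
Qed.

(** On [0, 1] the numerator of [gL] is at least ln 2 / 2 and 1 + y^2 is at most 2, so [gL] is at
    least ln 2 / 4. *)
Lemma half1_gt0 : 0 < half (1 : R).
Proof.
rewrite /half mulr_gt0 ?invr_gt0 //; set G := primitive gL (- 1).
have l2 : 0 < ln 2 :> R by rewrite ln_gt0 // ltr1n.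
suff : G 0 - 4^-1 * ln 2 * 0 <= G 1 - 4^-1 * ln 2 * 1 by lra.
apply: (@der_ndecr _ (fun y => G y - 4^-1 * ln 2 * y) (fun y => gL y - (4^-1 * ln 2 * 1 + y * 0)) 0 1) => //.
  move=> y /andP[y0 y1]; have y2 : - 1 < y by lra.
  apply: der_add; first exact: (der_primitive continuous_gL y2).
  exact: (der_opp (der_mul (der_cst (4^-1 * ln 2) y) (der_id y))).
move=> y /andP[y0 y1].
have h : ln (1 + y * y) <= ln 2 by rewrite ler_ln ?posrE //; nra.
have h0 : 0 <= ln (1 + y * y) by rewrite ln_ge0 //; nra.
rewrite mulr1 mulr0 addr0 subr_ge0 /gL ler_pdivlMr; last by nra.
have : 4^-1 * ln 2 * (1 + y * y) <= 4^-1 * ln 2 * 2.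
  by apply: ler_wpM2l; [lra|nra].
lra.
Qed.

End HalfInequality.

(** * Conics as exceptional sets in iterated integrals *)

Section Conics.
Context {R : realType}.
Local Notation mu := (@lebesgue_measure R).
Local Notation TR := (measurableTypeR R).

(** The coefficients of x^2, xy, y^2, then of x, y, 1. Degenerate conics are allowed, so lines and
    single points are covered as well. *)
Definition conic : Type := (R * R * R) * (R * R * R).

Definition conic_eval (q : conic) (x y : R) : R :=
  q.1.1.1 * x ^+ 2 + q.1.1.2 * (x * y) + q.1.2 * y ^+ 2 + q.2.1.1 * x + q.2.1.2 * y + q.2.2.

Lemma finite_roots2 (a b c : R) : (a, b, c) <> (0, 0, 0) ->
  finite_set [set y : R | a * y ^+ 2 + b * y + c = 0].
Proof.
move=> abc; have [a0|a0] := eqVneq a 0.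
  have [b0|b0] := eqVneq b 0.
    have [c0|c0] := eqVneq c 0; first by rewrite a0 b0 c0 in abc.
    rewrite (_ : [set _ | _] = set0) // -subset0 => y /=.
    by rewrite a0 b0 !mul0r !add0r => /eqP; rewrite (negbTE c0).
  apply: (@sub_finite_set _ _ [set - c / b]); last exact: finite_set1.
  move=> y /=; rewrite a0 mul0r add0r => h; apply: (mulfI b0).
  by rewrite mulrCA mulfV // mulr1; lra.
have [[y0 h0]|h] := pselect (exists y, a * y ^+ 2 + b * y + c = 0); last first.
  rewrite (_ : [set _ | _] = set0) // -subset0 => y /= hy; apply: h; by exists y.
apply: (@sub_finite_set _ _ ([set y0] `|` [set - b / a - y0])); last first.
  by rewrite finite_setU; split; exact: finite_set1.
move=> y /= hy; have : (y - y0) * (a * (y + y0) + b) = 0.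
  by transitivity ((a * y ^+ 2 + b * y + c) - (a * y0 ^+ 2 + b * y0 + c)); [ring|rewrite hy h0 subrr].
move/eqP; rewrite mulf_eq0 => /orP[/eqP h|/eqP h]; [left; lra|right].
apply: (mulfI a0); rewrite mulrBr mulrCA mulfV // mulr1; lra.
Qed.

(** A vertical section is infinite only if its quadratic equation in y is trivial. The three
    coefficients are polynomials in x of degree at most 2 and not all of them are identically
    zero. *)
Lemma finite_conic_sections (q : conic) : q <> ((0, 0, 0), (0, 0, 0)) ->
  finite_set [set x | ~ finite_set [set y | conic_eval q x y = 0]].
Proof.
move: q => [[[a b] c] [[d e] f]] q0.
have sec x : ~ finite_set [set y | conic_eval (a, b, c, (d, e, f)) x y = 0] ->
    [/\ c = 0, b * x + e = 0 & a * x ^+ 2 + d * x + f = 0].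
  move=> nf; have : (c, b * x + e, a * x ^+ 2 + d * x + f) = (0, 0, 0).
    apply: contrapT => /finite_roots2 h; apply: nf; move: h; congr finite_set.
    by apply/seteqP; split => y /=; rewrite /conic_eval /= => <-; ring.
  by case.
have [be|be] := pselect ((0, b, e) = (0, 0, 0) :> R * R * R); last first.
  apply: sub_finite_set (finite_roots2 be) => x /= /sec[_ h _].
  by rewrite mul0r add0r.
have [adf|adf] := pselect ((a, d, f) = (0, 0, 0)); last first.
  by apply: sub_finite_set (finite_roots2 adf) => x /= /sec[_ _ h].
rewrite (_ : [set _ | _] = set0) // -subset0 => x /= /sec[c0 _ _].
by case: adf be q0 => -> -> -> [-> ->]; rewrite c0.
Qed.

Lemma finite_ae (A : set R) (Q : R -> Prop) : finite_set A ->
  (forall x, ~ A x -> Q x) -> {ae mu, forall x, Q x}.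
Proof.
move=> fA h; exists A; split.
- apply: (@countable_measurable _ TR); last exact: finite_set_countable.
  by move=> t; exact: measurable_set1.
- by apply: countable_lebesgue_measure0; exact: finite_set_countable.
- by move=> x /= nq; apply: contrapT => /h.
Qed.

(** Off finitely many x the exceptional y are finite in number, so the comparison holds almost
    everywhere in each of the two integrations, and no null set of the plane has to be measured. *)
Lemma le_integral2_off_conics (qs : seq conic) (F G : R -> R -> \bar R) :
  (forall q, q \in qs -> q <> ((0, 0, 0), (0, 0, 0))) ->
  measurable_fun setT (fun p : TR * TR => F p.1 p.2) -> (forall x y, (0 <= F x y)%E) ->
  measurable_fun setT (fun p : TR * TR => G p.1 p.2) -> (forall x y, (0 <= G x y)%E) ->
  (forall x y, (forall q, q \in qs -> conic_eval q x y <> 0) -> (F x y <= G x y)%E) ->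
  (\int[mu]_x \int[mu]_y F x y <= \int[mu]_x \int[mu]_y G x y)%E.
Proof.
move=> q0 mF F0 mG G0 FG.
pose X := \bigcup_(q in [set` qs]) [set x | ~ finite_set [set y | conic_eval q x y = 0]].
have fX : finite_set X.
  apply: bigcup_finite; first exact: finite_seq.
  by move=> q /= /q0; exact: finite_conic_sections.
apply: ae_ge0_le_integral => //.
- by move=> x _; apply: integral_ge0.
- exact: measurable_inner mF F0.
- by move=> x _; apply: integral_ge0.
- exact: measurable_inner mG G0.
apply: (finite_ae fX) => x Xx _.
have fY : finite_set (\bigcup_(q in [set` qs]) [set y | conic_eval q x y = 0]).
  apply: bigcup_finite; first exact: finite_seq.
  by move=> q qs_q; apply: contrapT => nf; apply: Xx; exists q.
apply: ae_ge0_le_integral => //.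
- exact: (measurableT_comp mF (pair1_measurable x)).
- exact: (measurableT_comp mG (pair1_measurable x)).
apply: (finite_ae fY) => y Yy _; apply: FG => q qq e; apply: Yy; by exists q.
Qed.

End Conics.

(** * Affine maps of the plane and folding by a reflection *)

Section AffinePlane.
Context {R : realType}.
Local Notation mu := (@lebesgue_measure R).
Local Notation TR := (measurableTypeR R).

Lemma measurable2_affine (f : R -> R -> \bar R) (a b e c d g : R) :
  measurable_fun setT (fun p : TR * TR => f p.1 p.2) ->
  measurable_fun setT (fun p : TR * TR => f (a * p.1 + b * p.2 + e) (c * p.1 + d * p.2 + g)).
Proof.
move=> mf; apply: (measurableT_comp mf
  (measurable_fun_pair (measurable_lin2 a b e) (measurable_lin2 c d g))).
Qed.

Lemma measurable2_comp (f : R -> R -> \bar R) d (T : measurableType d) (g h : T -> TR) :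
  measurable_fun setT (fun p : TR * TR => f p.1 p.2) ->
  measurable_fun setT g -> measurable_fun setT h ->
  measurable_fun setT (fun t => f (g t) (h t)).
Proof. by move=> mf mg mh; apply: (measurableT_comp mf (measurable_fun_pair mg mh)). Qed.

Local Open Scope ereal_scope.

Lemma integral2_affine (a b e c d g : R) (f : R -> R -> \bar R) :
  (a * d - b * c != 0)%R ->
  measurable_fun setT (fun p : TR * TR => f p.1 p.2) -> (forall x y, 0 <= f x y) ->
  `|(a * d - b * c)%R|%:E *
    \int[mu]_x \int[mu]_y f (a * x + b * y + e)%R (c * x + d * y + g)%R =
  \int[mu]_x \int[mu]_y f x y.
Proof.
move=> D0 mf f0.
have E1 := @integral2_linear _ a b c d (fun x y => f (x + e)%R (y + g)%R) D0.
etransitivity; first apply: E1.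
- apply: eq_measurable_fun (measurable2_affine 1 0 e 0 1 g mf) => p _.
  by rewrite !mul1r !mul0r addr0 add0r.
- by move=> *; apply: f0.
transitivity (\int[mu]_x \int[mu]_y f (x + e)%R y).
  apply: eq_integral => x _.
  have E2 := @integral_affine _ 1 g (fun y => f (x + e)%R y) (oner_neq0 _).
  rewrite -E2 ?normr1 ?mul1e.
  - by apply: eq_integral => y _; rewrite mul1r.
  - exact: (measurableT_comp mf (pair1_measurable (x + e)%R)).
  - by move=> y; apply: f0.
have mi : measurable_fun setT (fun x => \int[mu]_y f x y) by exact: measurable_inner mf f0.
have E3 := @integral_affine _ 1 e _ (oner_neq0 _) mi.
rewrite -E3 ?normr1 ?mul1e; last by move=> x; apply: integral_ge0 => y _; apply: f0.
by apply: eq_integral => x _; rewrite mul1r.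
Qed.

Lemma integral2D (f g : R -> R -> \bar R) :
  measurable_fun setT (fun p : TR * TR => f p.1 p.2) -> (forall x y, 0 <= f x y) ->
  measurable_fun setT (fun p : TR * TR => g p.1 p.2) -> (forall x y, 0 <= g x y) ->
  \int[mu]_x \int[mu]_y (f x y + g x y) =
  \int[mu]_x \int[mu]_y f x y + \int[mu]_x \int[mu]_y g x y.
Proof.
move=> mf f0 mg g0.
rewrite -ge0_integralD; [|by []|by move=> x _; apply: integral_ge0|exact: measurable_inner mf f0
  |by move=> x _; apply: integral_ge0|exact: measurable_inner mg g0].
apply: eq_integral => x _; rewrite ge0_integralD; [by []|by []| | | |].
- by move=> y _.
- exact: (measurableT_comp mf (pair1_measurable x)).
- by move=> y _.
- exact: (measurableT_comp mg (pair1_measurable x)).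
Qed.

(** The second copy of [G] is transported by an area-preserving affine map. This serves for regions
    that a reflection, used as that map, folds in two. *)
Lemma double_integral2_le (qs : seq (@conic R)) (a b e c d g : R)
    (F G : R -> R -> \bar R) :
  (`|a * d - b * c| = 1)%R ->
  (forall q, q \in qs -> q <> ((0, 0, 0), (0, 0, 0)))%R ->
  measurable_fun setT (fun p : TR * TR => F p.1 p.2) -> (forall x y, 0 <= F x y) ->
  measurable_fun setT (fun p : TR * TR => G p.1 p.2) -> (forall x y, 0 <= G x y) ->
  (forall x y, (forall q, q \in qs -> conic_eval q x y <> 0%R) ->
    G x y + G (a * x + b * y + e)%R (c * x + d * y + g)%R <= F x y) ->
  2%:E * \int[mu]_x \int[mu]_y G x y <= \int[mu]_x \int[mu]_y F x y.
Proof.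
move=> D1 qs0 mF F0 mG G0 GF.
have D0 : (a * d - b * c != 0)%R by rewrite -normr_gt0 D1 ltr01.
have E1 := @integral2_affine a b e c d g G D0 mG G0.
rewrite D1 mul1e in E1.
have mG' := measurable2_affine a b e c d g mG.
rewrite (_ : 2%:E = 1%:E + 1%:E); last by rewrite -EFinD.
rewrite ge0_muleDl ?lee_fin ?ler01 // mul1e -{2}E1 -integral2D; last 4 first.
- exact: mG.
- exact: G0.
- exact: mG'.
- by move=> *; apply: G0.
apply: (@le_integral2_off_conics _ qs).
- exact: qs0.
- exact: (emeasurable_funD mG mG').
- by move=> x y; rewrite adde_ge0.
- exact: mF.
- exact: F0.
- exact: GF.
Qed.

End AffinePlane.

(** * Volume along one ray from the ideal point *)

Section Ray.
Context {R : realType}.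
Local Notation mu := (@lebesgue_measure R).
Local Notation TR := (measurableTypeR R).

Lemma integral_ray (q L : R) : 0 <= L -> L * q < 2 ->
  (\int[mu]_l (\1_(`]0, L]%classic) l * (2 - l * q) ^- 2)%:E = (L / (2 * (2 - L * q)))%:E)%E.
Proof.
move=> L0 Lq; rewrite -(@integral_mkindic _ _ TR mu `]0, L]%classic (fun l => (2 - l * q) ^- 2)).
rewrite integral_itv_obnd_cbnd; last first.
  apply: measurable_funS (measurableT) (@subsetT _ _) _; apply/measurable_EFinP.
  apply: (measurableT_comp (@measurable_expNn2 R)).
  by apply: measurable_funB => //; exact: measurable_funM.
pose F l := l * (2 * (2 - l * q))^-1.
have pos l : 0 <= l <= L -> 0 < 2 - l * q.
  move=> /andP[l0 lL]; have [q0|q0] := leP 0 q; last by nra.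
  by rewrite subr_gt0; apply: le_lt_trans Lq; rewrite ler_wpM2r.
have d1 (x : R) := der_add (der_cst 2 x) (der_opp (der_mul (der_id x) (der_cst q x))).
rewrite (_ : L / _ = F L - F 0); last by rewrite /F mul0r subr0.
apply: (@integral_der _ (fun l => (2 - l * q) ^- 2) F 0 L L0) => l lL; have p := pos _ lL.
  have n0 : 2 * (2 - l * q) != 0 by rewrite gt_eqF // mulr_gt0.
  apply: (der_eq (der_mul (der_id l) (der_inv (der_mul (der_cst 2 l) (d1 l)) n0))) => /=.
  by field; rewrite gt_eqF.
apply: der_continuous.
have n0 : (2 - l * q) * (2 - l * q) != 0 by rewrite gt_eqF // mulr_gt0.
exact: (der_inv (der_mul (d1 l) (d1 l)) n0).
Qed.

End Ray.

(** * Lower bound for the regular ideal octahedron *)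

Section Octahedron.
Context {R : realType}.
Local Notation mu := (@lebesgue_measure R).
Local Notation TR := (measurableTypeR R).

Lemma octahedronE (x y z : R) :
  ideal_octahedron (pt x y z) <-> x ^+ 2 + y ^+ 2 + z ^+ 2 < 1 /\ `|x| + `|y| + `|z| <= 1.
Proof.
rewrite /ideal_octahedron /= /H3 /= dotE !ptE -!expr2.
rewrite !big_ord_recl big_ord0 addr0 addrA.
have -> : pt x y z 0 ord0 = x by rewrite -[RHS](ptE x y z).1.1.
have -> : pt x y z 0 (lift ord0 ord0) = y.
  by rewrite -[RHS](ptE x y z).1.2; congr (pt _ _ _ _ _); apply/val_inj.
have -> // : pt x y z 0 (lift ord0 (lift ord0 ord0)) = z.
by rewrite -[RHS](ptE x y z).2; congr (pt _ _ _ _ _); apply/val_inj.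
Qed.

Lemma measurable_octahedron : borel3 (@ideal_octahedron R).
Proof.
rewrite /borel3 (_ : _ @^-1` _ =
  ((fun p : TR * (TR * TR) => vec3 p) @^-1` (@H3 R)) `&`
  ((fun p : TR * (TR * TR) => `|p.1| + `|p.2.1| + `|p.2.2| : TR) @^-1` `]-oo, 1])).
  apply: measurableI; first exact: measurable_H3.
  have : measurable_fun setT (fun p : TR * (TR * TR) => `|p.1| + `|p.2.1| + `|p.2.2| : TR).
    apply: measurable_funD; first apply: measurable_funD.
    - exact: (measurableT_comp (@normr_measurable _ _) measurable_proj1).
    - exact: (measurableT_comp (@normr_measurable _ _) measurable_proj2).
    - exact: (measurableT_comp (@normr_measurable _ _) measurable_proj3).
  move=> /(_ measurableT `]-oo, 1]%classic (measurable_itv _)).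
  by rewrite setTI.
apply/seteqP; split => -[x [y z]] /=; rewrite -[vec3 _]/(pt x y z) in_itv/=.
  by move/octahedronE => [h1 h2]; split => //; rewrite /H3 /= dotE !ptE -!expr2.
by move=> [h1 h2]; apply/octahedronE; split => //; move: h1; rewrite /H3 /= dotE !ptE -!expr2.
Qed.

(** The north pole with its frame, kept in the unsimplified form that [hvolume_euler_frame] produces
    for c = 1, s = 0, r = 0, z = 1. *)
Local Definition apex : 'rV[R]_3 := pt (0 * 1) (0 * 0) 1.
Local Definition axis1 : 'rV[R]_3 := pt (- 0) 1 0.
Local Definition axis2 : 'rV[R]_3 := pt (1 * 1) (0 * 1) (- 0).

Let cone_ptE (w1 w2 l : R) : cone_pt apex axis1 axis2 w1 w2 l = pt (l * w2) (l * w1) (1 - l).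
Proof.
have E k : cone_pt apex axis1 axis2 w1 w2 l 0 k =
  apex 0 k + l * (w1 * axis1 0 k + w2 * axis2 0 k - apex 0 k) by rewrite /cone_pt !mxE.
by apply: rV3P; rewrite E !ptE; ring.
Qed.

(** Up to l = 1 the octahedron only requires a + b <= 1; beyond, it requires l (1 + a + b) <= 2, so
    the ray leaves it at [L]. The resulting a + b - a^2 - b^2 is the power for the circle around
    (1/2, 1/2) through the origin. *)
Let oct_ray (a b w1 w2 : R) : a = `|w1| -> b = `|w2| -> 0 < a -> 0 < b -> a + b <= 1 ->
  (((2 * (a + b - a ^+ 2 - b ^+ 2))^-1)%:E <=
   \int[mu]_l (cone_density (@ideal_octahedron R) apex axis1 axis2 w1 w2 l)%:E)%E.
Proof.
move=> ea eb a0 b0 ab; have wa : w1 ^+ 2 = a ^+ 2 by rewrite ea real_normK ?num_real.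
have wb : w2 ^+ 2 = b ^+ 2 by rewrite eb real_normK ?num_real.
set L := 2 / (1 + (a + b)); set q := 1 + w1 ^+ 2 + w2 ^+ 2.
have ab1 : 0 < 1 + (a + b) by lra.
have sq : a ^+ 2 + b ^+ 2 < a + b by nra.
have L0 : 0 < L by rewrite divr_gt0.
have Lq : L * q < 2.
  by rewrite /L mulrAC ltr_pdivrMr // ltr_pM2l // /q wa wb; lra.
have -> : (2 * (a + b - a ^+ 2 - b ^+ 2))^-1 = L / (2 * (2 - L * q)).
  have n1 : 1 + (a + b) != 0 by rewrite gt_eqF.
  have n2 : a + b - a ^+ 2 - b ^+ 2 != 0 by rewrite gt_eqF //; lra.
  have -> : 2 - L * q = 2 * (a + b - a ^+ 2 - b ^+ 2) / (1 + (a + b)).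
    by rewrite /L /q wa wb; field.
  by rewrite /L; field; rewrite n1 n2.
rewrite -(integral_ray (ltW L0) Lq); apply: ge0_le_integral => //.
- by move=> l _; rewrite lee_fin mulr_ge0 // invr_ge0 exprn_even_ge0.
- apply/measurable_EFinP; apply: measurable_funM; first exact: measurable_indic.
  apply: (measurableT_comp (@measurable_expNn2 R)).
  by apply: measurable_funB => //; exact: measurable_funM.
- apply: (measurable3_comp (measurable_cone_density apex axis1 axis2 measurable_octahedron)) => //.
move=> l _; rewrite lee_fin indicE; case: (boolP (_ \in _)); last first.
  by rewrite mul0r cone_density_ge0.
rewrite in_setE /= in_itv/= => /andP[l0 lL].
rewrite mul1r /cone_density -/q indicE mem_set ?mul1r //; split; last first.
  rewrite cone_ptE /H3 /= dotE !ptE -!expr2 !exprMn wa wb.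
  have : l * q <= L * q by rewrite ler_wpM2r // /q wa wb; nra.
  have : q = 1 + a ^+ 2 + b ^+ 2 by rewrite /q wa wb.
  nra.
have h : l * q < 2 by apply: le_lt_trans Lq; rewrite ler_wpM2r // /q wa wb; nra.
rewrite cone_ptE; apply/octahedronE; rewrite !normrM -ea -eb !exprMn wa wb (gtr0_norm l0).
have lab : l * (1 + (a + b)) <= 2 by rewrite -ler_pdivlMr.
split; first by move: h; rewrite /q wa wb; nra.
have [l1|l1] := leP l 1; first by rewrite ger0_norm ?subr_ge0 //; nra.
by rewrite ltr0_norm ?subr_lt0 //; lra.
Qed.

Let dens (S : set (TR * TR)) (x y : R) : \bar R :=
  (\1_S (x, y) * (2 * (x + y - x ^+ 2 - y ^+ 2))^-1)%:E.

Let mdens S : measurable S -> measurable_fun setT (fun p : TR * TR => dens S p.1 p.2).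
Proof.
move=> mS; apply/measurable_EFinP; apply: measurable_funM.
  rewrite (_ : (fun p => _) = \1_S); first exact: measurable_indic.
  by apply/funext => -[].
apply: (measurableT_comp measurable_inv).
apply: eq_measurable_fun (measurable_quadratic (- 2) 0 (- 2) 2 2 0) => p _; ring.
Qed.

(* The part of the octahedron over a quadrant is halved by a diagonal, then by
   the midline of the resulting triangle: sixteen congruent flags in all. *)
Let S2 : set (TR * TR) := [set p | [/\ 0 <= p.1, 0 <= p.2 & p.1 + p.2 <= 1]].
Let S3 : set (TR * TR) := [set p | [/\ 0 <= p.2, p.2 <= p.1 & p.1 + p.2 <= 1]].
Let S4 : set (TR * TR) := [set p | [/\ 0 <= p.2, p.2 <= p.1 & p.1 <= 2^-1]].

Let hp3 (a1 b1 c1 a2 b2 c2 a3 b3 c3 : R) (S : set (TR * TR)) :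
  (forall x y, S (x, y) <-> [/\ 0 <= a1 * x + b1 * y + c1,
     0 <= a2 * x + b2 * y + c2 & 0 <= a3 * x + b3 * y + c3]) -> measurable S.
Proof.
move=> SE; rewrite (_ : S = [set p | 0 <= a1 * p.1 + b1 * p.2 + c1] `&`
  ([set p | 0 <= a2 * p.1 + b2 * p.2 + c2] `&` [set p | 0 <= a3 * p.1 + b3 * p.2 + c3])).
  by apply: measurableI; [|apply: measurableI]; exact: measurable_halfplane.
apply/seteqP; split => -[x y].
  by move/SE => [].
by move=> [/= ? [? ?]]; apply/SE.
Qed.

Let mS2 : measurable S2.
Proof. by apply: (@hp3 1 0 0 0 1 0 (-1) (-1) 1) => x y; rewrite /S2 /=; split => -[? ? ?]; split; lra. Qed.

Let mS3 : measurable S3.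
Proof. by apply: (@hp3 0 1 0 1 (-1) 0 (-1) (-1) 1) => x y; rewrite /S3 /=; split => -[? ? ?]; split; lra. Qed.

Let mS4 : measurable S4.
Proof. by apply: (@hp3 0 1 0 1 (-1) 0 (-1) 0 2^-1) => x y; rewrite /S4 /=; split => -[? ? ?]; split; lra. Qed.

Let dens0 S (x y : R) : S `<=` S2 -> (0 <= dens S x y)%E.
Proof.
move=> SS; rewrite /dens lee_fin indicE; case: (boolP (_ \in _)) => h; last by rewrite mul0r.
move: h; rewrite in_setE => /SS [/= x0 y0 xy]; rewrite mul1r invr_ge0; nra.
Qed.

Let dens_out S (x y : R) : ~ S (x, y) -> dens S x y = 0%E.
Proof. by move=> xS; rewrite /dens indicE memNset ?mul0r. Qed.

Let S32 : S3 `<=` S2. Proof. by move=> [x y] [/= ? ? ?]; split => /=; lra. Qed.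
Let S42 : S4 `<=` S2. Proof. by move=> [x y] [/= ? ? ?]; split => /=; lra. Qed.
Let S22 : S2 `<=` S2. Proof. by []. Qed.

Let vline (c : R) : @conic R := ((0, 0, 0), (1, 0, - c)).
Let hline (c : R) : @conic R := ((0, 0, 0), (0, 1, - c)).
Let diag : @conic R := ((0, 0, 0), (1, -1, 0)).
Let vline0 c : vline c <> ((0, 0, 0), (0, 0, 0)).
Proof. by move=> [] /eqP; rewrite oner_eq0. Qed.
Let hline0 c : hline c <> ((0, 0, 0), (0, 0, 0)).
Proof. by move=> [] /eqP; rewrite oner_eq0. Qed.
Let diag0 : diag <> ((0, 0, 0), (0, 0, 0)).
Proof. by move=> [] /eqP; rewrite oner_eq0. Qed.

Local Open Scope ereal_scope.

(** The similarity (x, y) -> ((x + y) / 2, (x - y) / 2) maps [tri 1] onto [S4], its vertex (1, 0)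
    going to the centre (1/2, 1/2). It doubles the density, which its Jacobian 1/2 compensates. *)
Let int4 : \int[mu]_x \int[mu]_y dens S4 x y = (half 1)%:E.
Proof.
have D0 : (2^-1 * - 2^-1 - 2^-1 * 2^-1 != 0 :> R)%R by rewrite lt_eqF //; lra.
have E := @integral2_affine R (2^-1) (2^-1) 0 (2^-1) (- 2^-1) 0 _ D0 (mdens mS4).
rewrite -E; last by move=> x y; exact: dens0 S42.
have -> : (`|2^-1 * - 2^-1 - 2^-1 * 2^-1| = 2^-1 :> R)%R by rewrite ltr0_norm; lra.
have dE (x y : R) : dens S4 (2^-1 * x + 2^-1 * y + 0)%R (2^-1 * x + - 2^-1 * y + 0)%R =
    (2 * tri_density 1 x y)%:E.
  rewrite /dens /tri_density; congr EFin.
  rewrite (_ : \1_S4 _ = \1_(tri 1) (x, y))%R; last first.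
    rewrite !indicE; congr (nat_of_bool _)%:R%R.
    by apply/idP/idP; rewrite !in_setE /S4 /tri /= => -[h1 h2 h3]; split; lra.
  rewrite mulrCA; congr (_ * _)%R.
  by rewrite [in RHS]invfM [RHS]mulrA mulfV ?pnatr_eq0 // mul1r; congr (_^-1)%R; field.
transitivity ((2^-1)%:E * \int[mu]_x \int[mu]_y (2%:E * (tri_density 1 x y)%:E)).
  by congr (_ * _); apply: eq_integral => x _; apply: eq_integral => y _; rewrite dE EFinM.
have md := @measurable_tri_density R 1.
have d0 (x y : R) : 0 <= (tri_density 1 x y)%:E by rewrite lee_fin tri_density_ge0.
transitivity ((2^-1)%:E * (2%:E * \int[mu]_x \int[mu]_y (tri_density 1 x y)%:E)).
  congr (_ * _); rewrite (ge0_integral_scale _ (measurable_inner md d0)); last 2 first.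
  - by [].
  - by move=> x; apply: integral_ge0.
  apply: eq_integral => x _; rewrite ge0_integral_scale //.
  exact: (measurableT_comp md (pair1_measurable x)).
by rewrite integral_tri // -!EFinM mulrA mulVf ?mul1r // pnatr_eq0.
Qed.

(** The reflection x -> 1 - x preserves the circle, hence the density, and exchanges the two halves
    of [S3], which meet only on the line x = 1/2. *)
Let int3 : 2%:E * \int[mu]_x \int[mu]_y dens S4 x y <= \int[mu]_x \int[mu]_y dens S3 x y.
Proof.
apply: (@double_integral2_le R [:: vline 2^-1] (-1) 0 1 0 1 0).
- by rewrite !mulr1 !mul0r subr0 normrN1.
- by move=> q; rewrite inE => /eqP ->; exact: vline0.
- exact: (mdens mS3).
- by move=> x y; exact: dens0 S32.
- exact: mdens.
- by move=> x y; exact: dens0 S42.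
move=> x y /(_ _ (mem_head _ _)); rewrite /conic_eval/= => nx.
have [h|h] := pselect (S4 (x, y)).
  have [/= h1 h2 h3] := h.
  rewrite [X in _ + X]dens_out ?adde0; last by move=> [/= g1 g2 g3]; apply: nx; lra.
  by rewrite /dens !indicE !mem_set //; split => /=; lra.
rewrite dens_out // add0e.
have [g|g] := pselect (S4 (-1 * x + 0 * y + 1, 0 * x + 1 * y + 0)%R); last first.
  by rewrite dens_out //; exact: dens0 S32.
have [/= g1 g2 g3] := g.
rewrite /dens !indicE !mem_set //; last by split => /=; lra.
by rewrite lee_fin le_eqVlt; apply/orP; left; apply/eqP; congr (_ * _^-1)%R; ring.
Qed.

Let int2 : 2%:E * \int[mu]_x \int[mu]_y dens S3 x y <= \int[mu]_x \int[mu]_y dens S2 x y.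
Proof.
apply: (@double_integral2_le R [:: diag] 0 1 0 1 0 0).
- by rewrite !mul0r mulr1 sub0r normrN1.
- by move=> q; rewrite inE => /eqP ->; exact: diag0.
- exact: mdens.
- by move=> x y; exact: dens0 S22.
- exact: mdens.
- by move=> x y; exact: dens0 S32.
move=> x y /(_ _ (mem_head _ _)); rewrite /conic_eval/= => nx.
have [h|h] := pselect (S3 (x, y)).
  have [/= h1 h2 h3] := h.
  rewrite [X in _ + X]dens_out ?adde0; last by move=> [/= g1 g2 g3]; apply: nx; lra.
  by rewrite /dens !indicE !mem_set //; split => /=; lra.
rewrite dens_out // add0e.
have [g|g] := pselect (S3 (0 * x + 1 * y + 0, 1 * x + 0 * y + 0)%R); last first.
  by rewrite dens_out //; exact: dens0 S22.
have [/= g1 g2 g3] := g.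
rewrite /dens !indicE !mem_set //; last by split => /=; lra.
by rewrite lee_fin le_eqVlt; apply/orP; left; apply/eqP; congr (_ * _^-1)%R; ring.
Qed.

Let J (x y : R) := dens S2 x y + dens S2 (- x)%R y.

Let mJ : measurable_fun setT (fun p : TR * TR => J p.1 p.2).
Proof.
apply: emeasurable_funD; first exact: mdens.
apply: (measurable2_comp (mdens mS2) _ measurable_snd).
by apply: measurableT_comp => //; exact: measurable_fst.
Qed.

Let J0 (x y : R) : 0 <= J x y.
Proof. by rewrite adde_ge0 //; exact: dens0 S22. Qed.

Let int1 : 2%:E * \int[mu]_x \int[mu]_y dens S2 x y <= \int[mu]_x \int[mu]_y J x y.
Proof.
apply: (@double_integral2_le R [::] (-1) 0 0 0 1 0).
- by rewrite !mulr1 !mul0r subr0 normrN1.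
- by [].
- exact: mJ.
- exact: J0.
- exact: mdens.
- by move=> x y; exact: dens0 S22.
by move=> x y _; rewrite /J !mul0r !addr0 add0r mul1r mulN1r.
Qed.

Let I (x y : R) := \int[mu]_l (cone_density (@ideal_octahedron R) apex axis1 axis2 x y l)%:E.

Let int0 : 2%:E * \int[mu]_x \int[mu]_y J x y <= \int[mu]_x \int[mu]_y I x y.
Proof.
apply: (@double_integral2_le R [:: vline 0; hline 0] 1 0 0 0 (-1) 0).
- by rewrite mul1r !mul0r subr0 normrN1.
- by move=> q; rewrite !inE => /orP[/eqP ->|/eqP ->]; [exact: vline0|exact: hline0].
- have mc := measurable_cone_density apex axis1 axis2 measurable_octahedron.
  apply: (measurable_inner (f := fun q l => (cone_density _ apex axis1 axis2 q.1 q.2 l)%:E)).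
    apply: (measurable3_comp mc).
    + exact: (measurableT_comp measurable_fst measurable_fst).
    + exact: (measurableT_comp measurable_snd measurable_fst).
    + exact: measurable_snd.
  by move=> *; rewrite lee_fin cone_density_ge0.
- by move=> x y; apply: integral_ge0 => l _; rewrite lee_fin cone_density_ge0.
- exact: mJ.
- exact: J0.
move=> x y h; have := h _ (mem_head _ _); have hh : hline 0 \in [:: vline 0; hline 0] by rewrite !inE eqxx orbT.
have := h (hline 0) hh.
rewrite /conic_eval/= => ny nx.
have x0 : (x != 0)%R by apply/eqP => e; apply: nx; rewrite e; lra.
have y0 : (y != 0)%R by apply/eqP => e; apply: ny; rewrite e; lra.
have Ipos : 0 <= I x y by apply: integral_ge0 => l _; rewrite lee_fin cone_density_ge0.
rewrite /J !mul0r !addr0 mul1r add0r mulN1r.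
have key (x' y' : R) : x' = `|x|%R -> y' = `|y|%R -> dens S2 x' y' <= I x y.
  move=> ex ey; have [s|s] := pselect (S2 (x', y')); last by rewrite dens_out.
  rewrite /dens indicE mem_set // mul1r; have [/= s1 s2 s3] := s.
  by apply: oct_ray => //; rewrite lt_neqAle ?s1 ?s2 ?andbT eq_sym ?ex ?ey normr_eq0.
have outx (x' y' : R) : (x' < 0)%R -> dens S2 x' y' = 0.
  by move=> x'0; apply: dens_out => -[/= h1 _ _]; lra.
have outy (x' y' : R) : (y' < 0)%R -> dens S2 x' y' = 0.
  by move=> x'0; apply: dens_out => -[/= _ h1 _]; lra.
case: (ltrgt0P x) x0 => [xp|xn|//] _; case: (ltrgt0P y) y0 => [yp|yn|//] _.
- rewrite (outx (- x)%R y) ?(outy x (- y)%R) ?(outx (- x)%R (- y)%R) ?oppr_lt0 // !adde0.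
  by apply: key; apply: esym; apply: gtr0_norm.
- rewrite (outy x y) ?(outx (- x)%R y) ?(outx (- x)%R (- y)%R) ?oppr_lt0 // !adde0 !add0e.
  by apply: key; apply: esym; [apply: gtr0_norm|apply: ltr0_norm].
- rewrite (outx x y) ?(outx x (- y)%R) ?(outy (- x)%R (- y)%R) ?oppr_lt0 // !adde0 !add0e.
  by apply: key; apply: esym; [apply: ltr0_norm|apply: gtr0_norm].
- rewrite (outx x y) ?(outy (- x)%R y) ?(outx x (- y)%R) ?oppr_lt0 // !adde0 !add0e.
  by apply: key; apply: esym; apply: ltr0_norm.
Qed.

(** Four successive doublings give the factor 16. For this direction the sixteen flags have to be
    disjoint up to conics; they need not be shown to exhaust the octahedron. *)
Lemma v8_ge : (16 * half 1)%:E <= v8 R.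
Proof.
have c1 : (1 ^+ 2 + 0 ^+ 2 = 1 :> R)%R by rewrite expr1n expr0n addr0.
have r1 : (0 ^+ 2 + 1 ^+ 2 = 1 :> R)%R by rewrite expr1n expr0n add0r.
have [_ E] := hvolume_euler_frame c1 r1 measurable_octahedron.
rewrite /v8 E; apply: le_trans int0.
have l2 : 0 <= 2%:E :> \bar R by rewrite lee_fin.
apply: le_trans (lee_wpmul2l l2 int1).
apply: le_trans (lee_wpmul2l l2 (lee_wpmul2l l2 int2)).
apply: le_trans (lee_wpmul2l l2 (lee_wpmul2l l2 (lee_wpmul2l l2 int3))).
by rewrite int4 -!EFinM lee_fin; lra.
Qed.

End Octahedron.

(** * The right triangle attached to two orthogonal circles *)

Section FlagTriangle.
Context {R : realType}.
Local Notation mu := (@lebesgue_measure R).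
Local Notation TR := (measurableTypeR R).

Section Coordinates.
Variables (c1 c2 u1 u2 r s sg : R).

(** Together with [flagY], the similarity of ratio 1 / r that sends the centre [c] to (1, 0) and the
    intersection point of the two circles on the side [sg] of the line of centres to the origin. The
    radical axis becomes y = (r / s) x. *)
Definition flagX (w1 w2 : R) : R :=
  1 - ((w1 - c1) * u1 + (w2 - c2) * u2 +
       sg * ((w2 - c2) * u1 - (w1 - c1) * u2) * (s / r)) / (r ^+ 2 + s ^+ 2).

Definition flagY (w1 w2 : R) : R :=
  ((s / r) * ((w1 - c1) * u1 + (w2 - c2) * u2) -
   sg * ((w2 - c2) * u1 - (w1 - c1) * u2)) / (r ^+ 2 + s ^+ 2).

Definition flag_density (w1 w2 : R) : R :=
  \1_(tri (r / s)) (flagX w1 w2, flagY w1 w2) *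
  (2 * (r ^+ 2 - (w1 - c1) ^+ 2 - (w2 - c2) ^+ 2))^-1.

Hypotheses (r0 : 0 < r) (s0 : 0 < s) (hu : u1 ^+ 2 + u2 ^+ 2 = r ^+ 2 + s ^+ 2).

Let N0 : 0 < r ^+ 2 + s ^+ 2.
Proof. by rewrite addr_gt0 ?exprn_gt0. Qed.

Lemma measurable_flag_density :
  measurable_fun setT (fun w : TR * TR => (flag_density w.1 w.2)%:E).
Proof.
apply/measurable_EFinP; apply: measurable_funM; last first.
  apply: (measurableT_comp measurable_inv).
  apply: eq_measurable_fun (measurable_quadratic (- 2) 0 (- 2) (4 * c1) (4 * c2)
    (2 * (r ^+ 2 - c1 ^+ 2 - c2 ^+ 2))) => p _; ring.
have mXY : measurable_fun setT (fun w : TR * TR => (flagX w.1 w.2, flagY w.1 w.2) : TR * TR).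
  apply: measurable_fun_pair.
    apply: eq_measurable_fun (measurable_lin2
      (- (u1 - sg * u2 * (s / r)) / (r ^+ 2 + s ^+ 2))
      (- (u2 + sg * u1 * (s / r)) / (r ^+ 2 + s ^+ 2))
      (1 + (c1 * u1 + c2 * u2 + sg * (c2 * u1 - c1 * u2) * (s / r)) / (r ^+ 2 + s ^+ 2))) => p _.
    by rewrite /flagX; ring.
  apply: eq_measurable_fun (measurable_lin2
    ((s / r * u1 + sg * u2) / (r ^+ 2 + s ^+ 2))
    ((s / r * u2 - sg * u1) / (r ^+ 2 + s ^+ 2))
    (- (s / r * (c1 * u1 + c2 * u2) - sg * (c2 * u1 - c1 * u2)) / (r ^+ 2 + s ^+ 2))) => p _.
  by rewrite /flagY; ring.
have mi : measurable_fun setT (\1_(tri (r / s)) : TR * TR -> R).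
  by apply: measurable_indic; exact: measurable_tri.
exact: (measurableT_comp mi mXY).
Qed.

Let flag_power (w1 w2 : R) : sg * sg = 1 ->
  r ^+ 2 - (w1 - c1) ^+ 2 - (w2 - c2) ^+ 2 =
  r ^+ 2 * (2 * flagX w1 w2 - flagX w1 w2 ^+ 2 - flagY w1 w2 ^+ 2).
Proof.
move=> sg1; set a := (w1 - c1) * u1 + (w2 - c2) * u2.
set b := sg * ((w2 - c2) * u1 - (w1 - c1) * u2).
(* Lagrange's identity: [a] is the scalar product and [b] the signed cross product of w - c with
   [u], whose squared length is [r ^+ 2 + s ^+ 2]. *)
have ab : a ^+ 2 + b ^+ 2 = ((w1 - c1) ^+ 2 + (w2 - c2) ^+ 2) * (r ^+ 2 + s ^+ 2).
  rewrite -hu /a /b exprMn (_ : sg ^+ 2 = 1); [ring|by rewrite expr2].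
have E : r ^+ 2 * (2 * flagX w1 w2 - flagX w1 w2 ^+ 2 - flagY w1 w2 ^+ 2) =
    r ^+ 2 - (a ^+ 2 + b ^+ 2) / (r ^+ 2 + s ^+ 2).
  rewrite /flagX /flagY -/a -/b; field; by rewrite !gt_eqF.
by rewrite E ab mulfK ?gt_eqF //; ring.
Qed.

Lemma flag_density_ge0 w1 w2 : sg * sg = 1 -> 0 <= flag_density w1 w2.
Proof.
move=> sg1; rewrite /flag_density flag_power //.
have := @tri_density_ge0 R (r / s) (flagX w1 w2) (flagY w1 w2) (divr_gt0 r0 s0).
rewrite /tri_density; set i := \1_ _ _; set q := _ - _ - _ => h.
rewrite mulrCA invfM mulrA -[X in X * _ * _]invrK -[X in _ <= X]mulrA.
by rewrite invrK mulrCA mulr_ge0 ?invr_ge0 ?sqr_ge0 // invfM -mulrA mulrCA; move: h; rewrite invfM.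
Qed.

Lemma integral_flag : sg * sg = 1 ->
  (\int[mu]_w1 \int[mu]_w2 (flag_density w1 w2)%:E = (half (r / s))%:E)%E.
Proof.
move=> sg1; set N := r ^+ 2 + s ^+ 2.
have Nn0 : N != 0 by rewrite gt_eqF.
have rn0 : r != 0 by rewrite gt_eqF.
have sn0 : s != 0 by rewrite gt_eqF.
(* The inverse similarity is (x, y) -> c + (x - 1) e + y f, with columns e = ([e1], [e2]) and f =
   ([f1], [f2]). *)
pose e1 := - (r ^+ 2 / N * u1 - sg * r * s / N * u2).
pose e2 := - (r ^+ 2 / N * u2 + sg * r * s / N * u1).
pose f1 := r * s / N * u1 + sg * r ^+ 2 / N * u2.
pose f2 := r * s / N * u2 - sg * r ^+ 2 / N * u1.
have det : e1 * f2 - f1 * e2 = sg * r ^+ 2.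
  transitivity (sg * r ^+ 2 * (r ^+ 2 + s ^+ 2) * (u1 ^+ 2 + u2 ^+ 2) / N ^+ 2).
    by rewrite /e1 /e2 /f1 /f2; field.
  by rewrite hu -/N; field.
have adet : `|sg * r ^+ 2| = r ^+ 2.
  by rewrite normrM [`|r ^+ 2|]ger0_norm ?sqr_ge0 // -[RHS]mul1r; congr (_ * _);
     apply/eqP; rewrite -sqrp_eq1 ?normr_ge0 // real_normK ?num_real // expr2 sg1.
have D0 : e1 * f2 - f1 * e2 != 0.
  by rewrite det -normr_gt0 adet exprn_gt0.
have E := @integral2_affine R e1 f1 (c1 - e1) e2 f2 (c2 - e2)
  (fun w1 w2 => (flag_density w1 w2)%:E) D0 measurable_flag_density.
rewrite -E; last by move=> x y; rewrite lee_fin flag_density_ge0.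
rewrite det adet.
have au x y : (e1 * x + f1 * y + (c1 - e1) - c1) * u1 + (e2 * x + f2 * y + (c2 - e2) - c2) * u2 =
   (1 - x) * r ^+ 2 + y * (r * s).
  transitivity (((1 - x) * r ^+ 2 + y * (r * s)) * (u1 ^+ 2 + u2 ^+ 2) / N).
    by rewrite /e1 /e2 /f1 /f2; field.
  by rewrite hu -/N mulfK.
have bu x y : sg * ((e2 * x + f2 * y + (c2 - e2) - c2) * u1 - (e1 * x + f1 * y + (c1 - e1) - c1) * u2) =
   (1 - x) * (r * s) - y * r ^+ 2.
  transitivity (((1 - x) * (r * s) - y * r ^+ 2) * (u1 ^+ 2 + u2 ^+ 2) * (sg * sg) / N).
    by rewrite /e1 /e2 /f1 /f2; field.
  by rewrite hu -/N sg1 mulr1 mulfK.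
have EX x y : flagX (e1 * x + f1 * y + (c1 - e1)) (e2 * x + f2 * y + (c2 - e2)) = x.
  rewrite /flagX au bu; field; by rewrite rn0 -/N Nn0.
have EY x y : flagY (e1 * x + f1 * y + (c1 - e1)) (e2 * x + f2 * y + (c2 - e2)) = y.
  rewrite /flagY au bu; field; by rewrite rn0 -/N Nn0.
have dE x y : flag_density (e1 * x + f1 * y + (c1 - e1)) (e2 * x + f2 * y + (c2 - e2)) =
    (r ^- 2) * tri_density (r / s) x y.
  rewrite /flag_density flag_power // EX EY /tri_density [RHS]mulrCA; congr (_ * _).
  by rewrite mulrCA invfM.
have md := @measurable_tri_density R (r / s).
have d0 x y : (0 <= (tri_density (r / s) x y)%:E)%E by rewrite lee_fin tri_density_ge0 // divr_gt0.
have r20 : 0 <= r ^- 2 by rewrite invr_ge0 sqr_ge0.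
transitivity ((r ^+ 2)%:E * ((r ^- 2)%:E * \int[mu]_x \int[mu]_y (tri_density (r / s) x y)%:E))%E.
  congr (_ * _)%E; rewrite (ge0_integral_scale r20 (measurable_inner (f := fun x y => (tri_density (r / s) x y)%:E) md d0)); last first.
    by move=> x; apply: integral_ge0 => y _; apply: d0.
  apply: eq_integral => x _.
  rewrite (ge0_integral_scale r20 (measurableT_comp md (pair1_measurable x))); last by move=> y; apply: d0.
  by apply: eq_integral => y _; rewrite dE EFinM.
by rewrite integral_tri ?divr_gt0 // -!EFinM mulrA mulfV ?mul1r // expf_neq0.
Qed.

(* The point is [c + th (z - c)] with [z] on the radical axis [(z - c).u = r^2]
   of the circles of centres [c] and [c + u], and the sign [sg] tells on which
   side of the line of centres it lies. *)
Lemma flag_cover (th z1 z2 : R) : 0 <= th -> th <= 1 ->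
  (z1 - c1) * u1 + (z2 - c2) * u2 = r ^+ 2 ->
  (z1 - c1) ^+ 2 + (z2 - c2) ^+ 2 <= r ^+ 2 -> sg * sg = 1 ->
  0 <= sg * ((z2 - c2) * u1 - (z1 - c1) * u2) ->
  tri (r / s) (flagX (c1 + th * (z1 - c1)) (c2 + th * (z2 - c2)),
               flagY (c1 + th * (z1 - c1)) (c2 + th * (z2 - c2))).
Proof.
move=> th0 th1 hz hz2 sg1; set b := sg * _ => b0.
have rn0 : r != 0 by rewrite gt_eqF.
have sn0 : s != 0 by rewrite gt_eqF.
have Nn0 : r ^+ 2 + s ^+ 2 != 0 by rewrite gt_eqF.
(* On the radical axis the scalar product with [u] is r^2, so being inside the circle bounds [b] by
   r s, its value at the intersection point of the circles. *)
have bb : b ^+ 2 <= (r * s) ^+ 2.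
  have -> : b ^+ 2 = ((z1 - c1) ^+ 2 + (z2 - c2) ^+ 2) * (r ^+ 2 + s ^+ 2) - (r ^+ 2) ^+ 2.
    rewrite -hu -hz /b exprMn (_ : sg ^+ 2 = 1); [ring|by rewrite expr2].
  rewrite (_ : (r * s) ^+ 2 = r ^+ 2 * (r ^+ 2 + s ^+ 2) - (r ^+ 2) ^+ 2); last ring.
  by rewrite lerD2r ler_wpM2r // ltW.
have brs : b <= r * s by rewrite -(@ler_pXn2r _ 2) // nnegrE // mulr_ge0 // ltW.
have EX : flagX (c1 + th * (z1 - c1)) (c2 + th * (z2 - c2)) =
    1 - th * (r ^+ 2 + b * (s / r)) / (r ^+ 2 + s ^+ 2).
  by rewrite /flagX /b; congr (1 - _ / _); rewrite -hz; ring.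
have EY : flagY (c1 + th * (z1 - c1)) (c2 + th * (z2 - c2)) =
    th * (r * s - b) / (r ^+ 2 + s ^+ 2).
  rewrite /flagY (_ : r * s = s / r * r ^+ 2); last by field.
  by rewrite /b; congr (_ / _); rewrite -hz; ring.
rewrite /tri /= EX EY; split.
- by rewrite divr_ge0 ?mulr_ge0 ?subr_ge0 // ltW.
- rewrite -subr_ge0 (_ : _ - _ = (r / s) * (1 - th)); last by field; rewrite sn0 Nn0.
  by apply: mulr_ge0; [exact: ltW (divr_gt0 r0 s0)|rewrite subr_ge0].
- rewrite -subr_ge0 (_ : _ - _ = th * b / (r * s)); last by field; rewrite sn0 rn0 Nn0.
  by apply: divr_ge0; [exact: mulr_ge0|exact: ltW (mulr_gt0 r0 s0)].
Qed.

End Coordinates.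
End FlagTriangle.

(** * Linear algebra of 3-space and affine independence *)

Section Space.
Context {R : realType}.
Implicit Types (x y z u v a : 'rV[R]_3) (A : set 'rV[R]_3).

Let cvg_coord (k : 'I_3) x : (fun y : 'rV[R]_3 => y 0 k) @ x --> x 0 k.
Proof. exact: coord_continuous. Qed.

Lemma dot_continuous a : continuous (fun x => dot a x).
Proof.
move=> x; have t k : {for x, continuous (fun y : 'rV[R]_3 => a 0 k * y 0 k)}.
  exact: (continuousM (@cst_continuous _ _ (a 0 k) x) (@cvg_coord k x)).
under eq_fun do rewrite dotE.
exact: (continuousD (continuousD (t 0) (t 1)) (t (1 + 1))).
Qed.

Lemma dotxx_continuous : continuous (fun x => dot x x).
Proof.
move=> x; have t k : {for x, continuous (fun y : 'rV[R]_3 => y 0 k * y 0 k)}.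
  exact: (continuousM (@cvg_coord k x) (@cvg_coord k x)).
under eq_fun do rewrite dotE.
exact: (continuousD (continuousD (t 0) (t 1)) (t (1 + 1))).
Qed.

Lemma dotxx_ge0 x : 0 <= dot x x.
Proof. by rewrite dotE -!expr2 !addr_ge0 ?sqr_ge0. Qed.

Lemma dotxx_eq0 x : dot x x = 0 -> x = 0.
Proof.
rewrite dotE -!expr2 => h; have := sqr_ge0 (x 0 0); have := sqr_ge0 (x 0 1).
have := sqr_ge0 (x 0 (1 + 1)) => h2 h1 h0.
by apply: rV3P; rewrite !mxE; apply/eqP; rewrite -sqrf_eq0; apply/eqP; lra.
Qed.

Lemma dotxx_gt0 x : x != 0 -> 0 < dot x x.
Proof. by move=> x0; rewrite lt_neqAle dotxx_ge0 andbT eq_sym; apply: contra x0 => /eqP/dotxx_eq0/eqP. Qed.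

Lemma cauchy_schwarz x y : dot x y ^+ 2 <= dot x x * dot y y.
Proof.
rewrite -subr_ge0; have -> : dot x x * dot y y - dot x y ^+ 2 =
  (x 0 0 * y 0 1 - x 0 1 * y 0 0) ^+ 2 + (x 0 0 * y 0 (1 + 1) - x 0 (1 + 1) * y 0 0) ^+ 2
  + (x 0 1 * y 0 (1 + 1) - x 0 (1 + 1) * y 0 1) ^+ 2 by rewrite !dotE; ring.
by rewrite !addr_ge0 ?sqr_ge0.
Qed.

Definition cross x y : 'rV[R]_3 :=
  pt (x 0 1 * y 0 (1 + 1) - x 0 (1 + 1) * y 0 1)
     (x 0 (1 + 1) * y 0 0 - x 0 0 * y 0 (1 + 1))
     (x 0 0 * y 0 1 - x 0 1 * y 0 0).

Lemma orth2_parallel x y a : dot a x = 0 -> dot a y = 0 ->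
  dot (cross x y) (cross x y) *: a = dot a (cross x y) *: cross x y.
Proof.
move=> ax ay; apply: rV3P; rewrite [LHS]mxE [RHS]mxE !(dotE (cross x y)) !(dotE a) !ptE; apply/eqP; rewrite -subr_eq0; apply/eqP.
- transitivity (dot a y * (cross x y 0 1 * x 0 (1+1) - cross x y 0 (1+1) * x 0 1) -
    dot a x * (cross x y 0 1 * y 0 (1+1) - cross x y 0 (1+1) * y 0 1)).
    by rewrite !dotE !ptE; ring.
  by rewrite ax ay; ring.
- transitivity (dot a y * (cross x y 0 (1+1) * x 0 0 - cross x y 0 0 * x 0 (1+1)) -
    dot a x * (cross x y 0 (1+1) * y 0 0 - cross x y 0 0 * y 0 (1+1))).
    by rewrite !dotE !ptE; ring.
  by rewrite ax ay; ring.
- transitivity (dot a y * (cross x y 0 0 * x 0 1 - cross x y 0 1 * x 0 0) -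
    dot a x * (cross x y 0 0 * y 0 1 - cross x y 0 1 * y 0 0)).
    by rewrite !dotE !ptE; ring.
  by rewrite ax ay; ring.
Qed.

Lemma parallel_of_orth2 x y a b : cross x y != 0 -> a != 0 ->
  dot a x = 0 -> dot a y = 0 -> dot b x = 0 -> dot b y = 0 -> exists c, b = c *: a.
Proof.
move=> n0 a0 ax ay bx by0.
have nn := dotxx_gt0 n0.
have Ea := orth2_parallel ax ay; have Eb := orth2_parallel bx by0.
have an : dot a (cross x y) != 0.
  apply: contra a0 => /eqP an; move: Ea; rewrite an scale0r => /eqP.
  by rewrite scaler_eq0 gt_eqF.
exists (dot b (cross x y) / dot a (cross x y)).
apply: (scalerI (lt0r_neq0 nn)); rewrite Eb scalerA mulrC -scalerA Ea scalerA.
by rewrite mulfVK.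
Qed.

Lemma cross_eq0_parallel x y : cross x y = 0 -> x != 0 -> exists c, y = c *: x.
Proof.
move=> c0 x0; exists (dot x y / dot x x).
have xx := dotxx_gt0 x0.
apply: (scalerI (lt0r_neq0 xx)); rewrite scalerA mulrCA mulfV ?gt_eqF // mulr1.
have e k : cross x y 0 k = 0 by rewrite c0 mxE.
have e0 := e 0; have e1 := e 1; have e2 := e (1 + 1); rewrite !ptE in e0 e1 e2.
apply: rV3P; rewrite !mxE !dotE; apply/eqP; rewrite -subr_eq0; apply/eqP.
- transitivity (x 0 (1+1) * (x 0 (1 + 1) * y 0 0 - x 0 0 * y 0 (1 + 1)) - x 0 1 * (x 0 0 * y 0 1 - x 0 1 * y 0 0)); first ring.
  by rewrite e1 e2; ring.
- transitivity (x 0 0 * (x 0 0 * y 0 1 - x 0 1 * y 0 0) - x 0 (1+1) * (x 0 1 * y 0 (1 + 1) - x 0 (1 + 1) * y 0 1)); first ring.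
  by rewrite e0 e2; ring.
- transitivity (x 0 1 * (x 0 1 * y 0 (1 + 1) - x 0 (1 + 1) * y 0 1) - x 0 0 * (x 0 (1 + 1) * y 0 0 - x 0 0 * y 0 (1 + 1))); first ring.
  by rewrite e0 e1; ring.
Qed.

(** All three vectors lie in the plane orthogonal to [u]. If [x] and [y] are not parallel,
    [cross x y] is a normal of that plane, and the coefficients are those of Cramer's rule inside
    it. *)
Lemma dependent_of_orth x y z u : u != 0 -> dot x u = 0 -> dot y u = 0 -> dot z u = 0 ->
  exists al be ga, [/\ al *: x + be *: y + ga *: z = 0 & (al, be, ga) <> (0, 0, 0)].
Proof.
move=> u0 xu yu zu.
have [xy|xy] := eqVneq (cross x y) 0.
  have [x0|x0] := eqVneq x 0.
    exists 1, 0, 0; rewrite x0 !scale0r scaler0 !addr0; split => // -[] /eqP.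
    by rewrite oner_eq0.
  have [c yE] := cross_eq0_parallel xy x0.
  exists c, (-1), 0; rewrite yE scale0r addr0 scaleN1r subrr; split => // -[_ /eqP].
  by rewrite oppr_eq0 oner_eq0.
have n0 := dotxx_gt0 xy.
have ux : dot u x = 0 by rewrite dotC.
have uy : dot u y = 0 by rewrite dotC.
have zn : dot z (cross x y) = 0.
  have E := orth2_parallel ux uy.
  have un : dot u (cross x y) != 0.
    apply: contra u0 => /eqP un; move: E; rewrite un scale0r => /eqP.
    by rewrite scaler_eq0 gt_eqF.
  have : dot z (dot (cross x y) (cross x y) *: u) = 0 by rewrite dotZr zu mulr0.
  by rewrite E dotZr => /eqP; rewrite mulf_eq0 (negbTE un) => /eqP.
set n := cross x y in n0 zn *.
exists (dot z (cross y n)), (- dot z (cross x n)), (- dot n n); split; last first.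
  by move=> [_ _ /eqP]; rewrite oppr_eq0 gt_eqF.
have E k : (dot z (cross y n) *: x + (- dot z (cross x n)) *: y + (- dot n n) *: z) 0 k =
    dot z (cross y n) * x 0 k - dot z (cross x n) * y 0 k - dot n n * z 0 k.
  by rewrite !mxE mulNr mulNr.
have zE : z 0 0 * (x 0 1 * y 0 (1 + 1) - x 0 (1 + 1) * y 0 1) + z 0 1 * (x 0 (1 + 1) * y 0 0 - x 0 0 * y 0 (1 + 1)) + z 0 (1+1) * (x 0 0 * y 0 1 - x 0 1 * y 0 0) = 0.
  by move: zn; rewrite /n dotE !ptE.
apply: rV3P; rewrite E [RHS]mxE.
- transitivity (- n 0 0 * dot z n); last by rewrite zn mulr0.
  by rewrite /n !dotE !ptE; ring.
- transitivity (- n 0 1 * dot z n); last by rewrite zn mulr0.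
  by rewrite /n !dotE !ptE; ring.
- transitivity (- n 0 (1 + 1) * dot z n); last by rewrite zn mulr0.
  by rewrite /n !dotE !ptE; ring.
Qed.

Lemma ord3P (k : 'I_3) : [\/ k = 0, k = 1 | k = 1 + 1].
Proof.
by case: k => -[|[|[|//]]] ki; [apply: Or31|apply: Or32|apply: Or33]; apply/val_inj.
Qed.

Lemma cross_eq0_minors x y (k : 'I_3) : cross x y = 0 -> y 0 k *: x - x 0 k *: y = 0.
Proof.
move=> c0; have e k' : cross x y 0 k' = 0 by rewrite c0 mxE.
have e0 := e 0; have e1 := e 1; have e2 := e (1 + 1); rewrite !ptE in e0 e1 e2.
have E l : (y 0 k *: x - x 0 k *: y) 0 l = y 0 k * x 0 l - x 0 k * y 0 l by rewrite !mxE.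
by case: (ord3P k) E => -> E; apply: rV3P; rewrite E [RHS]mxE; lra.
Qed.

Let row2 (m : nat) (M : 'M[R]_(m, 3)) : row_free M ->
  forall r : 'rV[R]_m, r *m M = 0 -> r = 0.
Proof. by move=> fM r h; apply: (row_free_inj fM); rewrite mul0mx. Qed.

Lemma aff_indep2P (x : 'I_2 -> 'rV[R]_3) :
  affinely_independent x <-> x (lift ord0 ord0) - x ord0 != 0.
Proof.
rewrite /affinely_independent; set M := \matrix_(i < 1) _.
have ME r : r *m M = r 0 0 *: (x (lift ord0 ord0) - x ord0).
  by apply/rowP => k; rewrite !mxE big_ord1 !mxE.
split.
  move=> /row2 h; apply: contraPneq (oner_neq0 R) => e.
  have /rowP/(_ 0) : (const_mx 1 : 'rV[R]_1) = 0 by apply: h; rewrite ME e scaler0.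
  by rewrite !mxE => ->; rewrite eqxx.
move=> n0; apply: inj_row_free => r; rewrite ME => /eqP; rewrite scaler_eq0 (negbTE n0) orbF.
by move=> /eqP h; apply/rowP => i; rewrite ord1 h mxE.
Qed.

Lemma aff_indep3P (x : 'I_3 -> 'rV[R]_3) :
  affinely_independent x <->
  cross (x (lift ord0 ord0) - x ord0) (x (lift ord0 (lift ord0 ord0)) - x ord0) != 0.
Proof.
rewrite /affinely_independent; set M := \matrix_(i < 2) _.
set u := _ (lift ord0 ord0) - _; set v := _ - _.
have ME r : r *m M = r 0 ord0 *: u + r 0 (lift ord0 ord0) *: v.
  apply/rowP => k; rewrite !mxE big_ord_recl big_ord1 !mxE.
  by congr (_ * _ + _ * _); rewrite /u /v !mxE.
split.
  move=> /row2 h; apply/negP => /eqP c0.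
  have z k : u 0 k = 0 /\ v 0 k = 0.
    pose r : 'rV[R]_2 := \row_i (if i == ord0 then v 0 k else - u 0 k).
    have r0 : r = 0.
      have ra : r 0 ord0 = v 0 k by rewrite mxE.
      have rb : r 0 (lift ord0 ord0) = - u 0 k by rewrite mxE.
      by apply: h; rewrite ME ra rb scaleNr; exact: cross_eq0_minors.
    have /rowP r0' := r0; have := r0' ord0; have := r0' (lift ord0 ord0).
    by rewrite [X in X = _]mxE /= [X in _ = X]mxE => /eqP; rewrite oppr_eq0 => /eqP -> ; rewrite [X in X = _]mxE /= [X in _ = X]mxE.
  have : (const_mx 1 : 'rV[R]_2) = 0.
    apply: h; rewrite ME; apply/rowP => k; have [uk vk] := z k.
    set c : 'rV[R]_2 := const_mx 1.
    transitivity (c 0 ord0 * u 0 k + c 0 (lift ord0 ord0) * v 0 k); first by rewrite !mxE.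
    by rewrite uk vk !mulr0 addr0 mxE.
  by move=> /rowP/(_ 0); rewrite !mxE => /eqP; rewrite oner_eq0.
move=> n0; apply: inj_row_free => r; rewrite ME => h.
have hk k : r 0 ord0 * u 0 k + r 0 (lift ord0 ord0) * v 0 k = 0.
  by move/rowP: h => /(_ k); rewrite [RHS]mxE => <-; rewrite !mxE.
have h0 := hk 0; have h1 := hk 1; have h2 := hk (1 + 1).
have c i : r 0 i = 0.
  apply/eqP; apply: contraR n0 => ri; apply/eqP.
  have key w : r 0 i * w = 0 -> w = 0 by move=> /eqP; rewrite mulf_eq0 (negbTE ri) => /eqP.
  case: i ri key => -[|[|//]] ii ri key;
  [rewrite (_ : Ordinal ii = ord0) in ri key|rewrite (_ : Ordinal ii = lift ord0 ord0) in ri key]; try exact: val_inj;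
  apply: rV3P; rewrite ptE [RHS]mxE; apply: key.
  - transitivity ((r 0 ord0 * u 0 1 + r 0 (lift ord0 ord0) * v 0 1) * v 0 (1 + 1) -
      (r 0 ord0 * u 0 (1+1) + r 0 (lift ord0 ord0) * v 0 (1+1)) * v 0 1); first ring.
    by rewrite h1 h2; ring.
  - transitivity ((r 0 ord0 * u 0 (1+1) + r 0 (lift ord0 ord0) * v 0 (1+1)) * v 0 0 -
      (r 0 ord0 * u 0 0 + r 0 (lift ord0 ord0) * v 0 0) * v 0 (1+1)); first ring.
    by rewrite h0 h2; ring.
  - transitivity ((r 0 ord0 * u 0 0 + r 0 (lift ord0 ord0) * v 0 0) * v 0 1 -
      (r 0 ord0 * u 0 1 + r 0 (lift ord0 ord0) * v 0 1) * v 0 0); first ring.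
    by rewrite h0 h1; ring.
  - transitivity (u 0 1 * (r 0 ord0 * u 0 (1+1) + r 0 (lift ord0 ord0) * v 0 (1+1)) -
      u 0 (1+1) * (r 0 ord0 * u 0 1 + r 0 (lift ord0 ord0) * v 0 1)); first ring.
    by rewrite h1 h2; ring.
  - transitivity (u 0 (1+1) * (r 0 ord0 * u 0 0 + r 0 (lift ord0 ord0) * v 0 0) -
      u 0 0 * (r 0 ord0 * u 0 (1+1) + r 0 (lift ord0 ord0) * v 0 (1+1))); first ring.
    by rewrite h0 h2; ring.
  - transitivity (u 0 0 * (r 0 ord0 * u 0 1 + r 0 (lift ord0 ord0) * v 0 1) -
      u 0 1 * (r 0 ord0 * u 0 0 + r 0 (lift ord0 ord0) * v 0 0)); first ring.
    by rewrite h0 h1; ring.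
by apply/rowP => i; rewrite c mxE.
Qed.

Lemma aff_dep4 (x : 'I_4 -> 'rV[R]_3) a b : a != 0 -> (forall i, dot a (x i) = b) ->
  ~~ affinely_independent x.
Proof.
move=> a0 xb; apply/negP; rewrite /affinely_independent row_free_unit => uM.
set M := \matrix_(i < 3) _ in uM.
have Ma : M *m a^T = 0.
  apply/colP => i; rewrite mxE [RHS]mxE.
  transitivity (dot (x (lift ord0 i) - x ord0) a).
    by rewrite /dot; apply: eq_bigr => k _; rewrite !mxE.
  by rewrite dotDl dotNl -!(dotC a) !xb subrr.
move: (mulKmx uM a^T); rewrite Ma mulmx0 => /esym/(congr1 trmx).
by rewrite trmxK trmx0; apply/eqP.
Qed.

Lemma dim2_le A a b : a != 0 -> (forall x, A x -> dot a x = b) ->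
  forall x : 'I_4 -> 'rV[R]_3, (forall i, A (x i)) -> ~~ affinely_independent x.
Proof. by move=> a0 Ab x xA; apply: aff_dep4 a0 _ => i; apply: Ab. Qed.

Lemma dim1_le A a b a' b' : cross a a' != 0 ->
  (forall x, A x -> dot a x = b) -> (forall x, A x -> dot a' x = b') ->
  forall x : 'I_3 -> 'rV[R]_3, (forall i, A (x i)) -> ~~ affinely_independent x.
Proof.
move=> c0 Ab Ab' x xA; apply/negP => /aff_indep3P; set u := _ - _; set v := _ - _ => n0.
have ua : dot a u = 0 by rewrite dotDr dotNr !Ab // subrr.
have ua' : dot a' u = 0 by rewrite dotDr dotNr !Ab' // subrr.
have va : dot a v = 0 by rewrite dotDr dotNr !Ab // subrr.
have va' : dot a' v = 0 by rewrite dotDr dotNr !Ab' // subrr.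
have a0 : a != 0.
  apply: contra c0 => /eqP ->; apply/eqP; apply: rV3P; rewrite ptE !mxE; ring.
have [c aE] := parallel_of_orth2 n0 a0 ua va ua' va'.
by move/eqP: c0; apply; rewrite aE; apply: rV3P; rewrite ptE !mxE; ring.
Qed.

End Space.

(** * Facets, edges and the local structure of a right-angled ideal polyhedron *)

Section Polyhedron.
Context {R : realType}.
Implicit Types (x y z u v a : 'rV[R]_3) (P A : set 'rV[R]_3).
Local Notation vec := 'rV[R]_3.

Lemma spacelike_neq0 (k : vec * R) : spacelike k -> k.1 != 0.
Proof.
rewrite /spacelike /lorentz => s; apply/negP => /eqP k0; move: s.
by rewrite k0 dotE !mxE; have := sqr_ge0 k.2; rewrite expr2; lra.
Qed.

Lemma eventually_linear (al be : R) : 0 < al ->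
  exists2 d, 0 < d & forall t, 0 <= t <= d -> 0 < al + t * be.
Proof.
move=> al0; have b1 : 0 < `|be| + 1 by rewrite ltr_wpDl.
exists (al / (`|be| + 1)); first by rewrite divr_gt0.
move=> t /andP[t0]; rewrite ler_pdivlMr // => tb.
have : t * - `|be| <= t * be by rewrite ler_wpM2l // lerNl ler_normr lexx orbT.
have [->|tn] := eqVneq t 0; first by rewrite !mul0r addr0.
have : 0 < t by rewrite lt_neqAle eq_sym tn.
nra.
Qed.

Lemma eventually_forall (I : finType) (Q : I -> R -> Prop) :
  (forall i, exists2 d, 0 < d & forall t, 0 <= t <= d -> Q i t) ->
  exists2 d, 0 < d & forall t, 0 <= t <= d -> forall i, Q i t.
Proof.
move=> h; suff [d d0 hd] : exists2 d, 0 < d &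
    forall t, 0 <= t <= d -> forall i, i \in enum I -> Q i t.
  by exists d => // t td i; apply: hd; rewrite ?mem_enum.
elim: (enum I) => [|i s [d d0 IH]]; first by exists 1.
have [e e0 he] := h i; exists (Num.min d e); first by rewrite lt_min d0 e0.
move=> t /andP[t0]; rewrite le_min => /andP[td te] j; rewrite inE => /orP[/eqP ->|js].
  by apply: he; rewrite t0.
by apply: IH js; rewrite t0.
Qed.

Lemma eventually_H3 z u : H3 z ->
  exists2 d, 0 < d & forall t, 0 <= t <= d -> H3 (z + t *: u).
Proof.
rewrite /H3 /= => hz.
have [|d d0 hd] := @eventually_linear (1 - dot z z) (- (2 * `|dot z u| + dot u u)); first lra.
exists (Num.min d 1); first by rewrite lt_min d0 ltr01.
move=> t /andP[t0]; rewrite le_min => /andP[td t1].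
have := hd t; rewrite t0 td => /(_ isT).
rewrite !dotL (dotC u z).
have : t * dot z u <= t * `|dot z u| by rewrite ler_wpM2l // ler_norm.
have : t * t * dot u u <= t * dot u u by rewrite ler_wpM2r ?dotxx_ge0 // -[leRHS]mulr1 ler_wpM2l.
lra.
Qed.

Lemma H3_convex x y (t : R) : H3 x -> H3 y -> 0 <= t <= 1 -> H3 (x + t *: (y - x)).
Proof.
rewrite /H3 /= => hx hy /andP[t0 t1].
have : 0 <= t * (1 - t) * dot (x - y) (x - y).
  by rewrite !mulr_ge0 ?subr_ge0 ?dotxx_ge0.
rewrite !dotL (dotC y x) => h.
have [->|tn] := eqVneq t 0; first by lra.
have tp : 0 < t by rewrite lt_neqAle eq_sym tn.
have : t * dot y y < t * 1 by rewrite ltr_pM2l.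
have : (1 - t) * dot x x <= (1 - t) * 1 by rewrite ler_wpM2l ?subr_ge0 // ltW.
lra.
Qed.

Section Facets.
Variables (P : set vec) (n : nat) (h : 'I_n -> vec * R).

Definition is_hrep :=
  (forall i, spacelike (h i)) /\
  forall x, P x <-> H3 x /\ forall i, dot (h i).1 x <= (h i).2.

Definition irredundant :=
  forall i, exists y, [/\ H3 y, forall j, j != i -> dot (h j).1 y <= (h j).2
    & (h i).2 < dot (h i).1 y].

Definition active i x := dot (h i).1 x = (h i).2.

Hypotheses (hrep : is_hrep) (irr : irredundant).

Let Pspace i : spacelike (h i). Proof. by case: hrep. Qed.
Let hPE x : P x <-> H3 x /\ forall i, dot (h i).1 x <= (h i).2. Proof. by case: hrep. Qed.
Let PH3 x : P x -> H3 x. Proof. by move/hPE => []. Qed.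
Let Ple x i : P x -> dot (h i).1 x <= (h i).2. Proof. by move/hPE => []. Qed.
Let a0 i : (h i).1 != 0. Proof. exact: spacelike_neq0. Qed.

Lemma eventually_P z u : P z -> (forall i, active i z -> dot (h i).1 u <= 0) ->
  exists2 d, 0 < d & forall t, 0 <= t <= d -> P (z + t *: u).
Proof.
move=> Pz act; have [d1 d10 h1] := eventually_H3 u (PH3 Pz).
have hall : forall i, exists2 d, 0 < d & forall t, 0 <= t <= d -> dot (h i).1 (z + t *: u) <= (h i).2.
  move=> i.
  have [e|ne] := eqVneq (dot (h i).1 z) (h i).2.
    exists 1 => // t /andP[t0 _]; rewrite dotDr dotZr e gerDl.
    by rewrite mulr_ge0_le0 // act.
  have lt : 0 < (h i).2 - dot (h i).1 z by rewrite subr_gt0 lt_neqAle ne Ple.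
  have [d d0 hd] := @eventually_linear _ (- dot (h i).1 u) lt.
  by exists d => // t /hd; rewrite dotDr dotZr; lra.
have [d2 d20 h2] := eventually_forall hall.
exists (Num.min d1 d2); first by rewrite lt_min d10 d20.
move=> t /andP[t0]; rewrite le_min => /andP[t1 t2]; apply/hPE; split.
  by apply: h1; rewrite t0.
by move=> i; apply: h2; rewrite t0.
Qed.

Hypothesis Pint : interior P !=set0.

Lemma interior_pt : exists2 o, P o & forall i, dot (h i).1 o < (h i).2.
Proof.
have [ o /nbhs_ballP[e /= e0 oP]] := Pint.
have oPo : P o by apply: oP; exact: ballxx.
exists o => // i.
have n1 : 0 < `|(h i).1| + 1 by rewrite ltr_wpDl.
have d0 : 0 < e / 2 / (`|(h i).1| + 1) by rewrite !divr_gt0.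
have : P (o + (e / 2 / (`|(h i).1| + 1)) *: (h i).1).
  apply: oP; rewrite -ball_normE /= opprD addrA subrr sub0r normrN normrZ (gtr0_norm d0).
  rewrite mulrAC ltr_pdivrMr //; have := normr_ge0 (h i).1; nra.
move/(@Ple _ i); rewrite dotDr dotZr.
have := mulr_gt0 d0 (dotxx_gt0 (a0 i)); lra.
Qed.

(** Irredundancy provides a point violating only the inequality [i]; the segment to it from an
    interior point crosses the plane of [h i] where all other inequalities are still strict. *)
Lemma facet_pt i : exists z, [/\ P z, active i z & forall j, j != i -> dot (h j).1 z < (h j).2].
Proof.
have [ o Po oi] := interior_pt; have [y [Hy yj yi]] := irr i.
pose t := ((h i).2 - dot (h i).1 o) / (dot (h i).1 y - dot (h i).1 o).
have den : 0 < dot (h i).1 y - dot (h i).1 o by have := oi i; lra.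
have t0 : 0 < t by rewrite divr_gt0 // subr_gt0.
have t1 : t < 1 by rewrite ltr_pdivrMr // mul1r; lra.
have ai : active i (o + t *: (y - o)).
  by rewrite /active !dotL /t; field; rewrite gt_eqF.
have aj j : j != i -> dot (h j).1 (o + t *: (y - o)) < (h j).2.
  move=> ji; rewrite !dotL; have := oi j; have := yj j ji.
  move=> y1 o1; have : 0 < (1 - t) * ((h j).2 - dot (h j).1 o) by rewrite mulr_gt0 ?subr_gt0.
  have : 0 <= t * ((h j).2 - dot (h j).1 y) by rewrite mulr_ge0 ?subr_ge0 // ltW.
  lra.
exists (o + t *: (y - o)); split=> //.
apply/hPE; split; first by apply: H3_convex => //; [exact: PH3|rewrite !ltW].
by move=> j; have [->|ji] := eqVneq j i; [rewrite ai|rewrite ltW // aj].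
Qed.

Definition facet i := P `&` plane (h i).

Lemma facetP i x : facet i x <-> P x /\ active i x.
Proof. by split => [[Px [_ e]]|[Px e]] //; split => //; split => //; exact: PH3. Qed.

Lemma facet_inj i j : facet i = facet j -> i = j.
Proof.
move=> e; have [z [Pz zi zj]] := facet_pt i.
have : facet j z by rewrite -e; apply/facetP.
move/facetP => [_ ja]; apply/eqP; apply: contraT; rewrite eq_sym => ji.
by have := zj j ji; rewrite ja ltxx.
Qed.

Lemma orth_pair a : a != 0 -> exists u v, [/\ dot a u = 0, dot a v = 0 & cross u v != 0].
Proof.
move=> an0; have aa := dotxx_gt0 an0.
have sn0 : Num.sqrt (dot a a) != 0 by rewrite gt_eqF // sqrtr_gt0.
have [|u [v [[[_ uu vv] [uv ua va]] _]]] := @hvolume_cone R ((Num.sqrt (dot a a))^-1 *: a).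
  rewrite dotZl dotZr mulrA -expr2 exprVn sqr_sqrtr ?dotxx_ge0 // mulVf //.
  by rewrite gt_eqF.
have orth w : dot w ((Num.sqrt (dot a a))^-1 *: a) = 0 -> dot a w = 0.
  by rewrite dotZr => /eqP; rewrite mulf_eq0 invr_eq0 (negbTE sn0) => /eqP; rewrite dotC.
exists u, v; split; [exact: orth|exact: orth|].
apply/negP => /eqP c0.
have : dot (cross u v) (cross u v) = dot u u * dot v v - dot u v ^+ 2.
  by rewrite !dotE !ptE; ring.
rewrite uu vv uv c0 dotE !mxE !mulr0 !addr0 mulr1 expr0n subr0 => /eqP.
by rewrite eq_sym oner_eq0.
Qed.

Lemma facet_dim2 i : has_dimension 2 (facet i).
Proof.
split; last first.
  apply: (@dim2_le _ _ (h i).1 (h i).2) => // x /facetP[_]; exact.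
have [z [Pz zi zj]] := facet_pt i.
have [u [v [au av uv]]] := orth_pair (a0 i).
have ev w : dot (h i).1 w = 0 -> exists2 d, 0 < d & forall t, 0 <= t <= d -> facet i (z + t *: w).
  move=> aw; have [j|d d0 hd] := @eventually_P z w Pz.
    have [->|ji] := eqVneq j i; first by rewrite aw.
    by rewrite /active => e; have := zj j ji; rewrite e ltxx.
  exists d => // t td; apply/facetP; split; first exact: hd.
  by rewrite /active dotDr dotZr aw mulr0 addr0.
have [d d0 hd] := ev u au; have [e e0 he] := ev v av.
pose x (k : 'I_3) := nth z [:: z; z + d *: u; z + e *: v] k.
exists x; split.
  move=> k; case: (ord3P k) => ->; rewrite /x /=.
  - exact/facetP.
  - by apply: hd; rewrite lexx ltW.
  - by apply: he; rewrite lexx ltW.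
apply/aff_indep3P; rewrite /x /= !(addrC z) !addrK.
rewrite (_ : cross _ _ = (d * e) *: cross u v); last first.
  by apply: rV3P; rewrite [RHS]mxE !ptE !mxE; ring.
by rewrite scaler_eq0 negb_or uv mulf_neq0 // gt_eqF.
Qed.

Lemma facet_supports i : supports 2 P (h i).
Proof.
split; [exact: Pspace| |exact: facet_dim2].
by move=> x Px; split; [exact: PH3|exact: Ple].
Qed.

Lemma facet_face i : face P (facet i).
Proof. by exists (h i) => //; exact: facet_supports. Qed.

(** Without an active constraint at [z] a small step in the direction [k.1] would stay in [P] and
    violate the bound [k.2]. *)
Lemma exists_active (k : vec * R) z : P z -> k.1 != 0 -> (forall x, P x -> dot k.1 x <= k.2) ->
  dot k.1 z = k.2 -> exists i, active i z.
Proof.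
move=> Pz k0 Pk kz; apply: contrapT => na.
have [i|d d0 hd] := @eventually_P z k.1 Pz; first by move=> ai; case: na; exists i.
have := Pk _ (hd d _); rewrite lexx ltW // => /(_ isT).
have := mulr_gt0 d0 (dotxx_gt0 k0); rewrite dotDr dotZr kz; lra.
Qed.

(** At the barycentre [z] of three affinely independent points of [F] some constraint is active; it
    is then active at all three points, so its plane is the supporting plane of [F]. *)
Lemma face_facet F : face P F -> exists i, F = facet i.
Proof.
move=> [k [ks Pk [[x [xF xi]] _]] FE].
have Pkx y : P y -> dot k.1 y <= k.2 by move=> /Pk[].
have xP l : P (x l) by case: (xF l).
have xk l : dot k.1 (x l) = k.2 by case: (xF l) => _ [].
pose x0 := x 0; pose x1 := x (lift ord0 ord0); pose x2 := x (lift ord0 (lift ord0 ord0)).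
pose y := x0 + 2^-1 *: (x1 - x0); pose z := y + 3^-1 *: (x2 - y).
have zE a : dot a z = 3^-1 * (dot a x0 + dot a x1 + dot a x2).
  by rewrite /z /y !dotL; field.
have Pz : P z.
  apply/hPE; split; last first.
    move=> i; rewrite zE; have := Ple i (xP 0); have := Ple i (xP (lift ord0 ord0)).
    have := Ple i (xP (lift ord0 (lift ord0 ord0))); rewrite -/x0 -/x1 -/x2; lra.
  have hx l : H3 (x l) by exact: PH3.
  apply: H3_convex; [apply: H3_convex; [exact: hx|exact: hx|apply/andP; split; lra]|exact: hx|].
  by apply/andP; split; lra.
have kz : dot k.1 z = k.2 by rewrite zE !xk; field.
have [i iz] := exists_active Pz (spacelike_neq0 ks) Pkx kz.
have ix : [/\ dot (h i).1 x0 = (h i).2, dot (h i).1 x1 = (h i).2 & dot (h i).1 x2 = (h i).2].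
  move: iz; rewrite /active zE; have := Ple i (xP 0); have := Ple i (xP (lift ord0 ord0)).
  have := Ple i (xP (lift ord0 (lift ord0 ord0))); rewrite -/x0 -/x1 -/x2 => ? ? ? ?.
  by split; lra.
have [i0 i1 i2] := ix.
move/aff_indep3P: xi; rewrite -[ord0]/(0 : 'I_3) -/x0 -/x1 -/x2 => cr.
have [||||c hc] := parallel_of_orth2 cr (spacelike_neq0 ks) _ _ (b := (h i).1).
- by rewrite dotDr dotNr !xk subrr.
- by rewrite dotDr dotNr !xk subrr.
- by rewrite dotDr dotNr i0 i1 subrr.
- by rewrite dotDr dotNr i0 i2 subrr.
have c0 : c != 0 by apply: contra (a0 i) => /eqP c0; rewrite hc c0 scale0r.
exists i; rewrite FE; apply/seteqP; split => w.
  move=> [Pw [Hw kw]]; apply/facetP; split=> //.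
  by rewrite /active -i0 hc !dotZl kw xk.
move=> /facetP[Pw iw]; split=> //; split; first exact: PH3.
by apply: (mulfI c0); rewrite -(xk 0) -!dotZl -hc iw -i0.
Qed.

Lemma card_faces N : (face P #= `I_N)%card -> N = n.
Proof.
move=> fN; apply/card_eq_II.
apply: card_eq_trans (card_esym fN) _.
rewrite (_ : face P = facet @` [set: 'I_n]); last first.
  apply/seteqP; split => F; first by move=> /face_facet[i ->]; exists i.
  by move=> [i _ <-]; exact: facet_face.
apply: card_eq_trans (card_esym card_II).
by apply: inj_card_eq => i j _ _; exact: facet_inj.
Qed.

Lemma closure_le i x : closure P x -> dot (h i).1 x <= (h i).2.
Proof.
have C : closed [set y : vec | dot (h i).1 y <= (h i).2].
  rewrite (_ : [set _ | _] = (fun y => dot (h i).1 y) @^-1` [set t | t <= (h i).2]) //.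
  by move/continuous_closedP: (@dot_continuous R (h i).1); apply; exact: closed_le.
move=> cx; have := closureS (fun y (Py : P y) => Ple i Py : [set y : vec | dot (h i).1 y <= (h i).2] y) cx.
by rewrite -(iffLR (closure_id _) C).
Qed.

Hypothesis ideal : vertex P `<=` absolute (R:=R).

(* [z] is not ideal, hence not a vertex: it is inside a segment of [closure P]. *)
Lemma edge_dir z : P z -> exists2 u, u != 0 & forall i, active i z -> dot (h i).1 u = 0.
Proof.
move=> Pz; have nv : ~ vertex P z.
  by move=> /ideal; rewrite /absolute /= => e; have := PH3 Pz; rewrite /H3 /= e ltxx.
have cz : closure P z by exact: subset_closure.
have [x [y [t [cx cy t01 zE xy]]]] : exists x y t, [/\ closure P x, closure P y, 0 < t < 1,
    z = t *: x + (1 - t) *: y & x <> y].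
  apply: contrapT => no; apply: nv; split=> // x y t cx cy t01 zE.
  by apply: contrapT => xy; apply: no; exists x, y, t.
exists (x - y); first by rewrite subr_eq0; apply/eqP.
have /andP[t0 t1] := t01.
move=> i; rewrite /active zE !dotL => e.
have hx := closure_le i cx; have hy := closure_le i cy.
have : 0 <= t * ((h i).2 - dot (h i).1 x) by rewrite mulr_ge0 ?subr_ge0 // ltW.
have : 0 <= (1 - t) * ((h i).2 - dot (h i).1 y) by rewrite mulr_ge0 ?subr_ge0 // ltW.
move=> h2 h1.
have t1' : 0 < 1 - t by rewrite subr_gt0.
have /eqP : t * ((h i).2 - dot (h i).1 x) = 0 by lra.
have /eqP : (1 - t) * ((h i).2 - dot (h i).1 y) = 0 by lra.
rewrite !mulf_eq0 (gt_eqF t0) (gt_eqF t1') /= => /eqP ? /eqP ?; lra.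
Qed.

(** The common point lies in [P], hence in the open ball: facets that meet only at an ideal vertex
    are not adjacent. One such point already forces a whole common edge. *)
Definition adj i j : bool := (i != j) && `[< exists z, [/\ P z, active i z & active j z] >].

Lemma adj_sym i j : adj i j = adj j i.
Proof.
rewrite /adj eq_sym; congr (_ && _); apply/asboolP/asboolP => -[z [? ? ?]]; by exists z.
Qed.

Lemma adjP i j : i != j -> forall z, P z -> active i z -> active j z -> adj i j.
Proof. by move=> ij z *; rewrite /adj ij; apply/asboolP; exists z. Qed.

Lemma adjE i j : adj i j -> i != j /\ exists z, [/\ P z, active i z & active j z].
Proof. by move=> /andP[ij /asboolP]. Qed.

Lemma adj_not_scaled i j : adj i j -> forall c, (h j).1 <> c *: (h i).1.
Proof.
move=> /adjE[ij [z [Pz iz jz]]] c jE.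
have jb : (h j).2 = c * (h i).2 by rewrite -jz jE dotZl iz.
have [x [Px ix xj]] := facet_pt i.
have := xj j; rewrite eq_sym ij => /(_ isT); rewrite jE dotZl ix jb ltxx //.
Qed.

Lemma adj_cross i j : adj i j -> cross (h i).1 (h j).1 != 0.
Proof.
move=> ij; apply/negP => /eqP /cross_eq0_parallel/(_ (a0 i)) [c].
exact: adj_not_scaled ij c.
Qed.

Definition ridge i j := facet i `&` facet j.

Lemma ridgeE i j : ridge i j = P `&` plane (h i) `&` plane (h j).
Proof.
apply/seteqP; split => x; first by move=> [[? ?] [? ?]].
by move=> [[? ?] ?]; split.
Qed.

Lemma adj_dim1 i j : adj i j -> has_dimension 1 (ridge i j).
Proof.
move=> ij; split; last first.
  apply: (@dim1_le _ _ (h i).1 (h i).2 (h j).1 (h j).2 (adj_cross ij)).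
    by move=> x [/facetP[]].
  by move=> x [_ /facetP[]].
have [_ [z [Pz iz jz]]] := adjE ij; have [u u0 uact] := edge_dir Pz.
have [k|d d0 hd] := @eventually_P z u Pz; first by move=> /uact ->.
pose x (k : 'I_2) := nth z [:: z; z + d *: u] k.
have inr t : 0 <= t <= d -> ridge i j (z + t *: u).
  move=> td; split; apply/facetP; split; try exact: hd;
  by rewrite /active dotDr dotZr uact // mulr0 addr0.
exists x; split.
  move=> k; rewrite (_ : x k = z + (if k == 0 then 0 else d) *: u).
    by apply: inr; case: ifP => _; rewrite ?lexx ltW.
  by case: k => -[|[|//]] ki; rewrite /x /= ?scale0r ?addr0.
apply/aff_indep2P; rewrite /x /= addrAC subrr add0r.
by rewrite scaler_eq0 negb_or u0 gt_eqF.
Qed.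

Hypothesis ra : right_angled P.

(** The equation says that [k] is Lorentz-orthogonal to the timelike vector (z, 1), and the form is
    nonnegative on the complement of such a vector. *)
Lemma lorentz_orth_ge0 (k : vec * R) z : H3 z -> dot k.1 z = k.2 -> 0 <= lorentz k k.
Proof.
rewrite /H3 /= => hz kz; rewrite /lorentz -kz -expr2 subr_ge0.
apply: le_trans (cauchy_schwarz _ _) _.
by rewrite -[leRHS]mulr1 ler_wpM2l ?dotxx_ge0 // ltW.
Qed.

Lemma lorentz_cauchy_schwarz (k l : vec * R) z : spacelike l -> H3 z ->
  dot k.1 z = k.2 -> dot l.1 z = l.2 -> lorentz k l ^+ 2 <= lorentz k k * lorentz l l.
Proof.
move=> sl hz kz lz.
pose w := (lorentz l l *: k.1 - lorentz k l *: l.1, lorentz l l * k.2 - lorentz k l * l.2).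
have : 0 <= lorentz w w.
  by apply: (lorentz_orth_ge0 hz); rewrite /w /= !dotL kz lz.
have -> : lorentz w w = lorentz l l * (lorentz k k * lorentz l l - lorentz k l ^+ 2).
  by rewrite /w /lorentz /= !dotL (dotC l.1 k.1); ring.
by rewrite pmulr_rge0 // subr_ge0.
Qed.

Lemma adj_lorentz i j : adj i j -> lorentz (h i) (h j) = 0.
Proof.
move=> ij; have [_ [z [Pz iz jz]]] := adjE ij.
have := ra (facet_supports i) (facet_supports j); rewrite -ridgeE => /(_ (adj_dim1 ij)).
rewrite /dihedral_angle; set s := Num.sqrt _ * Num.sqrt _ => da.
have s0 : 0 < s by rewrite mulr_gt0 // sqrtr_gt0; exact: Pspace.
have ac : acos (lorentz (h i) (h j) / s) = pi / 2 by have := @pi_gt0 R; lra.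
(* Outside [-1, 1] the value of [acos] would not determine its argument. The bound holds because the
   two planes meet at the point [z] of the ball. *)
have le1 : `|lorentz (h i) (h j) / s| <= 1.
  rewrite normrM normfV (gtr0_norm s0) ler_pdivrMr // mul1r.
  rewrite -(@ler_pXn2r _ 2) // ?nnegrE ?normr_ge0 // ?(ltW s0) //.
  rewrite real_normK ?num_real // /s exprMn !sqr_sqrtr ?(ltW (Pspace _)) //.
  exact: (lorentz_cauchy_schwarz (Pspace j) (PH3 Pz)).
have := acosK (x := lorentz (h i) (h j) / s); rewrite ac cos_pihalf in_itv /= -ler_norml.
move=> /(_ le1) /esym/eqP; rewrite mulf_eq0 invr_eq0 (gt_eqF s0) orbF => /eqP.
by [].
Qed.

(** Three planes through [z] would have dependent normals, all being orthogonal to the edge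
    direction at [z]. But the three vectors are pairwise Lorentz-orthogonal and spacelike, so every
    coefficient of the relation vanishes. *)
Lemma active_le2 i j k z : P z -> active i z -> active j z -> active k z ->
  i != j -> k = i \/ k = j.
Proof.
move=> Pz iz jz kz ij; apply: contrapT => /not_orP[/eqP ki /eqP kj].
have [u u0 uact] := edge_dir Pz.
have [al [be [ga [e nz]]]] := dependent_of_orth u0 (uact _ iz) (uact _ jz) (uact _ kz).
have lij := adj_lorentz (adjP ij Pz iz jz).
have lki := adj_lorentz (adjP ki Pz kz iz).
have lkj := adj_lorentz (adjP kj Pz kz jz).
(* The relation extends to the offsets because all three planes pass through [z]; it thus becomes a
   relation in R^{3,1}. *)
have e2 : al * (h i).2 + be * (h j).2 + ga * (h k).2 = 0.
  by rewrite -iz -jz -kz -!dotZl -!dotDl e dotE !mxE; ring.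
have L (l : vec * R) : al * lorentz (h i) l + be * lorentz (h j) l + ga * lorentz (h k) l = 0.
  transitivity (dot (al *: (h i).1 + be *: (h j).1 + ga *: (h k).1) l.1 -
    (al * (h i).2 + be * (h j).2 + ga * (h k).2) * l.2); last first.
    by rewrite e e2 dotE !mxE; ring.
  by rewrite /lorentz !dotL; ring.
have lC (p q : vec * R) : lorentz p q = lorentz q p by rewrite /lorentz dotC mulrC.
apply: nz; have Li := L (h i); have Lj := L (h j); have Lk := L (h k).
have si := Pspace i; have sj := Pspace j; have sk := Pspace k.
rewrite /spacelike in si sj sk.
move: Li Lj Lk; rewrite lij lki lkj !(lC (h i) (h k)) !(lC (h j) (h k)) !(lC (h j) (h i)) lij lki lkj.
rewrite !mulr0 !addr0 !add0r => /eqP + /eqP + /eqP.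
by rewrite !mulf_eq0 (gt_eqF si) (gt_eqF sj) (gt_eqF sk) !orbF => /eqP -> /eqP -> /eqP ->.
Qed.

(** The sum of the two inequalities supports [P] exactly along the ridge, and the orthogonality of
    the normals keeps the sum spacelike. *)
Lemma side_of_adj i j : adj i j -> sides P (facet i) (ridge i j).
Proof.
move=> ij; pose k := ((h i).1 + (h j).1, (h i).2 + (h j).2).
have kE : ridge i j = P `&` plane k.
  apply/seteqP; split => x.
    move=> [/facetP[Px ix] /facetP[_ jx]]; split => //; split; first exact: PH3.
    by rewrite /k /= dotDl ix jx.
  move=> [Px [_]]; rewrite /k /= dotDl => e.
  have := Ple i Px; have := Ple j Px => hj hi.
  by split; apply/facetP; split => //; rewrite /active; lra.
split; last by move=> x [].
exists k => //; split.
- have := Pspace i; have := Pspace j; have := adj_lorentz ij; rewrite /spacelike => l0 lj li.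
  have -> : lorentz k k = lorentz (h i) (h i) + 2 * lorentz (h i) (h j) + lorentz (h j) (h j).
    by rewrite /lorentz /k /= !dotL (dotC (h j).1 (h i).1); ring.
  by rewrite l0 mulr0 addr0 addr_gt0.
- move=> x Px; split; first exact: PH3.
  by rewrite /k /= dotDl lerD // Ple.
- by rewrite -kE; exact: adj_dim1.
Qed.

Lemma ridge_inj i j k : adj i j -> adj i k -> ridge i j = ridge i k -> j = k.
Proof.
move=> ij ik e; have [inj [z [Pz iz jz]]] := adjE ij.
have [_ /facetP[_ kz]] : ridge i k z by rewrite -e; split; apply/facetP.
have [ki|//] := active_le2 Pz iz jz kz inj.
by have [] := adjE ik; rewrite ki eqxx.
Qed.

(** A second facet is active at the midpoint [z] of two points of [E]. Its normal, that of [h i] and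
    that of the plane [k] supporting [E] are all orthogonal to [E], hence dependent, and so on
    [facet i] the conditions [j] and [k] agree. *)
Lemma side_adj i E : sides P (facet i) E -> exists2 j, adj i j & E = ridge i j.
Proof.
move=> [[k [ks Pk [[x [xE xi]] dimE]] EE] Ei].
rewrite -EE in xE dimE.
have Pkx y : P y -> dot k.1 y <= k.2 by move=> /Pk[].
have k0 := spacelike_neq0 ks.
pose x0 := x ord0; pose x1 := x (lift ord0 ord0); pose z := x0 + 2^-1 *: (x1 - x0).
move/aff_indep2P: xi; rewrite -/x0 -/x1 => d0.
have xP l : P (x l) by case: (facetP i (x l)) => + _; move=> /(_ (Ei _ (xE l)))[].
have xact l : active i (x l) by case: (facetP i (x l)) => + _; move=> /(_ (Ei _ (xE l)))[].
have xk l : dot k.1 (x l) = k.2 by have := xE l; rewrite EE => -[_ []].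
have zE a : dot a z = 2^-1 * (dot a x0 + dot a x1) by rewrite /z !dotL; field.
have Pz : P z.
  apply/hPE; split.
    apply: H3_convex; [exact: PH3 (xP _)|exact: PH3 (xP _)|apply/andP; split; lra].
  move=> j; rewrite zE; have := Ple j (xP ord0); have := Ple j (xP (lift ord0 ord0)).
  rewrite -/x0 -/x1; lra.
have kz : dot k.1 z = k.2 by rewrite zE !xk; field.
have iz : active i z by rewrite /active zE /x0 /x1 !xact; field.
(* Otherwise the plane of [k] would contain the whole facet, and [E] would be two-dimensional. *)
have npar c : k.1 <> c *: (h i).1.
  move=> kE; have [[y [yF yi]] _] := facet_dim2 i.
  suff : ~~ affinely_independent y by rewrite yi.
  apply: dimE => l; rewrite EE; have /facetP[Py iy] := yF l; split=> //; split; first exact: PH3.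
    by rewrite kE dotZl iy -iz -dotZl -kE.
(* If only [i] were active at [z], one could move from [z] in every direction of the facet plane;
   then [k.1] would vanish on these directions and be parallel to the normal of [h i]. *)
have [j [jz ji]] : exists j, active j z /\ j != i.
  apply: contrapT => no.
  have orth w : dot (h i).1 w = 0 -> dot k.1 w <= 0.
    move=> iw; have [j|d dp hd] := @eventually_P z w Pz.
      have [->|ji] := eqVneq j i; first by rewrite iw.
      by move=> jz; case: no; exists j.
    have := Pkx _ (hd d _); rewrite lexx ltW // => /(_ isT).
    rewrite dotDr dotZr kz => hle; have : d * dot k.1 w <= 0 by lra.
    by rewrite pmulr_rle0.
  have orth0 w : dot (h i).1 w = 0 -> dot k.1 w = 0.
    move=> iw; apply/eqP; rewrite eq_le orth //= -oppr_le0 -dotNr orth //.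
    by rewrite dotNr iw oppr0.
  have [u [v [iu iv uv]]] := orth_pair (a0 i).
  have [c] := parallel_of_orth2 uv (a0 i) iu iv (orth0 _ iu) (orth0 _ iv).
  exact: npar.
have ij : i != j by rewrite eq_sym.
have aij := adjP ij Pz iz jz.
have jx : dot (h j).1 x0 = (h j).2 /\ dot (h j).1 x1 = (h j).2.
  move: jz; rewrite /active zE; have := Ple j (xP ord0); have := Ple j (xP (lift ord0 ord0)).
  by rewrite -/x0 -/x1 => ? ? ?; split; lra.
have [jx0 jx1] := jx.
have ku : dot k.1 (x1 - x0) = 0 by rewrite dotDr dotNr !xk subrr.
have iu : dot (h i).1 (x1 - x0) = 0 by rewrite dotDr dotNr !xact subrr.
have ju : dot (h j).1 (x1 - x0) = 0 by rewrite dotDr dotNr jx0 jx1 subrr.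
have [al [be [ga [e nz]]]] := dependent_of_orth d0 ku iu ju.
have e2 : al * k.2 + be * (h i).2 + ga * (h j).2 = 0.
  by rewrite -kz -iz -jz -!dotZl -!dotDl e dotE !mxE; ring.
have ga0 : ga != 0.
  apply/eqP => g0; move: e; rewrite g0 scale0r addr0 => e.
  have [al0|al0] := eqVneq al 0.
    move/eqP: e; rewrite al0 scale0r add0r scaler_eq0 (negbTE (a0 i)) orbF => /eqP be0.
    by apply: nz; rewrite al0 be0 g0.
  apply: (npar (- be / al)); apply: (scalerI al0); rewrite scalerA mulrCA mulfV // mulr1.
  by apply/eqP; rewrite -subr_eq0 scaleNr opprK e.
have al0 : al != 0.
  apply/eqP => al0; move: e; rewrite al0 scale0r add0r => e.
  apply: (@adj_not_scaled _ _ aij (- be / ga)); apply: (scalerI ga0).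
  rewrite scalerA mulrCA mulfV // mulr1.
  by apply/eqP; rewrite -subr_eq0 scaleNr opprK addrC e.
have ew w : al * dot k.1 w + be * dot (h i).1 w + ga * dot (h j).1 w = 0.
  by rewrite -!dotZl -!dotDl e dotE !mxE; ring.
exists j => //; apply/seteqP; split => w.
  move=> Ew; have := Ew; rewrite EE => -[Pw [_ kw]].
  have /facetP[_ iw] := Ei _ Ew; split; apply/facetP; split => //.
  apply: (mulfI ga0); have := ew w; rewrite kw iw; lra.
move=> [/facetP[Pw iw] /facetP[_ jw]]; rewrite EE; split => //; split; first exact: PH3.
apply: (mulfI al0); have := ew w; rewrite iw jw; lra.
Qed.

Lemma card_II_finset (T : finType) (B : pred T) : (`I_#|B| #= [set x | x \in B])%card.
Proof.
apply: card_eq_trans card_II _; apply: card_esym.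
rewrite (_ : [set x | _] = (fun i : 'I_#|B| => enum_val i) @` [set: 'I_#|B|]).
  by apply: inj_card_eq => i j _ _; exact: enum_val_inj.
apply/seteqP; split => x /=; last by move=> [i _ <-]; exact: enum_valP.
by move=> xB; exists (enum_rank_in xB x) => //; rewrite enum_rankK_in.
Qed.

Lemma card_sides i k : (sides P (facet i) #= `I_k)%card -> #|adj i| = k.
Proof.
move=> sk; apply/card_eq_II; apply: (card_eq_trans _ sk).
apply: card_eq_trans (card_II_finset _) _.
rewrite (_ : sides P (facet i) = ridge i @` [set j | adj i j]); last first.
  apply/seteqP; split => E; first by move=> /side_adj[j ij ->]; exists j.
  by move=> [j ij <-]; exact: side_of_adj.
apply: card_esym; apply: inj_card_eq => j l; rewrite !in_setE /= => ij il.
exact: ridge_inj.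
Qed.

End Facets.

(** A description with the least number of half-spaces is irredundant, since any half-space without
    a witness could be dropped. *)
Lemma irredundant_hrep P : (exists (n : nat) (h : 'I_n -> vec * R),
     (forall i, spacelike (h i)) /\
     P = @H3 R `&` \bigcap_(i in [set: 'I_n]) halfspace (h i)) ->
  exists n (h : 'I_n -> vec * R), is_hrep P h /\ irredundant h.
Proof.
move=> [n0 [h0 [s0 PE0]]].
have ex : exists n, `[< exists h : 'I_n -> vec * R, is_hrep P h >].
  exists n0; apply/asboolP; exists h0; split=> // x; rewrite PE0; split.
    by move=> [Hx hx]; split=> // i; case: (hx i I).
  by move=> [Hx hx]; split=> // i _; split.
case: (ex_minnP ex) => n /asboolP[h hr] nmin; exists n, h; split=> // i.
apply: contrapT => no; case: n h hr nmin i no => [|n] h hr nmin i no; first by case: i {no}.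
suff /nmin : `[< exists h : 'I_n -> vec * R, is_hrep P h >] by rewrite ltnn.
apply/asboolP; exists (h \o lift i); case: hr => s hE; split; first by move=> j; exact: s.
move=> x; rewrite hE; split => -[Hx hx]; split=> //; first by move=> j; exact: hx.
move=> j.
have [->|ji] := eqVneq j i; last first.
  by case: (unliftP i j) ji => [l -> _|-> /eqP//]; exact: hx.
rewrite leNgt; apply/negP => lt; apply: no; exists x; split=> // l li.
by case: (unliftP i l) li => [l' -> _|-> /eqP//]; exact: hx.
Qed.

End Polyhedron.

(** * First exit from a region given by affine inequalities *)

Section AffineExit.
Context {R : realType}.

(** Among the functions that are negative at time 1, the one with the smallest root [A k / - B k] is
    the first to vanish. *)
Lemma first_exit (I : finType) (A B : I -> R) :
  (forall k, 0 <= A k) -> (exists k, A k + B k < 0) ->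
  exists t k, [/\ 0 <= t < 1, forall l, 0 <= A l + t * B l, A k + t * B k = 0
    & A k + B k < 0].
Proof.
move=> A0 [k0 k0n]; pose neg k := A k + B k < 0; pose root k := A k / - B k.
have Bneg k : neg k -> 0 < - B k by rewrite /neg => h; have := A0 k; lra.
case: (arg_minP root (k0n : neg k0)) => k kn kmin.
exists (root k), k; have Bk := Bneg k kn; split => //.
- rewrite /root divr_ge0 ?(ltW Bk) //= ltr_pdivrMr // mul1r; move: kn; rewrite /neg; lra.
- move=> l; have t0 : 0 <= root k by rewrite /root divr_ge0 ?(ltW Bk).
  have t1 : root k <= 1 by rewrite /root ler_pdivrMr // mul1r; move: kn; rewrite /neg; lra.
  have [ln|ln] := ltP (A l + B l) 0.
    have Bl := Bneg l ln; have := kmin l ln; rewrite {2}/root ler_pdivlMr //; lra.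
  have : 0 <= (1 - root k) * A l by rewrite mulr_ge0 ?subr_ge0.
  have : 0 <= root k * (A l + B l) by rewrite mulr_ge0.
  lra.
- have Bn : B k != 0 by rewrite lt_eqF //; lra.
  by rewrite /root; field.
Qed.

Lemma eventually_quadratic (al be ga : R) : 0 < al ->
  exists2 d, 0 < d & forall t, 0 <= t <= d -> 0 < al + t * be + t ^+ 2 * ga.
Proof.
move=> al0; have [d d0 hd] := @eventually_linear R al (- (`|be| + `|ga|)) al0.
exists (Num.min d 1); first by rewrite lt_min d0 ltr01.
move=> t /andP[t0]; rewrite le_min => /andP[td t1].
have := hd t; rewrite t0 td => /(_ isT).
have : t * - `|be| <= t * be by rewrite ler_wpM2l // lerNl ler_normr lexx orbT.
have : t ^+ 2 * - `|ga| <= t ^+ 2 * ga by rewrite ler_wpM2l ?sqr_ge0 // lerNl ler_normr lexx orbT.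
have : t ^+ 2 * `|ga| <= t * `|ga| by rewrite ler_wpM2r // expr2 -[leRHS]mulr1 ler_wpM2l.
lra.
Qed.

End AffineExit.

(** * The polyhedron in the half-space model with the ideal point at infinity *)

Section Cone.
Context {R : realType}.
Local Notation vec := 'rV[R]_3.
Local Notation mu := (@lebesgue_measure R).
Local Notation TR := (measurableTypeR R).
Variables (P : set vec) (n : nat) (h : 'I_n -> vec * R) (v e1 e2 : vec).
Hypotheses (hrep : is_hrep P h) (Pint : interior P !=set0).
Hypotheses (fr : frame v e1 e2) (cv : closure P v).

Local Notation p i := (dot (h i).1 e1).
Local Notation q i := (dot (h i).1 e2).
Local Notation be i := (dot (h i).1 v).
Local Notation b i := ((h i).2).

(* In the half-space model with [v] at infinity, the plane of [h i] is vertical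
   when [kap i = 0]; otherwise it is the hemisphere over a disc, [power i] is the
   power of a point with respect to that disc (positive inside), and the ray over
   [w] leaves the half-space at the parameter [l] with [l * exit_rate i w = 1]. *)
Definition kap i := b i - be i.

Lemma kap_ge0 i : 0 <= kap i.
Proof. by rewrite subr_ge0; exact: (closure_le hrep _ cv). Qed.

Definition vert i := kap i == 0.

Let frame_dots : [/\ dot v v = 1, dot e1 e1 = 1 & dot e2 e2 = 1] /\
  [/\ dot e1 e2 = 0, dot e1 v = 0 & dot e2 v = 0].
Proof. exact: fr. Qed.

Lemma frame_complete (a : vec) : a = dot a e1 *: e1 + dot a e2 *: e2 + dot a v *: v.
Proof.
have [[vv e11 e22] [e12 e1v e2v]] := frame_dots.
apply/eqP; rewrite -subr_eq0; set r := a - _; apply/eqP.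
have r1 : dot r e1 = 0.
  by rewrite /r !dotL (dotC e2 e1) (dotC v e1) e11 e12 e1v; ring.
have r2 : dot r e2 = 0.
  by rewrite /r !dotL (dotC v e2) e22 e12 e2v; ring.
have rv : dot r v = 0 by rewrite /r !dotL vv e1v e2v; ring.
have nn : dot (cross e1 e2) (cross e1 e2) = 1.
  transitivity (dot e1 e1 * dot e2 e2 - dot e1 e2 ^+ 2); first by rewrite !dotE !ptE; ring.
  by rewrite e11 e22 e12; ring.
have Er := orth2_parallel r1 r2.
have Ev : v = dot v (cross e1 e2) *: cross e1 e2.
  by rewrite -[LHS]scale1r -nn; apply: orth2_parallel; rewrite dotC.
rewrite nn scale1r in Er.
have : dot r (cross e1 e2) = 0.
  have vn : dot v (cross e1 e2) != 0.
    apply/negP => /eqP vn; move: vv; rewrite Ev vn scale0r dotE !mxE => /eqP.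
    by rewrite !mulr0 !addr0 eq_sym oner_eq0.
  by move: rv; rewrite Ev dotZr => /eqP; rewrite mulf_eq0 (negbTE vn) => /eqP.
by move=> rn; rewrite Er rn scale0r.
Qed.

Lemma dot_frameE (a c : vec) : dot a c = dot a e1 * dot c e1 + dot a e2 * dot c e2 + dot a v * dot c v.
Proof. by rewrite {1}(frame_complete a) !dotL !(dotC _ c). Qed.

Lemma lorentz_frameE i j : lorentz (h i) (h j) = p i * p j + q i * q j + be i * be j - b i * b j.
Proof. by rewrite /lorentz dot_frameE. Qed.

Definition exit_rate i (w1 w2 : R) : R := (p i * w1 + q i * w2 - be i) / kap i.
Definition power i (w1 w2 : R) : R := 2 * exit_rate i w1 w2 - (1 + w1 ^+ 2 + w2 ^+ 2).

Lemma dot_cone i w1 w2 l :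
  dot (h i).1 (cone_pt v e1 e2 w1 w2 l) = be i + l * (p i * w1 + q i * w2 - be i).
Proof. by rewrite /cone_pt !dotL; ring. Qed.

Lemma H3_cone w1 w2 l : H3 (cone_pt v e1 e2 w1 w2 l) <->
  0 < l /\ l * (1 + w1 ^+ 2 + w2 ^+ 2) < 2.
Proof.
have q1 : 0 < 1 + w1 ^+ 2 + w2 ^+ 2 by rewrite -addrA ltr_pwDl // addr_ge0 // sqr_ge0.
have E := dot_cone_pt w1 w2 l fr.
rewrite /H3 /=; split.
  rewrite -subr_gt0 E => h1; have l0 : 0 < l.
    rewrite ltNge; apply/negP => l0.
    have : l * (2 - l * (1 + w1 ^+ 2 + w2 ^+ 2)) <= 0.
      rewrite mulr_le0_ge0 // subr_ge0; apply: le_trans (_ : 0 <= _) => //.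
      by rewrite mulr_le0_ge0 // ltW.
    lra.
  by split => //; move: h1; rewrite pmulr_rgt0 // subr_gt0.
by move=> [l0 l2]; rewrite -subr_gt0 E mulr_gt0 // subr_gt0.
Qed.

(** Vertical planes restrict only the foot [w] of the ray; the others only bound how far the ray may
    descend. *)
Lemma P_cone w1 w2 l : P (cone_pt v e1 e2 w1 w2 l) <->
  [/\ 0 < l, l * (1 + w1 ^+ 2 + w2 ^+ 2) < 2,
      forall i, vert i -> p i * w1 + q i * w2 <= b i
    & forall i, ~~ vert i -> l * exit_rate i w1 w2 <= 1].
Proof.
case: hrep => _ hPE; rewrite hPE H3_cone; split.
  move=> [[l0 l2] hi]; split => // i vi; have := hi i; rewrite dot_cone.
    have : kap i = 0 by apply/eqP.
    rewrite /kap => k0 hle; have : l * (p i * w1 + q i * w2 - be i) <= 0 by lra.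
    by rewrite pmulr_rle0 //; lra.
  have k0 : 0 < kap i by rewrite lt_neqAle eq_sym vi kap_ge0.
  by rewrite /exit_rate mulrA ler_pdivrMr // mul1r /kap; lra.
move=> [l0 l2 hv hn]; split=> // i; rewrite dot_cone.
have [vi|vi] := boolP (vert i).
  have : kap i = 0 by apply/eqP.
  have := hv i vi; rewrite /kap => hle k0.
  have : l * (p i * w1 + q i * w2 - be i) <= 0 by rewrite pmulr_rle0 //; lra.
  by lra.
have k0 : 0 < kap i by rewrite lt_neqAle eq_sym vi kap_ge0.
by have := hn i vi; rewrite /exit_rate mulrA ler_pdivrMr // mul1r /kap; lra.
Qed.

Lemma active_cone_vert i w1 w2 l : vert i -> p i * w1 + q i * w2 = b i ->
  active h i (cone_pt v e1 e2 w1 w2 l).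
Proof.
move=> /eqP; rewrite /kap => k0 e; rewrite /active dot_cone e (_ : b i - be i = 0) ?mulr0 //.
by rewrite addr0; lra.
Qed.

Lemma active_cone_nonvert i w1 w2 l : ~~ vert i -> l * exit_rate i w1 w2 = 1 ->
  active h i (cone_pt v e1 e2 w1 w2 l).
Proof.
move=> vi e; have k0 : kap i != 0 by exact: vi.
rewrite /active dot_cone (_ : p i * w1 + q i * w2 - be i = exit_rate i w1 w2 * kap i).
  by rewrite mulrA e mul1r /kap addrC subrK.
by rewrite /exit_rate mulfVK.
Qed.

Lemma cone_surj x : H3 x -> exists w1 w2 l, 0 < l /\ x = cone_pt v e1 e2 w1 w2 l.
Proof.
move=> Hx; have [[vv _ _] _] := frame_dots.
have xv : dot x v < 1.
  have := cauchy_schwarz x v; rewrite vv mulr1 => h1.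
  have : dot x v ^+ 2 < 1 by apply: le_lt_trans h1 Hx.
  by move=> h2; rewrite ltNge; apply/negP => x1; have := sqr_ge0 (dot x v - 1); lra.
have l0 : 0 < 1 - dot x v by lra.
exists (dot x e1 / (1 - dot x v)), (dot x e2 / (1 - dot x v)), (1 - dot x v); split => //.
rewrite {1}(frame_complete x) /cone_pt scalerBr scalerDr !scalerA.
rewrite ![(1 - _) * _]mulrC !mulfVK ?gt_eqF // scalerBl scale1r opprB.
by rewrite addrCA [v + _]addrC subrK.
Qed.

Lemma interior_cone : exists w1 w2, forall i, vert i -> p i * w1 + q i * w2 < b i.
Proof.
have [ o Po oi] := interior_pt hrep Pint.
have [|w1 [w2 [l [l0 oE]]]] := @cone_surj o; first by case: hrep => _ /(_ o) [/(_ Po)[]].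
exists w1, w2 => i /eqP k0; have := oi i; rewrite oE dot_cone => hlt.
have : l * (p i * w1 + q i * w2 - be i) < 0 by move: k0; rewrite /kap; lra.
by rewrite pmulr_rlt0 //; move: k0; rewrite /kap; lra.
Qed.

Lemma measurable_P : borel3 P.
Proof.
case: hrep => _ hPE; rewrite /borel3.
rewrite (_ : _ @^-1` P = ((fun z : TR * (TR * TR) => vec3 z) @^-1` (@H3 R)) `&`
  \bigcap_(i in [set: 'I_n]) [set z : TR * (TR * TR) | dot (h i).1 (vec3 z) <= b i]).
  apply: measurableI; first exact: measurable_H3.
  apply: fin_bigcap_measurable; first exact: finite_finset.
  move=> i _.
  have := @measurable_lin3 R ((h i).1 0 0) ((h i).1 0 1) ((h i).1 0 (1 + 1)) 0 measurableT
    `]-oo, b i]%classic (measurable_itv _).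
  rewrite setTI; congr measurable; apply/seteqP; split => -[x [y z]] /=;
  by rewrite in_itv/= -[vec3 _]/(pt x y z) dotE !ptE addr0.
apply/seteqP; split => z /=.
  by move=> /hPE[Hz hz]; split => // i _; exact: hz.
by move=> [Hz hz]; apply/hPE; split=> // i; exact: hz.
Qed.

Definition ray_volume (w1 w2 : R) : \bar R :=
  (\int[mu]_l (cone_density P v e1 e2 w1 w2 l)%:E)%E.

Lemma ray_volume_ge0 w1 w2 : (0 <= ray_volume w1 w2)%E.
Proof. by apply: integral_ge0 => l _; rewrite lee_fin cone_density_ge0. Qed.

Lemma measurable_ray_volume : measurable_fun setT (fun w : TR * TR => ray_volume w.1 w.2).
Proof.
have mc := measurable_cone_density v e1 e2 measurable_P.
apply: (measurable_inner (f := fun w l => (cone_density P v e1 e2 w.1 w.2 l)%:E)).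
  apply: (measurable3_comp mc).
  - exact: (measurableT_comp measurable_fst measurable_fst).
  - exact: (measurableT_comp measurable_snd measurable_fst).
  - exact: measurable_snd.
by move=> *; rewrite lee_fin cone_density_ge0.
Qed.

Lemma ray_volume_out w1 w2 i : vert i -> b i < p i * w1 + q i * w2 -> ray_volume w1 w2 = 0%E.
Proof.
move=> vi lt; apply: integral0_eq => l _; rewrite /cone_density indicE memNset ?mul0r //.
by move=> [/P_cone[_ _ /(_ i vi) hle _] _]; lra.
Qed.

(** The ray is stopped at the latest by the hemisphere of [i], at L = 1 / m for the exit rate m;
    there L / (2 (2 - L Q)) equals 1 / (2 (2 m - Q)). *)
Lemma ray_volume_le w1 w2 i : ~~ vert i -> 0 < power i w1 w2 ->
  (ray_volume w1 w2 <= ((2 * power i w1 w2)^-1)%:E)%E.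
Proof.
move=> vi; rewrite /power; set m := exit_rate i w1 w2; set Q := 1 + w1 ^+ 2 + w2 ^+ 2 => pw.
have Q0 : 0 < Q by rewrite /Q -addrA ltr_pwDl // addr_ge0 // sqr_ge0.
have m0 : 0 < m by lra.
have mi : 0 < m^-1 by rewrite invr_gt0.
have mQ : m^-1 * Q < 2 by rewrite mulrC ltr_pdivrMr //; lra.
have -> : (2 * (2 * m - Q))^-1 = m^-1 / (2 * (2 - m^-1 * Q)).
  have n1 : 2 - m^-1 * Q != 0 by rewrite gt_eqF // subr_gt0.
  have n2 : 2 * m - Q != 0 by rewrite gt_eqF.
  have -> : 2 - m^-1 * Q = (2 * m - Q) / m by field; rewrite gt_eqF.
  by field; rewrite n2 gt_eqF.
rewrite -(integral_ray (ltW mi) mQ); apply: ge0_le_integral => //.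
- by move=> l _; rewrite lee_fin cone_density_ge0.
- exact: (measurable3_comp (measurable_cone_density v e1 e2 measurable_P)).
- apply/measurable_EFinP; apply: measurable_funM; first exact: measurable_indic.
  apply: (measurableT_comp (@measurable_expNn2 R)).
  by apply: measurable_funB => //; exact: measurable_funM.
move=> l _; rewrite lee_fin /cone_density -/Q ler_wpM2r ?invr_ge0 ?exprn_even_ge0 //.
rewrite !indicE; case: (boolP (_ \in _ `&` _)) => //; rewrite in_setE => -[/P_cone[l0 _ _ hn] _].
rewrite mem_set // /= in_itv /= l0 -[m^-1]mul1r ler_pdivlMr //.
exact: hn.
Qed.

Hypothesis fin : (hvolume P < +oo)%E.
Hypothesis volE : hvolume P = (\int[mu]_w1 \int[mu]_w2 ray_volume w1 w2)%E.

(** A ray over a point outside all discs stays in [P] down to the absolute, at l = 2 / Q, where its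
    volume diverges. The value of [ep] is chosen so that the part up to (2 - ep) / Q already
    contributes at least [K]. *)
Let ray_volume_ge w1 w2 (K : R) : 0 < K ->
  (forall i, vert i -> p i * w1 + q i * w2 < b i) ->
  (forall i, ~~ vert i -> power i w1 w2 < 0) ->
  (K%:E <= ray_volume w1 w2)%E.
Proof.
move=> K0 hv hn; set Q := 1 + w1 ^+ 2 + w2 ^+ 2.
have Q0 : 0 < Q by rewrite /Q -addrA ltr_pwDl // addr_ge0 // sqr_ge0.
pose ep := (1 + 2 * (Q * K))^-1.
have QK : 0 < Q * K by rewrite mulr_gt0.
have ep0 : 0 < ep by rewrite invr_gt0; lra.
have ep1 : ep <= 1 by rewrite invf_le1; lra.
pose L := (2 - ep) / Q.
have L0 : 0 < L by rewrite divr_gt0 //; lra.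
have LQ : L * Q = 2 - ep by rewrite /L mulfVK // gt_eqF.
have LQ2 : L * Q < 2 by lra.
apply: (@le_trans _ _ (L / (2 * (2 - L * Q)))%:E).
  rewrite lee_fin LQ opprB addrC subrK ler_pdivlMr; last by rewrite mulr_gt0.
  rewrite /L ler_pdivlMr //.
  have e1' : ep * (1 + 2 * (Q * K)) = 1 by rewrite mulVf // gt_eqF //; lra.
  have : K * (2 * ep) * Q = 1 - ep by rewrite -{2}e1'; ring.
  lra.
rewrite -(integral_ray (ltW L0) LQ2); apply: ge0_le_integral => //.
- by move=> l _; rewrite lee_fin mulr_ge0 // invr_ge0 exprn_even_ge0.
- apply/measurable_EFinP; apply: measurable_funM; first exact: measurable_indic.
  apply: (measurableT_comp (@measurable_expNn2 R)).
  by apply: measurable_funB => //; exact: measurable_funM.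
- exact: (measurable3_comp (measurable_cone_density v e1 e2 measurable_P)).
move=> l _; rewrite lee_fin /cone_density -/Q ler_wpM2r ?invr_ge0 ?exprn_even_ge0 //.
rewrite !indicE; case: (boolP (_ \in `]0, L]%classic)) => //.
rewrite in_setE /= in_itv /= => /andP[l0 lL]; rewrite mem_set //.
have lQ : l * Q < 2 by apply: le_lt_trans LQ2; rewrite ler_wpM2r // ltW.
split; last by apply/H3_cone.
apply/P_cone; split=> // i vi; first by rewrite ltW // hv.
have := hn i vi; rewrite /power -/Q => pn.
have : l * exit_rate i w1 w2 <= l * (Q / 2) by rewrite ler_wpM2l ?ltW //; lra.
lra.
Qed.

(* Otherwise the rays over a square around [w] reach the absolute inside [P], and
   each of them has infinite volume. *)
Lemma covered w1 w2 : (forall i, vert i -> p i * w1 + q i * w2 < b i) ->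
  exists2 i, ~~ vert i & 0 <= power i w1 w2.
Proof.
move=> hv; apply: contrapT => no.
have hn i : ~~ vert i -> power i w1 w2 < 0.
  by move=> vi; rewrite ltNge; apply/negP => hp; apply: no; exists i.
have [d d0 hd] : exists2 d, 0 < d & forall x y, `|x - w1| <= d -> `|y - w2| <= d ->
   (forall i, vert i -> p i * x + q i * y < b i) /\ (forall i, ~~ vert i -> power i x y < 0).
  have [i|d d0 hd] := @eventually_forall R 'I_n (fun i t => forall x y, `|x - w1| <= t -> `|y - w2| <= t ->
      if vert i then p i * x + q i * y < b i else power i x y < 0).
    have [vi|vi] := boolP (vert i).
      have [|d d0 hd] := @eventually_linear R (b i - (p i * w1 + q i * w2)) (- (`|p i| + `|q i|)).
        by rewrite subr_gt0 hv.
      exists d => // t td x y hx hy; have := hd t td.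
      have : p i * (x - w1) <= `|p i| * t.
        by apply: le_trans (ler_norm _) _; rewrite normrM ler_wpM2l.
      have : q i * (y - w2) <= `|q i| * t.
        by apply: le_trans (ler_norm _) _; rewrite normrM ler_wpM2l.
      lra.
    pose c1 := `|2 * p i / kap i - 2 * w1|; pose c2 := `|2 * q i / kap i - 2 * w2|.
    have [|d d0 hd] := @eventually_linear R (- power i w1 w2) (- (c1 + c2)).
      by rewrite oppr_gt0 hn.
    exists d => // t td x y hx hy; have := hd t td.
    have E : power i x y = power i w1 w2 + (2 * p i / kap i - 2 * w1) * (x - w1) +
       (2 * q i / kap i - 2 * w2) * (y - w2) - (x - w1) ^+ 2 - (y - w2) ^+ 2.
      by rewrite /power /exit_rate; ring.
    have := sqr_ge0 (x - w1); have := sqr_ge0 (y - w2).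
    have : (2 * p i / kap i - 2 * w1) * (x - w1) <= c1 * t.
      by apply: le_trans (ler_norm _) _; rewrite normrM ler_wpM2l.
    have : (2 * q i / kap i - 2 * w2) * (y - w2) <= c2 * t.
      by apply: le_trans (ler_norm _) _; rewrite normrM ler_wpM2l.
    rewrite E; lra.
  exists d => // x y hx hy; split => i vi.
    by have := hd d; rewrite lexx ltW // => /(_ isT i x y hx hy); rewrite vi.
  by have := hd d; rewrite lexx ltW // => /(_ isT i x y hx hy); rewrite (negbTE vi).
have box K : 0 < K -> ((K * (2 * d) * (2 * d))%:E <= hvolume P)%E.
  move=> K0; rewrite volE.
  pose A x : set R := `[(x - d)%R, (x + d)%R]%classic.
  have mA x : mu (A x) = (2 * d)%:E.
    rewrite /A lebesgue_measure_itv /= lte_fin ifT; last lra.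
    by rewrite -EFinB; congr EFin; ring.
  have inA x y : (\1_(A y) x : R) != 0 -> `|x - y| <= d.
    rewrite indicE; case: (boolP (_ \in _)) => [|_]; last by rewrite eqxx.
    by rewrite in_setE /A /= in_itv /= ler_distl => /andP[h1 h2] _; apply/andP; split; lra.
  have iA x : (\int[mu]_y (\1_(A x) y : R)%:E = (2 * d)%:E)%E.
    by rewrite -[RHS](mA x) -[in RHS](setIT (A x)); apply: integral_indic => //; exact: measurable_itv.
  have mA1 x : measurable_fun setT (\1_(A x) : TR -> R).
    by apply: measurable_indic; exact: measurable_itv.
  have mI x : measurable_fun setT (fun y : TR => (\1_(A x) y : R)%:E).
    exact: (iffRL (measurable_EFinP _ _) (mA1 x)).
  have I0 x y : (0 <= (\1_(A x) y : R)%:E)%E by rewrite lee_fin indicE ler0n.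
  have E : (\int[mu]_x \int[mu]_y (K * \1_(A w1) x * \1_(A w2) y)%:E =
      (K * (2 * d) * (2 * d))%:E)%E.
    transitivity (\int[mu]_x ((K * (2 * d))%:E * (\1_(A w1) x : R)%:E))%E.
      apply: eq_integral => x _; transitivity ((K * \1_(A w1) x)%:E * \int[mu]_y (\1_(A w2) y : R)%:E)%E.
        by rewrite (ge0_integral_scale _ (mI w2) (I0 w2)) // mulr_ge0 // ltW.
      by rewrite iA -!EFinM; congr EFin; ring.
    rewrite -(ge0_integral_scale _ (mI w1) (I0 w1)); last by rewrite mulr_ge0 ?mulr_ge0 // ltW.
    by rewrite iA -EFinM.
  rewrite -E; apply: (@le_integral2_off_conics _ [::] (fun x y => (K * \1_(A w1) x * \1_(A w2) y)%:E)).
  - by [].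
  - apply/measurable_EFinP; apply: measurable_funM; last exact: (measurableT_comp (mA1 w2) measurable_snd).
    by apply: measurable_funM => //; exact: (measurableT_comp (mA1 w1) measurable_fst).
  - by move=> x y; rewrite lee_fin !mulr_ge0 // ltW.
  - exact: measurable_ray_volume.
  - by move=> x y; exact: ray_volume_ge0.
  move=> x y _; have [i1|i1] := eqVneq (\1_(A w1) x : R) 0.
    by rewrite i1 mulr0 mul0r ray_volume_ge0.
  have [i2|i2] := eqVneq (\1_(A w2) y : R) 0; first by rewrite i2 mulr0 ray_volume_ge0.
  have [h1 h2] := hd x y (inA _ _ i1) (inA _ _ i2).
  apply: le_trans (ray_volume_ge K0 h1 h2).
  by rewrite lee_fin !indicE; case: (_ \in _); case: (_ \in _); rewrite ?mulr0 ?mul0r ?mulr1 ?(ltW K0).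
have V0 : (0 <= hvolume P)%E.
  rewrite volE; apply: integral_ge0 => a _; apply: integral_ge0 => c _.
  exact: ray_volume_ge0.
have Vf : hvolume P \is a fin_num by rewrite ge0_fin_numE.
have Vr : 0 <= fine (hvolume P) by rewrite fine_ge0.
pose K := (fine (hvolume P) + 1) / (2 * d) / (2 * d).
have K0 : 0 < K by rewrite !divr_gt0 ?mulr_gt0 //; lra.
have := box K K0; rewrite -(fineK Vf) lee_fin /K.
rewrite mulfVK ?mulfVK ?gt_eqF ?mulr_gt0 //; lra.
Qed.

End Cone.

(** * The planar picture: discs of non-vertical faces inside walls of vertical ones *)

Section Planar.
Context {R : realType}.
Local Notation vec := 'rV[R]_3.
Local Notation mu := (@lebesgue_measure R).
Local Notation TR := (measurableTypeR R).
Variables (P : set vec) (n : nat) (h : 'I_n -> vec * R) (v e1 e2 : vec).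
Hypotheses (hrep : is_hrep P h) (irr : irredundant h) (Pint : interior P !=set0).
Hypotheses (ideal : vertex P `<=` absolute (R:=R)) (ra : right_angled P).
Hypotheses (fr : frame v e1 e2) (cv : closure P v).
Hypothesis fin : (hvolume P < +oo)%E.
Hypothesis volE : hvolume P = (\int[mu]_w1 \int[mu]_w2 ray_volume P v e1 e2 w1 w2)%E.

Local Notation p i := (dot (h i).1 e1).
Local Notation q i := (dot (h i).1 e2).
Local Notation be i := (dot (h i).1 v).
Local Notation b i := ((h i).2).
Local Notation kp := (kap h v).
Local Notation vt := (vert h v).
Local Notation Mx := (exit_rate h v e1 e2).
Local Notation pwr := (power h v e1 e2).
Local Notation adjh := (adj P h).

(** The shadow of [P] on the boundary plane, a copy of the link of the ideal vertex [v]. *)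
Definition base_domain : set (R * R) :=
  [set w | forall i, vt i -> p i * w.1 + q i * w.2 <= b i].

(** The point ([cx], [cy]) is the centre and [rho2] the squared radius of the disc, as [powerE]
    shows. *)
Definition cx i := p i / kp i.
Definition cy i := q i / kp i.
Definition rho2 i := lorentz (h i) (h i) / kp i ^+ 2.
Definition rho i := Num.sqrt (rho2 i).

Let kap_gt0 i : ~~ vt i -> 0 < kp i.
Proof. by move=> vi; rewrite lt_neqAle eq_sym vi (kap_ge0 hrep cv). Qed.

Lemma rho2_gt0 i : ~~ vt i -> 0 < rho2 i.
Proof. by move=> /kap_gt0 k0; rewrite divr_gt0 ?exprn_gt0 //; case: hrep => + _; apply. Qed.

Lemma rho_gt0 i : ~~ vt i -> 0 < rho i.
Proof. by move=> vi; rewrite sqrtr_gt0 rho2_gt0. Qed.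

Lemma rho_sqr i : ~~ vt i -> rho i ^+ 2 = rho2 i.
Proof. by move=> vi; rewrite sqr_sqrtr // ltW // rho2_gt0. Qed.

Let bE i : b i = be i + kp i.
Proof. by rewrite /kap addrC subrK. Qed.

Lemma exit_rateE i w1 w2 : Mx i w1 w2 = cx i * w1 + cy i * w2 - be i / kp i.
Proof. by rewrite /exit_rate /cx /cy; ring. Qed.

Lemma rho2E i : ~~ vt i -> rho2 i = cx i ^+ 2 + cy i ^+ 2 - 2 * (be i / kp i) - 1.
Proof.
move=> /kap_gt0 k0; rewrite /rho2 (lorentz_frameE h fr) bE /cx /cy; field.
by rewrite gt_eqF.
Qed.

Lemma powerE i w1 w2 : ~~ vt i -> pwr i w1 w2 = rho2 i - (w1 - cx i) ^+ 2 - (w2 - cy i) ^+ 2.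
Proof. by move=> vi; rewrite /power exit_rateE rho2E //; ring. Qed.

(** Lorentz orthogonality seen in the boundary plane: two circles meet at right angles, which is
    Pythagoras for the centres. In the next two lemmas a wall passes through the centre of a disc,
    and two walls are perpendicular. *)
Lemma adj_nonvert f g : ~~ vt f -> ~~ vt g -> adjh f g ->
  (cx g - cx f) ^+ 2 + (cy g - cy f) ^+ 2 = rho2 f + rho2 g.
Proof.
move=> vf vg /(adj_lorentz hrep irr Pint ideal ra); rewrite (lorentz_frameE h fr) !bE => l0.
rewrite !rho2E //; have kf := kap_gt0 vf; have kg := kap_gt0 vg.
have : cx f * cx g + cy f * cy g - be f / kp f - be g / kp g - 1 = 0.
  transitivity ((p f * p g + q f * q g + be f * be g - (be f + kp f) * (be g + kp g)) /
    (kp f * kp g)); last by rewrite l0 mul0r.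
  by rewrite /cx /cy; field; rewrite !gt_eqF.
lra.
Qed.

Lemma adj_vert f g : ~~ vt f -> vt g -> adjh f g -> p g * cx f + q g * cy f = b g.
Proof.
move=> vf /eqP vg /(adj_lorentz hrep irr Pint ideal ra); rewrite (lorentz_frameE h fr) !bE vg addr0 => l0.
have kf := kap_gt0 vf; apply: (mulIf (lt0r_neq0 kf)).
by rewrite /cx /cy mulrDl ![_ * (_ / _)]mulrA !mulfVK ?gt_eqF //; lra.
Qed.

Lemma vert_adj f g : vt f -> vt g -> adjh f g -> p f * p g + q f * q g = 0.
Proof.
move=> /eqP vf /eqP vg /(adj_lorentz hrep irr Pint ideal ra); rewrite (lorentz_frameE h fr) !bE vg vf !addr0.
lra.
Qed.

Lemma vert_normal f : vt f -> 0 < p f ^+ 2 + q f ^+ 2.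
Proof.
case: hrep => /(_ f) + _ => /[swap] /eqP vf.
rewrite /spacelike (lorentz_frameE h fr) !bE vf !addr0; lra.
Qed.

(** Powers are continuous: were a point outside all closed discs, so would be nearby points on the
    way to an interior point of the domain, against [covered]. *)
Lemma covered_closed w1 w2 : base_domain (w1, w2) -> exists2 i, ~~ vt i & 0 <= pwr i w1 w2.
Proof.
move=> Qw; apply: contrapT => no.
have hn i : ~~ vt i -> pwr i w1 w2 < 0.
  by move=> vi; rewrite ltNge; apply/negP => hp; apply: no; exists i.
have [ u1 [u2 ho]] := interior_cone hrep Pint fr.
have [i|d d0 hd] := @eventually_forall R 'I_n (fun i t => ~~ vt i ->
    pwr i (w1 + t * (u1 - w1)) (w2 + t * (u2 - w2)) < 0).
  have [vi|vi] := boolP (vt i); first by exists 1.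
  have [|d d0 hd] := @eventually_quadratic R (- pwr i w1 w2)
    (- (2 * (cx i * (u1 - w1) + cy i * (u2 - w2)) - 2 * w1 * (u1 - w1) - 2 * w2 * (u2 - w2)))
    ((u1 - w1) ^+ 2 + (u2 - w2) ^+ 2).
    by rewrite oppr_gt0 hn.
  by exists d => // t /hd h1 _; rewrite -oppr_gt0; move: h1; rewrite /power !exit_rateE; lra.
pose t := Num.min d 1; have t0 : 0 < t by rewrite lt_min d0 ltr01.
have t1 : t <= 1 by rewrite ge_min lexx orbT.
have [i vi] : exists2 i, ~~ vt i & 0 <= pwr i (w1 + t * (u1 - w1)) (w2 + t * (u2 - w2)).
  apply: (covered hrep fr cv fin volE) => i vi.
  have := Qw i vi; have := ho i vi => /= h1 h2.
  have : 0 < t * (b i - (p i * u1 + q i * u2)) by rewrite mulr_gt0 ?subr_gt0.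
  have : 0 <= (1 - t) * (b i - (p i * w1 + q i * w2)) by rewrite mulr_ge0 ?subr_ge0.
  lra.
by rewrite leNgt hd // ltW //= ge_min lexx.
Qed.

Lemma adj_of_disc f g w1 w2 l : f != g -> 0 < l -> l * (1 + w1 ^+ 2 + w2 ^+ 2) < 2 ->
  base_domain (w1, w2) -> (forall k, ~~ vt k -> l * Mx k w1 w2 <= 1) ->
  active h f (cone_pt v e1 e2 w1 w2 l) -> active h g (cone_pt v e1 e2 w1 w2 l) -> adjh f g.
Proof. by move=> fg l0 lq Qw lM; apply: (adjP fg); apply/(P_cone hrep fr cv). Qed.

Lemma adj_max_nonvert f g w1 w2 : f != g -> ~~ vt f -> ~~ vt g -> base_domain (w1, w2) ->
  0 < pwr f w1 w2 -> (forall k, ~~ vt k -> Mx k w1 w2 <= Mx f w1 w2) ->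
  Mx g w1 w2 = Mx f w1 w2 -> adjh f g.
Proof.
move=> fg vf vg Qw; rewrite /power => pw Mmax Mg.
have M0 : 0 < Mx f w1 w2 by have := sqr_ge0 w1; have := sqr_ge0 w2; lra.
apply: (@adj_of_disc _ _ w1 w2 (Mx f w1 w2)^-1) => //; rewrite ?invr_gt0 //.
- by rewrite mulrC ltr_pdivrMr //; lra.
- by move=> k vk; rewrite mulrC ler_pdivrMr // mul1r Mmax.
- by apply: active_cone_nonvert => //; rewrite mulVf // gt_eqF.
- by apply: active_cone_nonvert => //; rewrite Mg mulVf // gt_eqF.
Qed.

Lemma adj_max_vert f g w1 w2 : ~~ vt f -> vt g -> base_domain (w1, w2) ->
  0 < pwr f w1 w2 -> (forall k, ~~ vt k -> Mx k w1 w2 <= Mx f w1 w2) ->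
  p g * w1 + q g * w2 = b g -> adjh f g.
Proof.
move=> vf vg Qw; rewrite /power => pw Mmax Mg.
have M0 : 0 < Mx f w1 w2 by have := sqr_ge0 w1; have := sqr_ge0 w2; lra.
apply: (@adj_of_disc _ _ w1 w2 (Mx f w1 w2)^-1) => //; rewrite ?invr_gt0 //.
- by apply: contraNneq vf => ->.
- by rewrite mulrC ltr_pdivrMr //; lra.
- by move=> k vk; rewrite mulrC ler_pdivrMr // mul1r Mmax.
- by apply: active_cone_nonvert => //; rewrite mulVf // gt_eqF.
- exact: active_cone_vert.
Qed.

(** Sufficiently close to [v], that is for small [l], only the walls matter, so the ray over the
    corner begins inside [P]. *)
Lemma adj_corner f g w1 w2 : f != g -> vt f -> vt g -> base_domain (w1, w2) ->
  p f * w1 + q f * w2 = b f -> p g * w1 + q g * w2 = b g -> adjh f g.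
Proof.
move=> fg vf vg Qw wf wg.
have [k|d d0 hd] := @eventually_forall R 'I_n (fun k l => l * Mx k w1 w2 <= 1).
  have [|d d0 hd] := @eventually_linear R 1 (- Mx k w1 w2); first exact: ltr01.
  by exists d => // t /hd; lra.
have [|d' d'0 hd'] := @eventually_linear R 2 (- (1 + w1 ^+ 2 + w2 ^+ 2)); first exact: ltr0n.
pose l := Num.min d d'; have l0 : 0 < l by rewrite lt_min d0 d'0.
apply: (@adj_of_disc _ _ w1 w2 l) => //.
- have := hd' l; rewrite (ltW l0) ge_min lexx orbT => /(_ isT); lra.
- by move=> k _; apply: hd; rewrite (ltW l0) ge_min lexx.
- exact: active_cone_vert.
- exact: active_cone_vert.
Qed.

(** Each power tends to minus infinity like - T^2 |y|^2. Multiplying by t^2 with t = 1 / T turns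
    this into a statement about small [t]. *)
Lemma far_out w1 w2 y1 y2 : 0 < y1 ^+ 2 + y2 ^+ 2 ->
  exists2 T, 1 <= T & forall i, ~~ vt i -> pwr i (w1 + T * y1) (w2 + T * y2) < 0.
Proof.
move=> y0.
have [i|d d0 hd] := @eventually_forall R 'I_n (fun i t => ~~ vt i ->
    t ^+ 2 * pwr i w1 w2 + t * (2 * (cx i * y1 + cy i * y2) - 2 * w1 * y1 - 2 * w2 * y2) -
    (y1 ^+ 2 + y2 ^+ 2) < 0).
  have [d d0 hd] := @eventually_quadratic R (y1 ^+ 2 + y2 ^+ 2)
    (- (2 * (cx i * y1 + cy i * y2) - 2 * w1 * y1 - 2 * w2 * y2)) (- pwr i w1 w2) y0.
  by exists d => // t /hd; lra.
pose t := Num.min d 1; have t0 : 0 < t by rewrite lt_min d0 ltr01.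
have tn0 : t != 0 by rewrite gt_eqF.
have t1 : t <= 1 by rewrite ge_min lexx orbT.
exists t^-1; first by rewrite -[t^-1]mul1r ler_pdivlMr ?mul1r ?t1.
move=> i vi; have := hd t _ i vi; rewrite (ltW t0) ge_min lexx => /(_ isT) h1.
have T0 : 0 < t ^- 2 by rewrite invr_gt0 exprn_gt0.
rewrite -(pmulr_rlt0 _ (exprn_gt0 2 t0)); apply: le_lt_trans h1; rewrite le_eqVlt; apply/orP; left.
by apply/eqP; rewrite /power !exit_rateE; move: (be i / kp i) => s; field.
Qed.

(** Walk along the wall [g] in the direction of its normal turned by a right angle. Far away no disc
    covers, so another wall must stop the walk; it meets [g] in a corner, is perpendicular to it,
    and faces the walk. *)
Lemma vert_next g : vt g -> exists j c, [/\ vt j, adjh g j, 0 < c, p j = c * - q g & q j = c * p g].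
Proof.
move=> vg; have n0 := vert_normal vg.
have [z [Pz gz zj]] := facet_pt hrep irr Pint g.
have [w1 [w2 [l [l0 zE]]]] := cone_surj fr (let: conj a _ := iffLR (hrep.2 z) Pz in a).
have Qw : base_domain (w1, w2).
  by move: Pz; rewrite zE => /(P_cone hrep fr cv)[].
have gw : p g * w1 + q g * w2 = b g.
  move: gz; rewrite /active zE (dot_cone h) bE (eqP vg) addr0 => h1.
  have /eqP : l * (p g * w1 + q g * w2 - be g) = 0 by lra.
  by rewrite mulf_eq0 gt_eqF // subr_eq0 => /eqP.
have n0' : 0 < (- q g) ^+ 2 + p g ^+ 2 by rewrite sqrrN addrC.
have [T T1 hT] := far_out w1 w2 n0'.
pose A i := if vt i then b i - (p i * w1 + q i * w2) else 0.
pose B i := if vt i then - (T * (p i * - q g + q i * p g)) else 0.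
have [i|/=|t [k [/andP[t0 t1] tA tk kn]]] := @first_exit R _ A B.
- by rewrite /A; case: ifP => // vi; rewrite subr_ge0; exact: Qw.
- apply: contrapT => no; have [|i vi] := @covered_closed (w1 + T * - q g) (w2 + T * p g).
    move=> i vi /=; rewrite leNgt; apply/negP => lt; apply: no; exists i.
    by rewrite /A /B vi; lra.
  by rewrite leNgt hT.
move: tk kn; rewrite /A /B; have [vk|_] := boolP (vt k); last by rewrite addr0 ltxx.
move=> tk kn.
have kg : g != k by apply/eqP => gk; move: kn; rewrite -gk gw; lra.
have gk : adjh g k.
  apply: (@adj_corner _ _ (w1 + t * (T * - q g)) (w2 + t * (T * p g))) => //; try lra.
  by move=> i vi /=; have := tA i; rewrite /A /B vi; lra.
have o := vert_adj vg vk gk.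
exists k, ((p k * - q g + q k * p g) / (p g ^+ 2 + q g ^+ 2)); split => //.
- have T0 : 0 < T by lra.
  rewrite divr_gt0 // -(pmulr_rgt0 _ T0); have := Qw k vk => /=; lra.
- apply: (mulIf (lt0r_neq0 n0)); rewrite mulrAC mulfVK ?gt_eqF //.
  have : (p g * p k + q g * q k) * p g = 0 by rewrite o mul0r.
  lra.
- apply: (mulIf (lt0r_neq0 n0)); rewrite mulrAC mulfVK ?gt_eqF //.
  have : (p g * p k + q g * q k) * q g = 0 by rewrite o mul0r.
  lra.
Qed.

(** Finitely many discs cannot cover the plane, so there is a wall. Three applications of
    [vert_next] turn its normal by one, two and three right angles, and the four directions are
    distinct. *)
Lemma four_vert : (4 <= #|vt|)%N.
Proof.
have [f vf] : exists f, vt f.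
  apply: contrapT => no.
  have nv i : ~~ vt i by apply/negP => vi; apply: no; exists i.
  have [|T _ hT] := @far_out 0 0 1 0; first by rewrite expr1n expr0n addr0.
  have [|i vi] := @covered_closed (0 + T * 1) (0 + T * 0).
    by move=> i vi; have := nv i; rewrite vi.
  by rewrite leNgt hT.
have [g1 [c1 [v1 _ c10 p1 q1]]] := vert_next vf.
have [g2 [c2 [v2 _ c20 p2 q2]]] := vert_next v1.
have [g3 [c3 [v3 _ c30 p3 q3]]] := vert_next v2.
have n0 := vert_normal vf; set x0 := p f in p1 q1 n0 *; set y0 := q f in p1 q1 n0 *.
have c120 : 0 < c1 * c2 by rewrite mulr_gt0.
have c1230 : 0 < c1 * c2 * c3 by rewrite mulr_gt0.
rewrite p1 q1 in p2 q2; rewrite p2 q2 in p3 q3.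
have ne i j (c d : R) : 0 < c -> (p j = - c * p i /\ q j = - c * q i \/
    p j = c * - q i /\ q j = c * p i) -> 0 < p i ^+ 2 + q i ^+ 2 -> i != j.
  move=> c0 H hn; apply/eqP => ij; case: H; rewrite -ij => -[E1 E2].
    have : (1 + c) * (p i ^+ 2 + q i ^+ 2) = 0.
      transitivity (p i * (p i - - c * p i) + q i * (q i - - c * q i)); first by ring.
      by rewrite -E1 -E2 !subrr !mulr0 addr0.
    by move/eqP; rewrite mulf_eq0 (gt_eqF hn) orbF => /eqP; lra.
  have : p i ^+ 2 + q i ^+ 2 = 0.
    transitivity (p i * p i + q i * q i); first by ring.
    by rewrite {2}E1 {3}E2; ring.
  lra.
have u : uniq [:: f; g1; g2; g3].
  have f1 : f != g1 by apply: (ne _ _ c1) => //; right.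
  have f2 : f != g2.
    by apply: (ne _ _ (c1 * c2)) => //; left; rewrite p2 q2 -/x0 -/y0; split; ring.
  have f3 : f != g3.
    rewrite eq_sym; apply: (ne _ _ (c1 * c2 * c3)^-1); rewrite ?invr_gt0 //; last exact: vert_normal.
    by right; rewrite p3 q3 -/x0 -/y0; split; field; rewrite !lt0r_neq0.
  have f12 : g1 != g2.
    by apply: (ne _ _ c2) => //; [right; rewrite p1 q1 p2 q2; split; ring|exact: vert_normal].
  have f13 : g1 != g3.
    by apply: (ne _ _ (c2 * c3)); rewrite ?mulr_gt0 //; [left; rewrite p1 q1 p3 q3; split; ring|exact: vert_normal].
  have f23 : g2 != g3.
    by apply: (ne _ _ c3) => //; [right; rewrite p2 q2 p3 q3; split; ring|exact: vert_normal].
  by rewrite /= !inE !negb_or f1 f2 f3 f12 f13 f23.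
rewrite -[4%N]/(size [:: f; g1; g2; g3]) -(card_uniqP u); apply: subset_leq_card; apply/fintype.subsetP => x.
by rewrite !inE => /or4P[] /eqP ->.
Qed.

(** Two neighbours on the same side have parallel normals of the same sense, so one of their
    inequalities would imply the other. But each has a facet point at which the other is strict. *)
Lemma vert_side_inj g j k : vt g -> vt j -> vt k -> adjh g j -> adjh g k ->
  (0 < p j * - q g + q j * p g) = (0 < p k * - q g + q k * p g) -> j = k.
Proof.
move=> vg vj vk gj gk s; apply/eqP; apply: contraT => jk.
have n0 := vert_normal vg; have := vert_adj vg vj gj; have := vert_adj vg vk gk => ok oj.
pose c i := (p i * - q g + q i * p g) / (p g ^+ 2 + q g ^+ 2).
have cE i : p g * p i + q g * q i = 0 -> p i = c i * - q g /\ q i = c i * p g.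
  move=> o; split; apply: (mulIf (lt0r_neq0 n0)); rewrite mulrAC mulfVK ?gt_eqF //.
    have : (p g * p i + q g * q i) * p g = 0 by rewrite o mul0r.
    lra.
  have : (p g * p i + q g * q i) * q g = 0 by rewrite o mul0r.
  lra.
have [pj qj] := cE j oj; have [pk qk] := cE k ok.
have c0 i : vt i -> p i = c i * - q g -> q i = c i * p g -> c i != 0.
  move=> vi pi qi; apply/negP => /eqP ci; have := vert_normal vi.
  by rewrite pi qi ci !mul0r expr0n addr0 ltxx.
have sc : 0 < c j * c k.
  have e : (0 < c j) = (0 < c k) by rewrite /c !pmulr_lgt0 ?invr_gt0.
  have [j0|j0] := ltP 0 (c j); first by rewrite mulr_gt0 // -e.
  have k0 : c k <= 0 by rewrite leNgt -e -leNgt.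
  have cj := c0 j vj pj qj; have ck := c0 k vk pk qk.
  by rewrite nmulr_rgt0 lt_neqAle ?cj ?ck.
have bound i l : i != l -> vt i -> vt l -> p i = c i * - q g -> q i = c i * p g ->
    p l = c l * - q g -> q l = c l * p g -> exists2 x, c i * x = b i & c l * x < b l.
  move=> il vi vl pi qi pl ql; have [z [Pz iz zl]] := facet_pt hrep irr Pint i.
  have [w1 [w2 [t [t0 zE]]]] := cone_surj fr (let: conj a _ := iffLR (hrep.2 z) Pz in a).
  exists (- q g * w1 + p g * w2).
    move: iz; rewrite /active zE (dot_cone h) bE (eqP vi) addr0 => h1.
    have /eqP : t * (p i * w1 + q i * w2 - be i) = 0 by lra.
    rewrite mulf_eq0 gt_eqF //= subr_eq0 => /eqP; rewrite pi qi; lra.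
  have := zl l; rewrite eq_sym il => /(_ isT); rewrite zE (dot_cone h) bE (eqP vl) addr0 => h1.
  have : t * (p l * w1 + q l * w2 - be l) < 0 by lra.
  rewrite pmulr_rlt0 // pl ql; lra.
have [x xj xk] := bound j k jk vj vk pj qj pk qk.
have kj : k != j by rewrite eq_sym.
have [y yk yj] := bound k j kj vk vj pk qk pj qj.
have h1 : c k * (x - y) < 0 by rewrite mulrBr yk; lra.
have h2 : 0 < c j * (x - y) by rewrite mulrBr xj; lra.
have : c j * c k * (x - y) ^+ 2 < 0.
  by rewrite (_ : _ * _ = (c j * (x - y)) * (c k * (x - y))); [rewrite pmulr_rlt0|ring].
by rewrite pmulr_rlt0 // ltNge sqr_ge0.
Qed.

Lemma vert_neighbours g : vt g -> (#|[pred j | vt j && adjh g j]| <= 2)%N.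
Proof.
move=> vg; rewrite -card_bool -(card_in_imset (f := fun j => 0 < p j * - q g + q j * p g) (D := [pred j | vt j && adjh g j])).
  exact: max_card.
by move=> j k; rewrite !inE => /andP[vj gj] /andP[vk gk]; exact: vert_side_inj.
Qed.

Definition flag_bound (w1 w2 : R) (f g : 'I_n) (sg : bool) : R :=
  flag_density (cx f) (cy f) (cx g - cx f) (cy g - cy f) (rho f) (rho g) ((-1) ^+ sg) w1 w2.

(* For [r > 0] this is the pair of lines joining [(x, y)] to the intersections
   of the circle of squared radius [r] around it with the line
   [a1 * (w1 - x) + a2 * (w2 - y) + a0 = 0]. *)
Definition cone_conic (x y r a1 a2 a0 : R) : @conic R :=
  (r * a1 ^+ 2 - a0 ^+ 2, 2 * r * a1 * a2, r * a2 ^+ 2 - a0 ^+ 2,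
   (- 2 * (r * a1 ^+ 2 - a0 ^+ 2) * x - 2 * r * a1 * a2 * y,
    - 2 * (r * a2 ^+ 2 - a0 ^+ 2) * y - 2 * r * a1 * a2 * x,
    r * (a1 * x + a2 * y) ^+ 2 - a0 ^+ 2 * (x ^+ 2 + y ^+ 2))).

Lemma cone_conicE x y r a1 a2 a0 w1 w2 :
  conic_eval (cone_conic x y r a1 a2 a0) w1 w2 =
  r * (a1 * (w1 - x) + a2 * (w2 - y)) ^+ 2 - a0 ^+ 2 * ((w1 - x) ^+ 2 + (w2 - y) ^+ 2).
Proof. by rewrite /conic_eval /=; ring. Qed.

Lemma cone_conic_neq0 x y r a1 a2 a0 : 0 < r -> a1 != 0 \/ a2 != 0 ->
  cone_conic x y r a1 a2 a0 <> ((0, 0, 0), (0, 0, 0)).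
Proof.
move=> r0 a [E1 E2 E3 _ _ _].
have : r * (a1 ^+ 2 - a2 ^+ 2) = 0 by lra.
move/eqP; rewrite mulf_eq0 (gt_eqF r0) /= => /eqP e.
have /eqP : r * (2 * a1 * a2) = 0 by lra.
rewrite mulf_eq0 (gt_eqF r0) /= -mulrA mulf_eq0 pnatr_eq0 /= mulf_eq0 => /orP[]/eqP z0;
  rewrite z0 expr0n /= in e; case: a; rewrite ?z0 ?eqxx // => /negP; apply; rewrite -sqrf_eq0; apply/eqP; lra.
Qed.

(** Where all slacks of [f] are nonnegative, the point lies within the walls and [f] is the first
    face hit. Each slack is affine in [w], with gradient ([slack1], [slack2]), so this cell is a
    convex polygon. *)
Definition slack f k w1 w2 : R :=
  if vt k then b k - (p k * w1 + q k * w2) else Mx f w1 w2 - Mx k w1 w2.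

Definition slack1 f k : R := if vt k then - p k else cx f - cx k.
Definition slack2 f k : R := if vt k then - q k else cy f - cy k.

Lemma slackE f k x1 x2 w1 w2 :
  slack f k w1 w2 = slack f k x1 x2 + (slack1 f k * (w1 - x1) + slack2 f k * (w2 - x2)).
Proof. by rewrite /slack /slack1 /slack2; case: ifP => _; rewrite ?exit_rateE; ring. Qed.

(** The rays from the centre of [f] that meet the boundary line of the cell on the circle itself:
    there the exit point would be ideal and show no adjacency. *)
Definition slack_conic f k : @conic R :=
  cone_conic (cx f) (cy f) (rho2 f) (slack1 f k) (slack2 f k) (slack f k (cx f) (cy f)).

Lemma radical_axis (z1 z2 c1 c2 d1 d2 r s : R) :
  r - (z1 - c1) ^+ 2 - (z2 - c2) ^+ 2 = s - (z1 - d1) ^+ 2 - (z2 - d2) ^+ 2 ->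
  (d1 - c1) ^+ 2 + (d2 - c2) ^+ 2 = r + s ->
  (z1 - c1) * (d1 - c1) + (z2 - c2) * (d2 - c2) = r.
Proof. lra. Qed.

(** Pushing [w] away from the centre of [f] until it leaves the cell of [f] leads to a point [z] on
    the boundary line with some [k]. This [k] is the required neighbour, and [w] lies between the
    centre and a point of the radical axis, as [flag_cover] demands. *)
Lemma flag_at f w1 w2 : ~~ vt f -> base_domain (w1, w2) ->
  (forall k, ~~ vt k -> Mx k w1 w2 <= Mx f w1 w2) -> 0 < pwr f w1 w2 ->
  (w1 - cx f) ^+ 2 + (w2 - cy f) ^+ 2 <> 0 ->
  (forall k, slack1 f k != 0 \/ slack2 f k != 0 -> conic_eval (slack_conic f k) w1 w2 <> 0) ->
  exists g sg, [/\ ~~ vt g, adjh f g & flag_bound w1 w2 f g sg = (2 * pwr f w1 w2)^-1].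
Proof.
move=> vf Qw Mmax pf; set y1 := w1 - cx f; set y2 := w2 - cy f => yn0 gen.
have y0 : 0 < y1 ^+ 2 + y2 ^+ 2.
  by rewrite lt_neqAle eq_sym addr_ge0 ?sqr_ge0 // andbT; apply/eqP.
have [T T1 hT] := far_out w1 w2 y0.
pose S k := slack1 f k * y1 + slack2 f k * y2.
have [k|/=|t [k [/andP[t0 t1] tA tk kn]]] := @first_exit R _ (fun k => slack f k w1 w2) (fun k => T * S k).
- rewrite /slack; case: ifP => vk; first by rewrite subr_ge0; exact: Qw.
  by rewrite subr_ge0 Mmax // vk.
- apply: contrapT => no; have [|i vi] := @covered_closed (w1 + T * y1) (w2 + T * y2).
    move=> i vi /=; rewrite leNgt; apply/negP => lt; apply: no; exists i.
    by rewrite /S /slack /slack1 /slack2 vi; lra.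
  by rewrite leNgt hT.
have T0 : 0 < T by lra.
pose s := 1 + t * T; have s1 : 1 <= s by rewrite /s lerDl mulr_ge0 // ltW.
have s0 : 0 < s by lra.
set z1 := w1 + t * T * y1; set z2 := w2 + t * T * y2.
have zs1 : z1 - cx f = s * y1 by rewrite /z1 /s /y1; ring.
have zs2 : z2 - cy f = s * y2 by rewrite /z2 /s /y2; ring.
have slz l : slack f l z1 z2 = slack f l w1 w2 + t * (T * S l).
  by rewrite (slackE f l w1 w2 z1 z2) /S /z1 /z2; ring.
have slc l : slack f l z1 z2 = slack f l (cx f) (cy f) + s * S l.
  by rewrite (slackE f l (cx f) (cy f) z1 z2) zs1 zs2 /S; ring.
have Sk : S k < 0.
  rewrite -(pmulr_rlt0 _ T0) ltNge; apply/negP => TS.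
  have : 0 <= t * (T * S k) by rewrite mulr_ge0.
  have : slack f k w1 w2 = - (t * (T * S k)) by lra.
  have : 0 <= slack f k w1 w2.
    have := Qw k; have := Mmax k; rewrite /slack; case: ifP => vk.
      by rewrite subr_ge0 => _; apply.
    by rewrite subr_ge0 => h1 _; exact: h1.
  lra.
have Qz : base_domain (z1, z2).
  by move=> i vi /=; have := tA i; rewrite -slz /slack vi subr_ge0.
have Mz i : ~~ vt i -> Mx i z1 z2 <= Mx f z1 z2.
  by move=> vi; have := tA i; rewrite -slz /slack (negbTE vi) subr_ge0.
(* Some disc contains [z], and at [z] no face has a larger power than [f]. *)
have pz : 0 <= pwr f z1 z2.
  have [i vi] := covered_closed Qz; have := Mz i vi; rewrite /power; lra.
have a0 : slack f k (cx f) (cy f) = - (s * S k) by have := slc k; rewrite slz tk; lra.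
(* A zero power would put [z] on the circle of [f] and thus [w] on [slack_conic f k]. *)
have pz0 : 0 < pwr f z1 z2.
  rewrite lt_neqAle pz andbT; apply/eqP => z0; apply: (gen k).
    apply: contrapT => /not_orP[/negP/negPn/eqP E1 /negP/negPn/eqP E2].
    by move: Sk; rewrite /S E1 E2 !mul0r addr0 ltxx.
  rewrite cone_conicE a0 -/y1 -/y2 -/(S k).
  have -> : rho2 f = s ^+ 2 * (y1 ^+ 2 + y2 ^+ 2).
    by move/esym: z0; rewrite powerE // zs1 zs2; lra.
  by ring.
(* The walk cannot leave through a wall: an adjacent wall contains the centre, so its slack is zero
   there and could not decrease to zero again along the ray. *)
have [vk|vk] := boolP (vt k).
  have zk : p k * z1 + q k * z2 = b k.
    by move: tk; rewrite -slz /slack vk; lra.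
  have fk := adj_max_vert vf vk Qz pz0 Mz zk.
  move: a0; rewrite /slack vk adj_vert // subrr => /esym/eqP.
  by rewrite oppr_eq0 mulf_eq0 (gt_eqF s0) (lt_eqF Sk).
have fk : f != k.
  apply/eqP => fk; move: Sk; rewrite /S /slack1 /slack2 (negbTE vk) fk !subrr !mul0r addr0 ltxx //.
have Mk : Mx k z1 z2 = Mx f z1 z2.
  by move: tk; rewrite -slz /slack (negbTE vk); lra.
have afk := adj_max_nonvert fk vf vk Qz pz0 Mz Mk.
have hu := adj_nonvert vf vk afk; rewrite -(rho_sqr vf) -(rho_sqr vk) in hu.
pose cr := (z2 - cy f) * (cx k - cx f) - (z1 - cx f) * (cy k - cy f).
pose sg : bool := (cr < 0)%R; exists k, sg; split=> //.
have sg1 : (-1) ^+ sg * (-1) ^+ sg = 1 :> R.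
  by rewrite -expr2 sqrr_sign.
have th0 : 0 <= s^-1 by rewrite invr_ge0 ltW.
have th1 : s^-1 <= 1 by rewrite invf_le1.
have rad : (z1 - cx f) * (cx k - cx f) + (z2 - cy f) * (cy k - cy f) = rho f ^+ 2.
  have : pwr f z1 z2 = pwr k z1 z2 by rewrite /power Mk.
  rewrite (powerE _ _ vf) (powerE _ _ vk) -(rho_sqr vf) -(rho_sqr vk) => e.
  exact: radical_axis e hu.
have inr : (z1 - cx f) ^+ 2 + (z2 - cy f) ^+ 2 <= rho f ^+ 2.
  by move: pz; rewrite (powerE _ _ vf) -(rho_sqr vf) -addrA -opprD subr_ge0.
have sgc : 0 <= (-1) ^+ sg * cr.
  by rewrite /sg; case: ltP => c0; rewrite ?expr1 ?expr0 ?mul1r // mulN1r oppr_ge0 ltW.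
have := flag_cover (rho_gt0 vf) (rho_gt0 vk) hu th0 th1 rad inr sg1 sgc.
have -> : cx f + s^-1 * (z1 - cx f) = w1.
  by rewrite zs1 mulrA mulVf ?gt_eqF // mul1r /y1 addrC subrK.
have -> : cy f + s^-1 * (z2 - cy f) = w2.
  by rewrite zs2 mulrA mulVf ?gt_eqF // mul1r /y2 addrC subrK.
move=> ht; rewrite /flag_bound /flag_density indicE mem_set // mul1r.
by rewrite (powerE _ _ vf) (rho_sqr vf).
Qed.

Definition inner_flag (x : 'I_n * 'I_n) : bool := [&& ~~ vt x.1, ~~ vt x.2 & adjh x.1 x.2].

Definition flags_density (w1 w2 : R) : R :=
  \sum_(x | inner_flag x) (flag_bound w1 w2 x.1 x.2 false + flag_bound w1 w2 x.1 x.2 true).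

Lemma flag_bound_ge0 w1 w2 x sg : inner_flag x -> 0 <= flag_bound w1 w2 x.1 x.2 sg.
Proof.
move=> /and3P[vf vg fg]; apply: flag_density_ge0; rewrite ?rho_gt0 //; last by rewrite -expr2 sqrr_sign.
by rewrite adj_nonvert // !rho_sqr.
Qed.

Lemma measurable_flag_bound f g sg :
  measurable_fun setT (fun w : TR * TR => (flag_bound w.1 w.2 f g sg)%:E).
Proof. exact: measurable_flag_density. Qed.

Lemma integral_flag_bound x sg : inner_flag x ->
  (\int[mu]_w1 \int[mu]_w2 (flag_bound w1 w2 x.1 x.2 sg)%:E = (half (rho x.1 / rho x.2))%:E)%E.
Proof.
move=> /and3P[vf vg fg]; apply: integral_flag; rewrite ?rho_gt0 //; last by rewrite -expr2 sqrr_sign.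
by rewrite adj_nonvert // !rho_sqr.
Qed.

Let disc_conic f : @conic R :=
  (1, 0, 1, (- 2 * cx f, - 2 * cy f, cx f ^+ 2 + cy f ^+ 2)).

Let circle_conic f : @conic R :=
  (1, 0, 1, (- 2 * cx f, - 2 * cy f, cx f ^+ 2 + cy f ^+ 2 - rho2 f)).

Lemma ray_volume_le_flags w1 w2 :
  (forall f, ~~ vt f -> (w1 - cx f) ^+ 2 + (w2 - cy f) ^+ 2 <> 0) ->
  (forall f, ~~ vt f -> pwr f w1 w2 <> 0) ->
  (forall f k, ~~ vt f -> slack1 f k != 0 \/ slack2 f k != 0 ->
    conic_eval (slack_conic f k) w1 w2 <> 0) ->
  (ray_volume P v e1 e2 w1 w2 <= (flags_density w1 w2)%:E)%E.
Proof.
move=> gen1 gen2 gen3.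
have G0 : 0 <= flags_density w1 w2.
  by apply: sumr_ge0 => x xi; rewrite addr_ge0 // flag_bound_ge0.
have [[i vi lt]|no] := pselect (exists2 i, vt i & b i < p i * w1 + q i * w2).
  by rewrite (ray_volume_out hrep fr cv vi lt) lee_fin.
have Qw : base_domain (w1, w2).
  by move=> i vi /=; rewrite leNgt; apply/negP => lt; apply: no; exists i.
have [i0 vi0 pi0] := covered_closed Qw.
case: (@arg_maxP _ _ _ i0 (fun i => ~~ vt i) (fun i => Mx i w1 w2) vi0) => f vf fmax.
have pf : 0 < pwr f w1 w2.
  rewrite lt_neqAle eq_sym; apply/andP; split; first by apply/eqP; exact: gen2.
  by apply: le_trans pi0 _; rewrite /power lerD2r ler_pM2l ?ltr0n //; exact: fmax.
have [g [sg [vg fg E]]] := flag_at vf Qw fmax pf (gen1 f vf) (fun k => @gen3 f k vf).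
apply: le_trans (ray_volume_le hrep fr cv vf pf) _; rewrite -E lee_fin.
have fi : inner_flag (f, g) by rewrite /inner_flag vf vg fg.
have rest : 0 <= \sum_(x | inner_flag x && (x != (f, g)))
    (flag_bound w1 w2 x.1 x.2 false + flag_bound w1 w2 x.1 x.2 true).
  by apply: sumr_ge0 => x /andP[xi _]; rewrite addr_ge0 // flag_bound_ge0.
rewrite /flags_density (bigD1 (f, g)) //= -[leLHS]addr0 lerD //.
have := flag_bound_ge0 w1 w2 true fi; have := flag_bound_ge0 w1 w2 false fi => /=.
by case: sg {E} => h1 h2; rewrite ?lerDl ?lerDr.
Qed.

Lemma integral2_sum (I : Type) (r : seq I) (Q : pred I) (F : I -> R -> R -> R) :
  (forall i, Q i -> measurable_fun setT (fun w : TR * TR => (F i w.1 w.2)%:E)) ->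
  (forall i x y, Q i -> 0 <= F i x y) ->
  (\int[mu]_x \int[mu]_y (\sum_(i <- r | Q i) F i x y)%:E =
   \sum_(i <- r | Q i) \int[mu]_x \int[mu]_y (F i x y)%:E)%E.
Proof.
move=> mF F0; elim: r => [|i r IH].
  rewrite big_nil; apply: integral0_eq => x _; apply: integral0_eq => y _.
  by rewrite big_nil.
rewrite big_cons -IH; case: ifP => Qi; last first.
  by apply: eq_integral => x _; apply: eq_integral => y _; rewrite big_cons Qi.
rewrite -(@integral2D R (fun x y => (F i x y)%:E) (fun x y => (\sum_(j <- r | Q j) F j x y)%:E)).
- by apply: eq_integral => x _; apply: eq_integral => y _; rewrite big_cons Qi EFinD.
- exact: mF.
- by move=> x y; rewrite lee_fin F0.
- apply/measurable_EFinP.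
  pose F' j (w : TR * TR) := if Q j then F j w.1 w.2 else 0.
  have mF' j : measurable_fun setT (F' j).
    rewrite /F'; case: (boolP (Q j)) => Qj; last exact: measurable_cst.
    exact: (iffLR (measurable_EFinP _ _) (mF j Qj)).
  apply: eq_measurable_fun (measurable_sum r mF') => w _.
  by rewrite /F' [RHS]big_mkcond.
- by move=> x y; rewrite lee_fin sumr_ge0 // => j Qj; exact: F0.
Qed.

(** Exchanging the two faces of a flag inverts the ratio of radii, so half of the double sum may be
    taken with inverse ratios and each flag compared with the regular one. *)
Lemma flag_sum_le :
  \sum_(x | inner_flag x) (half (rho x.1 / rho x.2) + half (rho x.1 / rho x.2)) <=
  #|inner_flag|%:R * (2 * half 1).
Proof.
have sw : \sum_(x | inner_flag x) half (rho x.1 / rho x.2) =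
    \sum_(x | inner_flag x) half (rho x.1 / rho x.2)^-1.
  rewrite (reindex_inj (h := fun x : 'I_n * 'I_n => (x.2, x.1))); last by move=> [? ?] [? ?] [-> ->].
  apply: eq_big => [x|x _]; last by rewrite invf_div.
  by rewrite /inner_flag /= adj_sym andbCA.
rewrite big_split /= {2}sw -big_split /= mulr_natl -sumr_const; apply: ler_sum => x.
by move=> /and3P[vf vg _]; apply: half_inv_le; rewrite divr_gt0 ?rho_gt0.
Qed.

Lemma volume_le_flags : (hvolume P <= (#|inner_flag|%:R * (2 * half 1))%:E)%E.
Proof.
(* The points to avoid: centres of discs, as zeros of a sum of two squares, circles, and the rays of
   [slack_conic]. The latter is the zero polynomial for [k = f], for instance, which is why [qs]
   filters the list. *)
pose L : seq ((R * R * R) * (R * R * R)) :=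
  [seq disc_conic f | f <- enum 'I_n] ++ [seq circle_conic f | f <- enum 'I_n] ++
  [seq slack_conic x.1 x.2 | x <- enum {: 'I_n * 'I_n}].
pose qs := [seq q <- L | q != ((0, 0, 0), (0, 0, 0))].
rewrite volE; apply: (@le_trans _ _ (\int[mu]_w1 \int[mu]_w2 (flags_density w1 w2)%:E)%E).
  apply: (@le_integral2_off_conics R qs).
  - by move=> c; rewrite mem_filter => /andP[/eqP].
  - exact: measurable_ray_volume hrep.
  - by move=> x y; exact: ray_volume_ge0.
  - apply/measurable_EFinP.
    pose F (x : 'I_n * 'I_n) (w : TR * TR) :=
      if inner_flag x then flag_bound w.1 w.2 x.1 x.2 false + flag_bound w.1 w.2 x.1 x.2 true else 0.
    have mF x : measurable_fun setT (F x).
      rewrite /F; case: (inner_flag x); last exact: measurable_cst.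
      by apply: measurable_funD; apply/measurable_EFinP; exact: measurable_flag_bound.
    apply: eq_measurable_fun (measurable_sum (index_enum _) mF) => w _.
    by rewrite /F /flags_density [RHS]big_mkcond.
  - by move=> x y; rewrite lee_fin sumr_ge0 // => z zi; rewrite addr_ge0 // flag_bound_ge0.
  move=> x y off; apply: ray_volume_le_flags.
  - move=> f _ e; apply: (off (disc_conic f)).
      rewrite mem_filter mem_cat map_f ?mem_enum // andbT.
      by apply/eqP => -[/eqP]; rewrite oner_eq0.
    by rewrite -e /conic_eval /=; ring.
  - move=> f vf e; apply: (off (circle_conic f)).
      rewrite mem_filter !mem_cat (map_f circle_conic) ?mem_enum // orbT andbT.
      by apply/eqP => -[/eqP]; rewrite oner_eq0.
    by apply: oppr_inj; rewrite oppr0 -e powerE // /conic_eval /=; ring.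
  move=> f k vf nz; apply: off.
  rewrite mem_filter !mem_cat (map_f (fun x => slack_conic x.1 x.2) (x := (f, k))) ?mem_enum // !orbT andbT.
  by apply/eqP; apply: cone_conic_neq0 => //; exact: rho2_gt0.
rewrite /flags_density integral2_sum.
- apply: le_trans (_ : (\sum_(x | inner_flag x) (half (rho x.1 / rho x.2) + half (rho x.1 / rho x.2)))%:E <= _)%E; last first.
    by rewrite lee_fin flag_sum_le.
  rewrite -sumEFin; apply: lee_sum => x xi.
  have E := @integral2D R _ _ (measurable_flag_bound x.1 x.2 false)
    (fun w1 w2 => (_ : (0 <= (flag_bound w1 w2 x.1 x.2 false)%:E)%E))
    (measurable_flag_bound x.1 x.2 true) (fun w1 w2 => (_ : (0 <= (flag_bound w1 w2 x.1 x.2 true)%:E)%E)).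
  rewrite (integral_flag_bound _ xi) (integral_flag_bound _ xi) in E.
  rewrite EFinD -E //; by move=> *; rewrite lee_fin flag_bound_ge0.
- move=> x xi; apply/measurable_EFinP; apply: measurable_funD; apply/measurable_EFinP; exact: measurable_flag_bound.
- by move=> x w1 w2 xi; rewrite addr_ge0 // flag_bound_ge0.
Qed.

End Planar.

(** * An ideal vertex on a prescribed face *)

Section VertexOnFacet.
Context {R : realType}.
Local Notation vec := 'rV[R]_3.
Variables (P : set vec) (n : nat) (h : 'I_n -> vec * R).
Hypotheses (hrep : is_hrep P h) (irr : irredundant h) (Pint : interior P !=set0).
Hypothesis ideal : vertex P `<=` absolute (R:=R).

Lemma closure_ball x : closure P x -> dot x x <= 1.
Proof.
have C : closed [set y : vec | dot y y <= 1].
  rewrite (_ : [set _ | _] = (fun y => dot y y) @^-1` [set t | t <= 1]) //.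
  by move/continuous_closedP: (@dotxx_continuous R); apply; exact: closed_le.
have PC : P `<=` [set y : vec | dot y y <= 1].
  by move=> y /(hrep.2 y)[Hy _]; exact: ltW.
by move=> /(closureS PC); rewrite -(iffLR (closure_id _) C).
Qed.

Lemma compact_facet i : compact (closure P `&` [set x | dot (h i).1 x = (h i).2]).
Proof.
apply: bounded_closed_compact.
  exists 1; split; first exact: num_real.
  move=> M M1 x [/closure_ball x1 _] /=; rewrite [leLHS]/Num.norm /= mx_normrE.
  apply/bigmax_leP; split; first by rewrite ltW // (lt_trans ltr01).
  move=> [k j] _ /=; rewrite ord1; apply: le_trans (ltW M1).
  have : x 0 j ^+ 2 <= 1.
    apply: le_trans x1; rewrite dotE.
    by have := sqr_ge0 (x 0 0); have := sqr_ge0 (x 0 1); have := sqr_ge0 (x 0 (1 + 1));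
      case: (ord3P j) => ->; lra.
  by rewrite -real_normK ?num_real // expr_le1.
apply: closedI; first exact: closed_closure.
rewrite (_ : [set _ | _] = (fun y => dot (h i).1 y) @^-1` [set (h i).2]) //.
by move/continuous_closedP: (@dot_continuous R (h i).1); apply; exact: closed_eq.
Qed.

(* A point of maximal norm of the compact face is extreme, by strict convexity of the norm. *)
Lemma ideal_vertex_on_facet i : exists v, [/\ closure P v, dot v v = 1 & vert h v i].
Proof.
set K := closure P `&` [set x | dot (h i).1 x = (h i).2].
have K0 : K !=set0.
  have [z [Pz iz _]] := facet_pt hrep irr Pint i.
  by exists z; split => //; exact: subset_closure.
have cf : {within K, continuous (fun x : vec => dot x x)}.
  by apply: continuous_subspaceT; exact: dotxx_continuous.
have [v] := compact_EVT_max K0 (@compact_facet i) cf.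
rewrite in_setE => -[cv iv] vmax; exists v; split=> //; last by rewrite /vert /kap iv subrr.
apply: ideal; split=> // x y t cx cy /andP[t0 t1] vE.
have hx := closure_le hrep i cx; have hy := closure_le hrep i cy.
have e : t * ((h i).2 - dot (h i).1 x) + (1 - t) * ((h i).2 - dot (h i).1 y) = 0.
  by rewrite -iv vE !dotL; ring.
have u0 : 0 < 1 - t by rewrite subr_gt0.
have dx : 0 <= t * ((h i).2 - dot (h i).1 x) by rewrite mulr_ge0 ?subr_ge0 // ltW.
have dy : 0 <= (1 - t) * ((h i).2 - dot (h i).1 y) by rewrite mulr_ge0 ?subr_ge0 // ltW.
have ex : dot (h i).1 x = (h i).2.
  have /eqP : t * ((h i).2 - dot (h i).1 x) = 0 by lra.
  by rewrite mulf_eq0 (gt_eqF t0) subr_eq0 => /eqP.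
have ey : dot (h i).1 y = (h i).2.
  have /eqP : (1 - t) * ((h i).2 - dot (h i).1 y) = 0 by lra.
  by rewrite mulf_eq0 (gt_eqF u0) subr_eq0 => /eqP.
have vx : dot x x <= dot v v by apply: vmax; rewrite in_setE.
have vy : dot y y <= dot v v by apply: vmax; rewrite in_setE.
have E : dot v v = t * dot x x + (1 - t) * dot y y - t * (1 - t) * dot (x - y) (x - y).
  by rewrite vE !dotL (dotC y x); ring.
have d0 := dotxx_ge0 (x - y).
apply/eqP; rewrite -subr_eq0; apply/eqP; apply: dotxx_eq0; apply/eqP.
rewrite eq_le d0 andbT -(pmulr_rle0 _ (mulr_gt0 t0 u0)).
have : 0 <= t * (dot v v - dot x x) by rewrite mulr_ge0 ?subr_ge0 // ltW.
have : 0 <= (1 - t) * (dot v v - dot y y) by rewrite mulr_ge0 ?subr_ge0 // ltW.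
lra.
Qed.

End VertexOnFacet.

(** * Counting ordered adjacencies that avoid a set of faces *)

Section Counting.
Variables (T : finType) (a : rel T) (V : pred T).
Local Open Scope nat_scope.

Let links (A B : pred T) := \sum_(x | A x) \sum_(y | B y) (a x y : nat).

Let card_links A : \sum_(x | A x) #|a x| = links A V + links A (predC V).
Proof.
rewrite -big_split; apply: eq_bigr => x _.
by rewrite -sum1_card big_mkcond (bigID V) /=; congr (_ + _); apply: eq_bigr => y _; rewrite unfold_in; case: (a x y).
Qed.

(** The degree sums [k] over the m faces of [V] and [k'] over the others split into pairs inside [V]
    ([d]), across ([c]) and outside ([f]). From c >= k - 2 m one gets f < 4 m' - m = 4 N - 5 m in
    the first case and f <= 3 m' - m in the second. *)
Let count_bound (N m m' k k' f c d : nat) : k' = c + f -> k = d + c -> d <= 2 * m -> m + m' = N ->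
  4 <= m -> 17 <= N -> (k' <= m' * 4 /\ m * 3 < k) \/ (k' <= m' * 3 /\ m * 3 <= k) ->
  f + 20 < 4 * N.
Proof. lia. Qed.

Lemma card_inner_links : symmetric a ->
  (forall x, #|a x| = 3 \/ #|a x| = 4) -> 4 <= #|V| ->
  (forall x, V x -> #|[pred y | V y && a x y]| <= 2) ->
  (exists2 x, V x & #|a x| = 4) \/ (forall x, #|a x| = 3) -> 17 <= #|T| ->
  #|[pred z : T * T | [&& ~~ V z.1, ~~ V z.2 & a z.1 z.2]]| + 20 < 4 * #|T|.
Proof.
move=> sym deg V4 nb quad T17.
have -> : #|[pred z : T * T | [&& ~~ V z.1, ~~ V z.2 & a z.1 z.2]]| = links (predC V) (predC V).
  rewrite /links pair_big /= -sum1_card big_mkcond [RHS]big_mkcond; apply: eq_bigr => -[x y] _ /=.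
  by rewrite inE /=; case: (V x) => //=; case: (V y) => //=; case: (a x y).
have swap : links (predC V) V = links V (predC V).
  by rewrite /links exchange_big; apply: eq_bigr => x _; apply: eq_bigr => y _; rewrite sym.
have VV : links V V <= 2 * #|V|.
  rewrite /links mulnC -sum_nat_const; apply: leq_sum => x /nb; apply: leq_trans.
  rewrite -sum1_card big_mkcond [X in _ <= X]big_mkcond; apply: leq_sum => y _.
  by rewrite inE /=; case: (V y) => //=; case: (a x y).
have cT : #|V| + #|predC V| = #|T| := cardC V.
have bound c (A : pred T) : (forall x, #|a x| <= c) -> \sum_(x | A x) #|a x| <= #|A| * c.
  by move=> ac; rewrite -sum_nat_const; apply: leq_sum.
have bound' c (A : pred T) : (forall x, c <= #|a x|) -> #|A| * c <= \sum_(x | A x) #|a x|.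
  by move=> ac; rewrite -sum_nat_const; apply: leq_sum.
have E1 := card_links (predC V); have E2 := card_links V.
have ge3 x : 3 <= #|a x| by case: (deg x) => ->.
rewrite swap in E1; apply: (count_bound E1 E2 VV cT V4 T17).
case: quad => [[x Vx x4]|all3]; [left|right]; split.
- by apply: bound => x'; case: (deg x') => ->.
- rewrite -sum_nat_const (bigD1 x) //= [X in _ < X](bigD1 x) //= x4 -addSn leq_add //.
  exact: leq_sum.
- by apply: bound => x'; rewrite all3.
- exact: bound'.
Qed.

End Counting.

Theorem theorem3p3 (R : realType) (P : set 'rV[R]_3) (N : nat)
  (hP : ideal_right_angled_polyhedron P)
  (hN : (face P #= `I_N)%card)
  (hN17 : (17 <= N)%N)
  (hfaces : forall F : set 'rV[R]_3, face P F ->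
     triangular P F \/ quadrilateral P F) :
  (hvolume P < (N%:R - 5)%:E * (v8 R * (2^-1)%:E))%E.
Proof.
have [[rep Pint] fin ideal ra] := hP.
have [n [h [hrep irr]]] := irredundant_hrep rep.
have Nn := card_faces hrep irr Pint hN; subst N.
have deg i : #|adj P h i| = 3%N \/ #|adj P h i| = 4%N.
  by case: (hfaces _ (facet_face hrep irr Pint i)) => /(card_sides hrep irr Pint ideal ra);
    [left|right].
have n0 : (0 < n)%N by apply: leq_trans hN17.
(* The face that is to contain [v]: a quadrilateral if there is one, for the strict inequality in
   the count; otherwise any face. *)
have [i0 quad] : exists i0, #|adj P h i0| = 4%N \/ forall i, #|adj P h i| = 3%N.
  have [[i i4]|no] := pselect (exists i, #|adj P h i| = 4%N); first by exists i; left.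
  exists (Ordinal n0); right => i; case: (deg i) => // i4; case: no; by exists i.
have [v [cv vv vert0]] := ideal_vertex_on_facet hrep irr Pint ideal i0.
have [e1 [e2 [fr vol]]] := hvolume_cone vv.
have volE := vol P (measurable_P hrep).
have count : (#|inner_flag P h v| + 20 < 4 * #|'I_n|)%N.
  apply: (@card_inner_links _ (adj P h) (vert h v)) => //.
  - exact: adj_sym.
  - exact: (four_vert hrep irr Pint ideal ra fr cv fin volE).
  - exact: (vert_neighbours hrep irr Pint ideal ra fr).
  - by case: quad => [i4|]; [left; exists i0|right].
  - by rewrite card_ord.
rewrite card_ord in count.
have half0 := @half1_gt0 R.
have n5 : 0 < n%:R - 5 :> R by rewrite subr_gt0 ltr_nat (leq_trans _ hN17).
(* The middle term is (4 n - 20) times [2 * half 1], the bound obtained for 4 n - 20 flags; [count]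
   says that there are strictly fewer. *)
apply: (@lt_le_trans _ _ ((n%:R - 5) * (16 * half 1 * 2^-1))%:E).
  apply: le_lt_trans (volume_le_flags hrep irr Pint ideal ra fr cv fin volE) _.
  rewrite lte_fin; move: count; rewrite -(ltr_nat R) natrD natrM => count.
  have : (#|inner_flag P h v|%:R + 20) * half 1 < 4 * n%:R * half (1 : R) by rewrite ltr_pM2r.
  lra.
rewrite EFinM lee_pmul2l ?lte_fin // EFinM.
apply: lee_wpmul2r; first by rewrite lee_fin invr_ge0.
exact: v8_ge.
Qed.
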